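(* Let $\Psi\in\mathsf{K}\mathsf{B}\bigl(\mathsf{V};\mathsf{V}\otimes_{\mathrm M}\mathsf{B}(\mathsf{K})\bigr)$, let $$\psi(a):=\Delta^\perp(\widetilde\pi\circ\Psi)(a)\Delta^\perp+\Delta^\perp(\widetilde\pi\circ\delta^\perp\circ\Psi)(a)\Delta+\Delta(\widetilde\pi\circ\delta^\perp\circ\Psi)(a)\Delta^\perp+\Delta\,\widetilde\pi\bigl(\widetilde P_0^\perp\Psi(a)\widetilde P_0^\perp\bigr)\Delta\qquad(a\in\mathsf{V}),$$ and let $X,Y\in\ker\rho\subseteq\mathsf{B}(\mathsf{K})$. Then, for all $a\in\mathsf{V}$, $$E^\omega\psi(a)E_\omega=E^\omega\widetilde\pi(\Psi(a))E_\omega=\widetilde\rho(\Psi(a)),$$ $$E^\omega\psi(a)E_{[Y]}=E^\omega\widetilde\pi(\Psi(a))E_{[d^\perp(Y)]},$$ $$E^{[X]}\psi(a)E_\omega=E^{[d^\perp(X)]}\widetilde\pi(\Psi(a))E_\omega$$ and $$E^{[X]}\psi(a)E_{[Y]}=E^{[P_0^\perp X]}\widetilde\pi(\Psi(a))E_{[P_0^\perp Y]}.$$ Thus, if $N:=\dim\mathsf{K}<\infty$, there can be no more than $$2(Nk-l)+(N-k)^2k^2$$ independent noises in the quantum stochastic differential equation $dj^\psi_t(a)=j^\psi_t\,d\Lambda_{\psi(a)}(t)$ satisfied by the cocycle $j^\psi$, where $k:=\dim\mathsf{K}_0\in\{1,\dots,N\}$ and $l:=\operatorname{rank}d_0\i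n\{1,\dots,k^2\}$.
   Context: **General.** Hilbert spaces are complex with inner products linear in the second variable. $\mathsf{B}(\mathsf{H})$ denotes the bounded operators on $\mathsf{H}$; $\otimes$ and $\bar\otimes$ denote Hilbert-space and ultraweak tensor products. $\mathsf{h}$ is a fixed Hilbert space; for a Hilbert space $\mathsf{H}$ and $x\in\mathsf{H}$, $E_x:\mathsf{h}\to\mathsf{h}\otimes\mathsf{H}$, $u\mapsto u\otimes x$, and $E^x:=(E_x)^*$. $\mathsf{V}\subseteq\mathsf{B}(\mathsf{h})$ is a fixed concrete operator space (norm-closed subspace). $\mathsf{V}\otimes_{\mathrm M}\mathsf{B}(\mathsf{H}):=\{T\in\mathsf{B}(\mathsf{h}\otimes\mathsf{H}):E^xTE_y\in\mathsf{V}\ \forall x,y\in\mathsf{H}\}$. For operator spaces $\mathsf{V},\mathsf{W}$ and non-zero $\mathsf{H}$, $\mathsf{H}\mathsf{B}(\mathsf{V};\mathsf{W})$ is the space of linear maps $\phi:\mathsf{V}\to\mathsf{W}$ that are $\mathsf{H}$ bounded, i.e. bounded if $\dim\mathsf{H}<\infty$ and completely bounded if $\dim\mathsf{H}=\infty$. **Particle state.** $\rho$ is a normal state on $\mathsf{B}(\mathsf{K})$, $\mathsf{K}$ a Hilbert space, with density matrix $\varrho$. $\mathsf{K}_0:=\overline{\operatorname{im}\varrho^{1/2}}$, $P_0$ is the orthogonal projection of $\mathsf{K}$ onto $\mathsf{K}_0$, $P_0^\perp:=I_{\mathsf{K}}-P_0$, $\widetilde P_0:=I_{\mathsf{h}}\otimes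 P_0$, $\widetilde P_0^\perp:=I_{\mathsf{h}\otimes\mathsf{K}}-\widetilde P_0$, $F_0:\mathsf{K}_0\hookrightarrow\mathsf{K}$ is the embedding. $\rho_0(X):=\rho(F_0XF_0^* )$ is a faithful normal state on $\mathsf{B}(\mathsf{K}_0)$. $d_0$ is a fixed conditional expectation from $\mathsf{B}(\mathsf{K}_0)$ onto a $*$-subalgebra $\mathcal{D}_0$ (a completely positive linear idempotent with range $\mathcal{D}_0$ that is a $\mathcal{D}_0$-$\mathcal{D}_0$-bimodule map) with $\rho_0\circ d_0=\rho_0$; it is automatically ultraweakly continuous and unital. $d(X):=F_0d_0(F_0^*XF_0)F_0^*$ on $\mathsf{B}(\mathsf{K})$, $d^\perp:=\mathrm{id}_{\mathsf{B}(\mathsf{K})}-d$, $\delta:=\mathrm{id}_{\mathsf{B}(\mathsf{h})}\bar\otimes d$, $\delta^\perp:=\mathrm{id}_{\mathsf{B}(\mathsf{h}\otimes\mathsf{K})}-\delta$. $\widetilde\rho:=\mathrm{id}_{\mathsf{B}(\mathsf{h})}\bar\otimes\rho:\mathsf{B}(\mathsf{h}\otimes\mathsf{K})\to\mathsf{B}(\mathsf{h})$. **Concrete GNS representation.** $\mathsf{H}^\dagger=\{u^\dagger:u\in\mathsf{H}\}$ is the Hilbert space conjugate to $\mathsf{H}$. $U_{\mathsf{K}}$ is the isometric isomorphism from the Hilbert–Schmidt operators on $\mathsf{K}$ onto $\mathsf{K}\otimes\mathsf{K}^\dagger$ with $U_{\mathsf{K}}(|u\rangle\langle v|)=u\otimes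 v^\dagger$. $\widehat{\mathsf{k}}:=\mathsf{K}\otimes\mathsf{K}_0^\dagger$, $\omega:=U_{\mathsf{K}}(\varrho^{1/2})\in\widehat{\mathsf{k}}$ (a unit vector), $\pi(X):=X\otimes I_{\mathsf{K}_0^\dagger}$, $[X]:=\pi(X)\omega=U_{\mathsf{K}}(X\varrho^{1/2})$, $\widetilde\pi(T):=T\otimes I_{\mathsf{K}_0^\dagger}$ for $T\in\mathsf{B}(\mathsf{h}\otimes\mathsf{K})$. $\mathsf{k}:=\widehat{\mathsf{k}}\ominus\mathbb{C}\omega$; $[X]\in\mathsf{k}$ iff $\rho(X)=0$. $\Delta$ is the orthogonal projection of $\mathsf{h}\otimes\widehat{\mathsf{k}}$ onto $\mathsf{h}\otimes\mathsf{k}$ and $\Delta^\perp:=I-\Delta$. **Cocycle.** For $x\in\mathsf{k}$, $\widehat x:=\omega+x$. $\mathcal{F}$ is Boson Fock space over $L^2(\mathbb{R}_+;\mathsf{k})$ with exponential vectors $\varepsilon(f)$, $\langle\varepsilon(f),\varepsilon(g)\rangle=\exp\int_0^\infty\langle f(t),g(t)\rangle\,dt$. The cocycle $j^\psi$ is the unique strongly regular adapted mapping process satisfying the quantum stochastic differential equation $dj^\psi_t(a)=j^\psi_t\,d\Lambda_{\psi(a)}(t)$, $j^\psi_0(a)=a\otimes I_{\mathcal{F}}$, which means that $$\langle u\varepsilon(f),(j^\psi_t(a)-a\otimes I_{\mathcal{F}})v\varepsilon(g)\rangle=\int_0^t\langle u\varepsilon(f),j^\psi_s(E^{\widehat{f(s)}}\psi(a)E_{\widehat{g(s)}})v\varepsilon(g)\rangle\,ds$$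 for all $u,v\in\mathsf{h}$, $f,g\in L^2(\mathbb{R}_+;\mathsf{k})$, $a\in\mathsf{V}$, $t\ge0$. **Number of noises.** When $\widehat{\mathsf{k}}$ is finite dimensional, the quantum stochastic differential equation has no more than $m$ independent noises if there is an orthonormal basis $e_1,\dots,e_r$ of $\mathsf{k}$ such that, with $e_0:=\omega$, there are at most $m$ pairs $(i,j)\ne(0,0)$ with $0\le i,j\le r$ for which the map $a\mapsto E^{e_i}\psi(a)E_{e_j}$ is not identically zero (each such pair corresponds to one quantum noise in the equation: creation, annihilation or gauge; the pair $(0,0)$ corresponds to time). *)

(* Defs.v *)
From HB Require Import structures.
From mathcomp Require Import all_boot all_order all_algebra.
From mathcomp Require Import complex.
From mathcomp Require Import all_classical all_reals all_analysis.

Set Implicit Arguments.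
Unset Strict Implicit.
Unset Printing Implicit Defensive.

Import Order.TTheory GRing.Theory Num.Theory.
Import numFieldNormedType.Exports.

Local Open Scope classical_set_scope.
Local Open Scope ring_scope.
Local Open Scope complex_scope.

Reserved Notation "''B' ( H , K )" (format "''B' ( H ,  K )").
Reserved Notation "''B' ( H )" (format "''B' ( H )").
Reserved Notation "A \bo B" (at level 40, left associativity).
Reserved Notation "x \ox [ T ] y"
  (at level 40, left associativity, format "x  \ox [ T ]  y").

(* The norm takes values in R[i], as for every normed module over R[i]; the
   order of R[i] makes `0 <= z` mean that z is real and nonnegative. *)
HB.mixin Record CompleteNormedModule_isHilbert (R : realType) H
    of CompleteNormedModule R[i] H := {
  dot : H -> H -> R[i] ;
  dotDr : forall x y z : H, dot x (y + z) = dot x y + dot x z ;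
  dotZr : forall (a : R[i]) (x y : H), dot x (a *: y) = a * dot x y ;
  dotC : forall x y : H, dot y x = (dot x y)^*%R ;
  dotxx : forall x : H, dot x x = `|x| ^+ 2 }.

#[short(type="hilbertType")]
HB.structure Definition Hilbert (R : realType) :=
  {H of CompleteNormedModule R[i] H & CompleteNormedModule_isHilbert R H}.

Notation "''[' x , y ]" := (dot x y) : ring_scope.

Section DotTheory.
Variables (R : realType) (H : hilbertType R).
Implicit Types (x y z : H) (a : R[i]).

Lemma dotDl x y z : '[x + y, z] = '[x, z] + '[y, z].
Proof. by rewrite dotC dotDr rmorphD/= -!dotC. Qed.

Lemma dotZl a x y : '[a *: x, y] = a^*%R * '[x, y].
Proof. by rewrite dotC dotZr rmorphM/= -dotC. Qed.

Lemma dot0r x : '[x, 0] = 0.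
Proof. by rewrite -(scale0r (0 : H)) dotZr mul0r. Qed.

Lemma cauchy_schwarz x y : `|'[x, y]| <= `|x| * `|y|.
Proof.
have [->|x0] := eqVneq x 0.
  by rewrite dotC dot0r conjC0 !normr0 mul0r.
have n0 : `|x| ^+ 2 != 0 by rewrite expf_eq0/= normr_eq0.
have np : 0 < `|x| ^+ 2 by rewrite lt_def n0 exprn_ge0.
rewrite -ler_sqr ?nnegrE ?mulr_ge0// exprMn.
set a := '[x, y].
have ortho : '[x, `|x| ^+ 2 *: y - a *: x] = 0.
  by rewrite dotDr -scaleNr !dotZr dotxx -/a mulNr mulrC subrr.
have : 0 <= '[`|x| ^+ 2 *: y - a *: x, `|x| ^+ 2 *: y - a *: x].
  by rewrite dotxx exprn_ge0.
rewrite {1}dotDl -scaleNr (dotZl _ x) scaleNr ortho mulr0 addr0 dotZl dotDr.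
rewrite -scaleNr !dotZr dotxx (dotC x y) -/a geC0_conj ?exprn_ge0//.
by rewrite pmulr_rge0// mulNr -normCK subr_ge0.
Qed.

End DotTheory.

Section Conjugate.
Variables (R : realType) (H : hilbertType R).

Definition conj_space : Type := H.
HB.instance Definition _ := GRing.Zmodule.copy conj_space H.

Definition conj_scale (a : R[i]) (x : conj_space) : conj_space :=
  a^*%R *: (x : H).

Let conj_scaleA a b v :
  conj_scale a (conj_scale b v) = conj_scale (a * b) v.
Proof. by rewrite /conj_scale scalerA rmorphM. Qed.
Let conj_scale1 : left_id 1 conj_scale.
Proof. by move=> v; rewrite /conj_scale rmorph1 scale1r. Qed.
Let conj_scaleDr : right_distributive conj_scale +%R.
Proof. by move=> a u v; rewrite /conj_scale scalerDr. Qed.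
Let conj_scaleDl v : {morph conj_scale^~ v : a b / a + b}.
Proof. by move=> a b; rewrite /conj_scale rmorphD scalerDl. Qed.

HB.instance Definition _ := GRing.Zmodule_isLmodule.Build R[i] conj_space
  conj_scaleA conj_scale1 conj_scaleDr conj_scaleDl.

Definition conj_norm (x : conj_space) : R[i] := `|(x : H)|.

Let conj_normD x y : conj_norm (x + y) <= conj_norm x + conj_norm y.
Proof. exact: ler_normD. Qed.
Let conj_normZ a x : conj_norm (a *: x) = `|a| * conj_norm x.
Proof. by rewrite /conj_norm [LHS]normrZ norm_conjC. Qed.
Let conj_norm0 x : conj_norm x = 0 -> x = 0.
Proof. exact: normr0_eq0. Qed.

HB.instance Definition _ := Lmodule_isNormed.Build R[i] conj_space
  conj_normD conj_normZ conj_norm0.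

Let conj_complete (F : set_system conj_space) :
  ProperFilter F -> cauchy F -> cvg F.
Proof.
move=> FF /cauchy_ballP Fc.
have /cauchy_cvg/cvg_ex[l Fl] : @cauchy H F.
  apply/cauchy_ballP => e e0; have := Fc e e0.
  by rewrite /= -!ball_normE.
apply/cvg_ex; exists l; apply/cvgrPdist_lt => e e0.
by move/cvgrPdist_lt : Fl; apply.
Qed.

HB.instance Definition _ := Uniform_isComplete.Build conj_space conj_complete.

Definition conj_dot (x y : conj_space) : R[i] := '[(y : H), (x : H)].

Let conj_dotDr x y z : conj_dot x (y + z) = conj_dot x y + conj_dot x z.
Proof. exact: dotDl. Qed.
Let conj_dotZr a x y : conj_dot x (a *: y) = a * conj_dot x y.
Proof. by rewrite /conj_dot [LHS]dotZl conjCK. Qed.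
Let conj_dotC x y : conj_dot y x = (conj_dot x y)^*%R.
Proof. exact: dotC. Qed.
Let conj_dotxx x : conj_dot x x = `|x| ^+ 2.
Proof. exact: dotxx. Qed.

HB.instance Definition _ := CompleteNormedModule_isHilbert.Build R conj_space
  conj_dotDr conj_dotZr conj_dotC conj_dotxx.

Definition dagger (x : H) : conj_space := x.

End Conjugate.

Section Spans.
Variables (R : realType) (E : lmodType R[i]).

Definition lspan (S : set E) : set E :=
  [set x | exists n (c : 'I_n -> R[i]) (v : 'I_n -> E),
     (forall i, S (v i)) /\ x = \sum_(i < n) c i *: v i].

Definition lin_indep n (v : 'I_n -> E) : Prop :=
  forall c : 'I_n -> R[i], \sum_(i < n) c i *: v i = 0 -> forall i, c i = 0.

Definition has_dim (S : set E) (n : nat) : Prop :=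
  exists v : 'I_n -> E, lin_indep v /\ lspan (range v) = S.

Definition finite_dim (S : set E) : Prop := exists n, has_dim S n.

(* junk value 0 on infinite-dimensional subspaces *)
Definition dimension (S : set E) : nat := xget 0%N [set n | has_dim S n].

End Spans.

Section BoundedOperators.
Variables (R : realType) (H K : hilbertType R).

Definition bounded_linear : {pred H -> K} :=
  [pred f | `[< linear f /\
     exists M : R, forall x, `|f x| <= M%:C * `|x| >]].

Let bounded_linear_submod : submod_closed bounded_linear.
Proof.
split=> [|a f g].
  apply/asboolP; split=> [c x y|]; first by rewrite /= scaler0 addr0.
  by exists 0 => x; rewrite normr0 mul0r.
move=> /asboolP[fl [M fM]] /asboolP[gl [M' gM]]; apply/asboolP; split.
  move=> c x y; rewrite !(fctE, addrfctE, scalrfctE) fl gl.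
  by rewrite !scalerDr !scalerA addrACA [a * c]mulrC.
exists (complex.Re `|a| * M + M') => x; rewrite (le_trans (ler_normD _ _))//.
rewrite normrZ rmorphD rmorphM/= mulrDl lerD// -mulrA.
have -> : (complex.Re `|a|)%:C = `|a| by [].
by rewrite ler_wpM2l.
Qed.

HB.instance Definition _ :=
  GRing.isSubmodClosed.Build R[i] (H -> K) bounded_linear
    bounded_linear_submod.

Record bop := Bop { bop_fun :> H -> K ; _ : bop_fun \in bounded_linear }.
HB.instance Definition _ := [isSub for bop_fun].
HB.instance Definition _ := [Choice of bop by <:].
HB.instance Definition _ := [SubChoice_isSubLmodule of bop by <:].

Lemma bop_linear (A : bop) : linear A.
Proof. by case: A => f /= /asboolP[]. Qed.

HB.instance Definition _ (A : bop) :=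
  GRing.isLinear.Build R[i] H K *:%R A (bop_linear A).

Lemma bop_bounded (A : bop) : exists M : R, forall x, `|A x| <= M%:C * `|x|.
Proof. by case: A => f /= /asboolP[]. Qed.

Lemma bopP (A B : bop) : A =1 B -> A = B.
Proof. by move=> AB; apply/val_inj/funext. Qed.

End BoundedOperators.

Notation "''B' ( H , K )" := (bop H K) : type_scope.
Notation "''B' ( H )" := (bop H H) : type_scope.

Section Operators.
Variable R : realType.
Implicit Types H K L : hilbertType R.

Fact bid_subproof H : (@idfun H) \in @bounded_linear R H H.
Proof.
by apply/asboolP; split=> //; exists 1 => x; rewrite rmorph1 mul1r.
Qed.
Definition bid H : 'B(H) := Bop (bid_subproof H).

Fact bcomp_subproof H K L (A : 'B(K, L)) (B : 'B(H, K)) :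
  A \o B \in @bounded_linear R H L.
Proof.
apply/asboolP; split=> [c x y|]; first by rewrite /= !linearP.
have [M AM] := bop_bounded A; have [M' BM] := bop_bounded B.
exists (`|M| * M') => x; rewrite rmorphM/= (le_trans (AM _))//.
rewrite -mulrA (@le_trans _ _ (`|M|%:C * `|B x|))//.
  by rewrite ler_wpM2r// lecR ler_norm.
by rewrite ler_wpM2l// lecR.
Qed.
Definition bcomp H K L (A : 'B(K, L)) (B : 'B(H, K)) : 'B(H, L) :=
  Bop (bcomp_subproof A B).

Fact ketbra_subproof H K (u : K) (v : H) :
  (fun x => '[v, x] *: u) \in @bounded_linear R H K.
Proof.
apply/asboolP; split=> [c x y|]; first by rewrite dotDr dotZr scalerDl scalerA.
exists (complex.Re (`|v| * `|u|)) => x; rewrite normrZ.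
have -> : (complex.Re (`|v| * `|u|))%:C = `|v| * `|u| :> R[i].
  by rewrite RRe_real// ger0_real// mulr_ge0.
by rewrite mulrAC ler_wpM2r// cauchy_schwarz.
Qed.
Definition ketbra H K (u : K) (v : H) : 'B(H, K) := Bop (ketbra_subproof u v).

End Operators.

Arguments bid {R} H.
Notation "A \bo B" := (bcomp A B) : ring_scope.

Section OperatorTheory.
Variable R : realType.
Implicit Types H K : hilbertType R.

(* Here and below, [xget 0] picks the bounded operator with the stated property;
   in each case it exists and is unique, and the default value 0 plays no role
   (for [orthproj], when S is a closed subspace). *)
Definition adj H K (A : 'B(H, K)) : 'B(K, H) :=
  xget 0 [set B : 'B(K, H) | forall x y, '[A x, y] = '[x, B y]].

Definition isometric H K (A : 'B(H, K)) : Prop :=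
  forall x y, '[A x, A y] = '[x, y].

Definition posop H (A : 'B(H)) : Prop := forall x, 0 <= '[x, A x].

Definition is_sqrt H (S A : 'B(H)) : Prop := posop S /\ S \bo S = A.

Definition orthproj H (S : set H) : 'B(H) :=
  xget 0 [set P : 'B(H) |
    forall x, S (P x) /\ forall y, S y -> '[y, x - P x] = 0].

Definition conjop H K (A : 'B(H, K)) : 'B(conj_space H, conj_space K) :=
  xget 0 [set B : 'B(conj_space H, conj_space K) |
    forall x, B (dagger x) = dagger (A x)].

(* [opnorm_mx a] is the norm of the matrix [a] over 'B(H), acting on the n-fold
   direct sum of H. *)
Definition opnorm H K (A : 'B(H, K)) : R :=
  inf [set c : R | 0 <= c /\ forall x, `|A x| <= c%:C * `|x|].

Definition opnorm_mx H n (a : 'M['B(H)]_n) : R :=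
  inf [set c : R | 0 <= c /\ forall x : 'I_n -> H,
    \sum_i `|\sum_j a i j (x j)| ^+ 2 <= (c ^+ 2)%:C * \sum_j `|x j| ^+ 2].

Definition posop_mx H n (a : 'M['B(H)]_n) : Prop :=
  forall x : 'I_n -> H, 0 <= \sum_i \sum_j '[x i, a i j (x j)].

Definition orthonormal_basis H (E : set H) : Prop :=
  (forall x y, E x -> E y -> '[x, y] = (x == y)%:R) /\
  closure (lspan E) = setT.

(* unconditional sum over an arbitrary index set *)
Definition is_sum (I : choiceType) (E : set I) (f : I -> R[i]) (s : R[i]) :=
  forall eps : R[i], 0 < eps ->
    exists A : set I, [/\ finite_set A, A `<=` E &
      forall B, finite_set B -> A `<=` B -> B `<=` E ->
        `|\sum_(i \in B) f i - s| < eps].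

Definition has_trace H (A : 'B(H)) (t : R[i]) : Prop :=
  forall E, orthonormal_basis E -> is_sum E (fun e => '[e, A e]) t.

Definition hilbert_schmidt H (A : 'B(H)) : Prop :=
  exists t, has_trace (adj A \bo A) t.

Definition square_summable H (x : nat -> H) : Prop :=
  cvgn (series (fun n => `|x n| ^+ 2 : R[i]^o)).

(* The functionals whose absolute values are the seminorms that define the
   ultraweak topology. *)
Definition uw_form H (f : 'B(H) -> R[i]) : Prop :=
  exists x y : nat -> H, [/\ square_summable x, square_summable y &
    forall T : 'B(H),
      series (fun n => '[x n, T (y n)] : R[i]^o) @ \oo --> (f T : R[i]^o)].

Definition uw_continuous_form H (f : 'B(H) -> R[i]) : Prop :=
  exists n (g : 'I_n -> 'B(H) -> R[i]),
    (forall i, uw_form (g i)) /\ forall T, `|f T| <= \sum_i `|g i T|.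

(* continuity of a linear map for the ultraweak topologies *)
Definition uw_continuous H K (Phi : 'B(H) -> 'B(K)) : Prop :=
  forall f, uw_form f -> uw_continuous_form (f \o Phi).

Definition normal_state H (rho : {scalar 'B(H)}) : Prop :=
  [/\ forall A, posop A -> 0 <= rho A, rho (bid H) = 1 &
      uw_continuous_form rho].

Definition density_matrix H (rho : {scalar 'B(H)}) (D : 'B(H)) : Prop :=
  posop D /\ forall A, has_trace (D \bo A) (rho A).

Definition completely_positive H K (Phi : 'B(H) -> 'B(K)) : Prop :=
  forall n (a : 'M['B(H)]_n), posop_mx a -> posop_mx (map_mx Phi a).

Definition star_subalgebra H (D : set 'B(H)) : Prop :=
  [/\ D 0,
      forall (c : R[i]) A B, D A -> D B -> D (c *: A + B),
      forall A B, D A -> D B -> D (A \bo B) &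
      forall A, D A -> D (adj A)].

Definition conditional_expectation H (D : set 'B(H))
    (E : {linear 'B(H) -> 'B(H)}) : Prop :=
  [/\ completely_positive E,
      forall A, E (E A) = E A,
      range E = D &
      forall A B X, D A -> D B -> E (A \bo X \bo B) = A \bo E X \bo B].

Definition operator_space H (V : set 'B(H)) : Prop :=
  [/\ V 0,
      forall (c : R[i]) A B, V A -> V B -> V (c *: A + B) &
      forall A, (forall eps : R, 0 < eps ->
        exists B, V B /\ opnorm (A - B) < eps) -> V A].

Definition linear_on H K (V : set 'B(H)) (Phi : 'B(H) -> 'B(K)) : Prop :=
  forall (c : R[i]) A B, V A -> V B -> Phi (c *: A + B) = c *: Phi A + Phi B.

Definition bounded_on H K (V : set 'B(H)) (Phi : 'B(H) -> 'B(K)) : Prop :=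
  exists M : R, forall A, V A -> opnorm (Phi A) <= M * opnorm A.

Definition completely_bounded_on H K (V : set 'B(H)) (Phi : 'B(H) -> 'B(K)) :=
  exists M : R, forall n (a : 'M['B(H)]_n), (forall i j, V (a i j)) ->
    opnorm_mx (map_mx Phi a) <= M * opnorm_mx a.

(* L-bounded linear maps from V to W. A map on V is represented by a map on
   'B(H) of which only the restriction to V matters. *)
Definition Hbounded (L : hilbertType R) H K (V : set 'B(H)) (W : set 'B(K))
    (Phi : 'B(H) -> 'B(K)) : Prop :=
  [/\ linear_on V Phi,
      forall A, V A -> W (Phi A),
      finite_dim [set: L] -> bounded_on V Phi &
      ~ finite_dim [set: L] -> completely_bounded_on V Phi].

End OperatorTheory.

(* A Hilbert space tensor product of H and K; it is unique up to a unique
   unitary that respects elementary tensors. *)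
Record tensor (R : realType) (H K : hilbertType R) := Tensor {
  tensor_space :> hilbertType R ;
  tmul : H -> K -> tensor_space ;
  tmul_linearl : forall y, linear (tmul^~ y) ;
  tmul_linearr : forall x, linear (tmul x) ;
  dot_tmul : forall x y x' y',
    '[tmul x y, tmul x' y'] = '[x, x'] * '[y, y'] ;
  tmul_dense : closure (lspan [set tmul x y | x in setT & y in setT]) = setT }.

Notation "x \ox [ T ] y" := (tmul T x y) : ring_scope.

Section TensorOperators.
Variable R : realType.
Implicit Types H K L : hilbertType R.

Lemma norm_tmul H K (T : tensor H K) x y : `|x \ox[T] y| = `|x| * `|y|.
Proof.
apply/eqP; rewrite -(@eqrXn2 _ 2) ?mulr_ge0//.
by rewrite exprMn -!dotxx dot_tmul.
Qed.

Fact Eket_subproof H K (T : tensor H K) (x : K) :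
  (fun u => u \ox[T] x) \in @bounded_linear R H T.
Proof.
apply/asboolP; split; first exact: (tmul_linearl T x).
exists (complex.Re `|x|) => u; rewrite norm_tmul mulrC.
by rewrite RRe_real// ger0_real.
Qed.

(* E_x and E^x *)
Definition Eket H K (T : tensor H K) (x : K) : 'B(H, T) :=
  Bop (Eket_subproof T x).
Definition Ebra H K (T : tensor H K) (x : K) : 'B(T, H) := adj (Eket T x).

Definition tensop H H' K K' (T : tensor H K) (T' : tensor H' K')
    (A : 'B(H, H')) (B : 'B(K, K')) : 'B(T, T') :=
  xget 0 [set Z : 'B(T, T') |
    forall x y, Z (x \ox[T] y) = A x \ox[T'] B y].

(* the canonical identification of the two iterated tensor products *)
Definition assocop H K L (HK : tensor H K) (HK_L : tensor HK L)
    (KL : tensor K L) (H_KL : tensor H KL) : 'B(HK_L, H_KL) :=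
  xget 0 [set Z : 'B(HK_L, H_KL) | forall x y z,
    Z ((x \ox[HK] y) \ox[HK_L] z) = x \ox[H_KL] (y \ox[KL] z)].

Definition mtensor H K (T : tensor H K) (V : set 'B(H)) : set 'B(T) :=
  [set Z | forall x y, V (Ebra T x \bo Z \bo Eket T y)].

(* Phi is the ultraweak tensor product of the identity of 'B(H) and phi *)
Definition is_uwtensor H K (T : tensor H K) (phi : 'B(K) -> 'B(K))
    (Phi : {linear 'B(T) -> 'B(T)}) : Prop :=
  uw_continuous Phi /\
  forall A X, Phi (tensop T T A X) = tensop T T A (phi X).

Definition is_uwtensor_form H K (T : tensor H K) (f : 'B(K) -> R[i])
    (Phi : {linear 'B(T) -> 'B(H)}) : Prop :=
  uw_continuous Phi /\ forall A X, Phi (tensop T T A X) = f X *: A.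

(* U, whose values outside the Hilbert-Schmidt operators are irrelevant, is the
   isometric isomorphism onto the tensor product of K and its conjugate. *)
Definition is_HS_isomorphism K (T : tensor K (conj_space K))
    (U : 'B(K) -> T) : Prop :=
  [/\ forall (c : R[i]) A B, hilbert_schmidt A -> hilbert_schmidt B ->
        U (c *: A + B) = c *: U A + U B,
      forall A B, hilbert_schmidt A -> hilbert_schmidt B ->
        has_trace (adj A \bo B) '[U A, U B],
      forall z, exists2 A, hilbert_schmidt A & U A = z &
      forall u v, U (ketbra u v) = u \ox[T] dagger v].

End TensorOperators.

Arguments mtensor {R H K} T V.
Arguments assocop {R H K L} HK HK_L KL H_KL.

Section Noises.
Variables (R : realType) (h k_ : hilbertType R) (T : tensor h k_).

(* the orthogonal complement of the line spanned by omega *)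
Definition orthocompl1 (omega : k_) : set k_ := [set x | '[omega, x] = 0].

Definition with_omega (omega : k_) r (e : 'I_r -> k_) (i : 'I_r.+1) : k_ :=
  oapp e omega (unlift ord0 i).

(* The quantum stochastic differential equation dj_t(a) = j_t dLambda_psi(a)(t)
   is determined by its coefficient psi; each active pair (i, j) is one noise,
   and the excluded pair (0, 0), with index 0 for omega, is the time term. *)
Definition qsde_noises_at_most (V : set 'B(h)) (omega : k_)
    (psi : 'B(h) -> 'B(T)) (m : nat) : Prop :=
  exists r (e : 'I_r -> k_),
    let e' := with_omega omega e in
    let active (p : 'I_r.+1 * 'I_r.+1) := exists2 a, V a &
      Ebra T (e' p.1) \bo psi a \bo Eket T (e' p.2) <> 0 in
    [/\ forall i j, '[e i, e j] = (i == j)%:R,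
        lspan (range e) = orthocompl1 omega &
        leq #|[pred p | (p != (ord0, ord0)) && `[< active p >]]| m].

End Noises.

(* Main.v *)
Require Import Defs.
From HB Require Import structures.
From mathcomp Require Import all_boot all_order all_algebra.
From mathcomp Require Import complex.
From mathcomp Require Import all_classical all_reals all_analysis.
From mathcomp Require Import finmap ring.

Import Order.TTheory GRing.Theory Num.Theory.
Import numFieldNormedType.Exports.

Local Open Scope classical_set_scope.
Local Open Scope ring_scope.

(** Why the identities hold. The projection [Delta] fixes [u \ox x] when [x] is
    orthogonal to [omega] and kills [u \ox omega]. Hence a compression
    [E^x (psi a) E_y], with [x] and [y] equal to [omega] or orthogonal to it,
    selects exactly one of the four summands of [psi] ([block00], ...,
    [block11]). What remains is to move the maps [delta] and [P0perp] from the
    operator [Psi a] to the vectors. For [P0perp] this is multiplicativity of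
    the ampliation ([ampl_perp_ket]). For [delta] the claim is
    [E^omega (pit (delta T)) E_(cls Y) = E^omega (pit T) E_(cls (d Y))] and its
    mirror image, where [cls Y] is the vector [(Y \ox 1) omega].
    On an elementary tensor [T = A \ox X] it reads
    [rho (d X \bo Y) = rho (X \bo d Y)]. This is the self-adjointness of a
    state preserving conditional expectation, once the conditional expectation
    is known to be unital, which follows from faithfulness of the restricted
    state ([condexp_unital], [rho_condexp_swap], [rho_condexp_adj]). Both sides
    are ultraweakly continuous in [T], and a linear form that is ultraweakly
    continuous and vanishes on elementary tensors is zero
    ([uw_form_elem_eq0]), because compressing an operator to finite dimensional
    product subspaces gives bounded weak approximations by sums of elementary
    tensors.

    The state enters only through [rho A = <omega, (A \ox 1) omega>]
    ([state_vector]). It follows from [<u \ox v, U S> = <u, S v>] with [S] the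
    square root of the density matrix: slicing the first tensor factor along an
    orthonormal basis turns the right-hand side into the trace that defines
    [rho].

    The number of noises. In finite dimension let [W1] consist of the vectors
    [cls Y] with [Y] in the range of [d]; it has dimension [l] and contains
    [omega]. Let [W2] be the range of [P0 \ox 1], of dimension [k ^ 2]. An
    orthonormal basis of the whole space, of dimension [N * k], is chosen along
    [omega, W1, W2, everything]. By the identities a creation or annihilation
    coefficient vanishes when its basis vector is in [W1], since [d Y = Y]
    there, and a gauge coefficient vanishes when one of its two vectors is in
    [W2]. This leaves [N * k - l] possible creation and as many annihilation
    noises, and [(N * k - k ^ 2) ^ 2] possible gauge noises
    ([noises_along_flag]).

    Adjoints, orthogonal projections and tensor products of operators are given
    by the property that characterizes them, so they have to be shown to exist:
    by the projection theorem and the Riesz representation ([exists_proj],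
    [riesz], [adjE]), and by extending bounded relations with dense domain
    ([bop_extend], [tensopE], [assocopE]). *)

(** * Limits of sequences in a Hilbert space *)

Section Limits.
Set Implicit Arguments.
Unset Strict Implicit.
Variable R : realType.
Local Notation C := R[i].

Lemma gt0_complexE (e : C) : 0 < e -> exists2 d : R, 0 < d & e = d%:C%C.
Proof.
case: e => a b; rewrite ltcE /= => /andP[/eqP -> a0].
by exists a.
Qed.

Lemma inv_lt_eps (e : C) : 0 < e -> exists n, (n.+1%:R^-1 : C) < e.
Proof.
move=> /gt0_complexE[d d0 ->].
have [n nd] : exists n, (n.+1%:R^-1 : R) < d.
  exists (Num.Def.truncn d^-1).
  rewrite invf_plt ?posrE //.
  by rewrite (lt_le_trans (truncnS_gt _)).
exists n.
have -> : (n.+1%:R^-1 : C) = ((n.+1%:R^-1 : R)%:C)%C.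
  by rewrite fmorphV rmorph_nat.
by rewrite ltcR.
Qed.

Lemma small_eq0 (V : normedZmodType C) (a : V) :
  (forall e : C, 0 < e -> `|a| <= e) -> a = 0.
Proof.
move=> ae; apply/eqP; rewrite -normr_eq0; apply/negPn/negP => a0.
have a1 : 0 < `|a| by rewrite lt_def a0 normr_ge0.
have := ae (`|a| / 2) (divr_gt0 a1 (ltr0n _ 2)).
rewrite ler_pdivlMr ?ltr0n// mulr_natr mulr2n gerDl => a2.
by have := lt_le_trans a1 a2; rewrite ltxx.
Qed.

Lemma small_eq0_mul (V : normedZmodType C) (a : V) (c : C) : 0 <= c ->
  (forall e : C, 0 < e -> `|a| <= c * e) -> a = 0.
Proof.
move=> c0 ae; apply: small_eq0 => e e0.
have c1 : 0 < c + 1 by rewrite ltr_wpDl.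
have := ae (e / (c + 1)) (divr_gt0 e0 c1).
move/le_trans; apply; rewrite mulrCA ger_pMr //.
by rewrite ler_pdivrMr// mul1r lerDl.
Qed.

Variable H : hilbertType R.

Lemma closure_norm (S : set H) (x : H) :
  closure S x <-> forall e : C, 0 < e -> exists2 y, S y & `|x - y| < e.
Proof.
split=> [Sx e e0|Sx B].
  have [y [Sy]] := Sx _ (nbhsx_ballx x (PosNum e0)%:num e0).
  by rewrite -ball_normE => xy; exists y.
rewrite -nbhs_ballE => -[e e0 eB].
have [y Sy xy] := Sx e e0; exists y; split=> //; apply: eB.
by rewrite -ball_normE.
Qed.

Lemma cvg_eps (u : nat -> H) (l : H) :
  (forall e : C, 0 < e -> exists N, forall n, (N <= n)%N -> `|l - u n| < e)
  <-> u @ \oo --> l.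
Proof.
split=> [ul|/cvgrPdist_lt ul e e0].
  by apply/cvgrPdist_lt => e e0; have [N Nu] := ul e e0; exists N.
by have [N _ Nu] := ul e e0; exists N.
Qed.

(** Completeness, for the modulus [n.+1^-1] with which the approximating
    sequences of this file are chosen. *)
Lemma cauchy_inv_lim (u : nat -> H) :
  (forall m n, `|u m - u n| <= m.+1%:R^-1 + n.+1%:R^-1) ->
  exists l, forall e : C, 0 < e ->
    exists N, forall n, (N <= n)%N -> `|l - u n| < e.
Proof.
move=> uc.
suff /cauchy_cvg/cvg_ex[l] : cauchy (u @ \oo) by move=> /cvg_eps; exists l.
apply/cauchy_ballP => e e0.
have [N Ne] := inv_lt_eps (divr_gt0 e0 (ltr0n _ 2)).
exists ((fun x => exists2 n, (N <= n)%N & x = u n),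
        (fun x => exists2 n, (N <= n)%N & x = u n)).
  by split; exists N => //= n Nn; exists n.
move=> [x y] [/= [m Nm ->] [n Nn ->]]; rewrite -ball_normE /=.
apply: (le_lt_trans (uc m n)).
rewrite (splitr e) ltrD//; apply: le_lt_trans Ne;
  by rewrite lef_pV2 ?posrE ?ltr0n// ler_nat ltnS.
Qed.

End Limits.

(** * Inner products, spans and orthogonal projections *)

Section InnerProduct.
Set Implicit Arguments.
Unset Strict Implicit.
Variables (R : realType) (H : hilbertType R).
Implicit Types (x y z : H) (a : R[i]).

Lemma dotNr x y : '[x, - y] = - '[x, y].
Proof. by rewrite -scaleN1r dotZr mulN1r. Qed.

Lemma dotBr x y z : '[x, y - z] = '[x, y] - '[x, z].
Proof. by rewrite dotDr dotNr. Qed.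

Lemma dotNl x y : '[- x, y] = - '[x, y].
Proof. by rewrite dotC dotNr rmorphN/= -dotC. Qed.

Lemma dotBl x y z : '[x - y, z] = '[x, z] - '[y, z].
Proof. by rewrite dotDl dotNl. Qed.

Lemma dot0l x : '[0, x] = 0.
Proof. by rewrite dotC dot0r rmorph0. Qed.

Lemma dot_sumr (I : Type) (r : seq I) (P : pred I) (F : I -> H) x :
  '[x, \sum_(i <- r | P i) F i] = \sum_(i <- r | P i) '[x, F i].
Proof. exact: (big_morph _ (dotDr x) (dot0r x)). Qed.

Lemma dot_suml (I : Type) (r : seq I) (P : pred I) (F : I -> H) x :
  '[\sum_(i <- r | P i) F i, x] = \sum_(i <- r | P i) '[F i, x].
Proof. exact: (big_morph (fun y => '[y, x]) (fun y z => dotDl y z x) (dot0l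
  x)). Qed.

Lemma dot_extl x y : (forall z, '[z, x] = '[z, y]) -> x = y.
Proof.
move=> xy; apply/eqP; rewrite -subr_eq0 -normr_eq0 -sqrf_eq0 -dotxx dotBr xy.
by rewrite subrr.
Qed.

Lemma dot_extr x y : (forall z, '[x, z] = '[y, z]) -> x = y.
Proof. by move=> xy; apply: dot_extl => z; rewrite dotC xy -dotC. Qed.

Lemma dot_ge0 x : 0 <= '[x, x].
Proof. by rewrite dotxx exprn_ge0. Qed.

Lemma dotxx_eq0 x : ('[x, x] == 0) = (x == 0).
Proof. by rewrite dotxx sqrf_eq0 normr_eq0. Qed.

Lemma norm_sub_proj y z : y != 0 ->
  `|z - ('[y, z] / `|y| ^+ 2) *: y| ^+ 2
    = `|z| ^+ 2 - `|'[y, z]| ^+ 2 / `|y| ^+ 2.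
Proof.
move=> y0; have n0 : `|y| ^+ 2 != 0 by rewrite sqrf_eq0 normr_eq0.
set t := _ / _.
have ort : '[y, z - t *: y] = 0.
  by rewrite dotBr dotZr dotxx /t divfK// subrr.
rewrite -dotxx {1}dotBl dotZl ort mulr0 subr0 dotBr dotZr dotxx; congr (_ - _).
by rewrite (dotC y z) /t normCK mulrAC.
Qed.

End InnerProduct.

Section Subspaces.
Set Implicit Arguments.
Unset Strict Implicit.
Variables (R : realType).

Definition subspace (E : lmodType R[i]) (S : set E) : Prop :=
  S 0 /\ forall (c : R[i]) x y, S x -> S y -> S (c *: x + y).

Section Lmod.
Variable E : lmodType R[i].
Implicit Types S : set E.

Lemma subspaceD S x y : subspace S -> S x -> S y -> S (x + y).
Proof. by move=> [_ SD] Sx Sy; rewrite -[x]scale1r; exact: SD. Qed.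

Lemma subspaceZ S c x : subspace S -> S x -> S (c *: x).
Proof. by move=> [S0 SD] Sx; rewrite -[_ *: _]addr0; exact: SD. Qed.

Lemma subspaceB S x y : subspace S -> S x -> S y -> S (x - y).
Proof. by move=> [_ SD] Sx Sy; rewrite addrC -scaleN1r; exact: SD. Qed.

Lemma subspace_sum S (I : Type) (r : seq I) (P : pred I) (F : I -> E) :
  subspace S -> (forall i, P i -> S (F i)) -> S (\sum_(i <- r | P i) F i).
Proof.
move=> SS SF; apply: (big_ind S) => //; first by case: SS.
by move=> x y; exact: subspaceD.
Qed.

Lemma lspan_subset S (P : set E) : subspace P -> S `<=` P -> lspan S `<=` P.
Proof.
move=> PP SP _ [n [c [v [Sv ->]]]]; apply: subspace_sum => // i _.
by apply: subspaceZ => //; exact/SP/Sv.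
Qed.

Lemma lspan_in S x : S x -> lspan S x.
Proof.
move=> Sx; exists 1%N, (fun=> 1), (fun=> x); split=> //.
by rewrite big_ord1 scale1r.
Qed.

Lemma lspan_subspace S : subspace (lspan S).
Proof.
split; first by exists 0%N, (fun=> 0), (fun=> 0); split;
  [case|rewrite big_ord0].
move=> a _ _ [n [c [v [Sv ->]]]] [m [d [w [Sw ->]]]].
exists (n + m)%N, (fun i : 'I_(n + m) => match fintype.split i with inl j => a
  * c j | inr j => d j end),
  (fun i : 'I_(n + m) => match fintype.split i with inl j => v j | inr j => w j
    end); split.
  by move=> i; case: fintype.split.
rewrite big_split_ord /= scaler_sumr; congr (_ + _).
- apply: eq_bigr => i _; rewrite scalerA.
  by case: splitP => j //= ij; [congr (_ * c _ *: v _); exact/val_inj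
                              |have := ltn_ord i; rewrite ij ltnNge leq_addr].
- apply: eq_bigr => i _.
  case: splitP => j //= ij; first by have := ltn_ord j;
    rewrite -ij ltnNge leq_addr.
  by move/addnI : ij => ij; congr (d _ *: w _); exact/val_inj.
Qed.

Lemma lspan_mono S S' : S `<=` S' -> lspan S `<=` lspan S'.
Proof.
by move=> SS'; apply: lspan_subset (lspan_subspace _) _ => x /SS'/lspan_in.
Qed.

End Lmod.

Section Closed.
Variable H : hilbertType R.
Implicit Types S : set H.

Lemma closure_subspace S : subspace S -> subspace (closure S).
Proof.
move=> [S0 SD]; split; first exact: subset_closure.
move=> c x y /closure_norm Sx /closure_norm Sy; apply/closure_norm => e e0.
have c1 : 0 < `|c| + 1 by rewrite ltr_wpDl.
have e2 : 0 < e / 2 by rewrite divr_gt0.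
have [x' Sx' xx'] := Sx _ (divr_gt0 e2 c1).
have [y' Sy' yy'] := Sy _ e2.
exists (c *: x' + y'); first exact: SD.
rewrite opprD addrACA -scalerBr (le_lt_trans (ler_normD _ _))//.
rewrite (splitr e) ler_ltD// normrZ.
apply: (@le_trans _ _ ((`|c| + 1) * `|x - x'|)).
  by rewrite ler_wpM2r// lerDl.
by rewrite mulrC -ler_pdivlMr// ltW.
Qed.

Lemma closure_closure S : closure (closure S) `<=` closure S.
Proof.
by have /closure_id <- := @closed_closure H S.
Qed.

(** If [`|x - s| ^+ 2] is within [e ^+ 2] of the infimum, then [x - s] is
    orthogonal to [S] up to [e]: otherwise moving [s] along a line of [S] would
    go below the infimum. Applied to differences of terms of a minimizing
    sequence, this shows that the sequence is Cauchy; applied to a fixed vector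
    of [S], it shows that the limit is the projection. *)
Lemma exists_proj S : subspace S -> closure S `<=` S ->
  forall x, exists2 p, S p & forall y, S y -> '[y, x - p] = 0.
Proof.
move=> SS clS x.
pose A := [set r : R | exists2 s, S s & `|x - s| ^+ 2 = r%:C%C].
have Are s : (complex.Re (`|x - s| ^+ 2))%:C%C = `|x - s| ^+ 2.
  by rewrite RRe_real// ger0_real// exprn_ge0.
have hA : has_inf A.
  split; first by exists (complex.Re (`|x - 0| ^+ 2)), 0;
    [case: SS|rewrite Are].
  exists 0 => r [s _ sr].
  by rewrite -lecR -sr exprn_ge0.
pose m := inf A.
have key (e : R[i]) s y : 0 < e -> S s -> `|x - s| ^+ 2 < m%:C%C + e ^+ 2 ->
    S y -> `|'[y, x - s]| <= `|y| * e.
  move=> e0 Ss xs Sy.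
  have [->|y0] := eqVneq y 0; first by rewrite dot0l !normr0 mul0r.
  have yp : 0 < `|y| ^+ 2 by rewrite exprn_gt0// normr_gt0.
  have : m%:C%C <= `|x - s - ('[y, x - s] / `|y| ^+ 2) *: y| ^+ 2.
    rewrite -addrA -opprD -Are lecR; apply: ge_inf; first by case: hA.
    exists (s + ('[y, x - s] / `|y| ^+ 2) *: y); last by rewrite Are.
    by apply: subspaceD => //; exact: subspaceZ.
  rewrite norm_sub_proj// lerBrDl => xs'.
  have := le_lt_trans xs' xs; rewrite addrC ltrD2l ltr_pdivrMr//.
  rewrite mulrC -exprMn => /ltW.
  by rewrite ler_sqr ?nnegrE// mulr_ge0// ltW.
have /choice[s sP] n : exists s, S s /\ `|x - s| ^+ 2 < m%:C%C + (n.+1%:R^-1)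
  ^+ 2.
  have n0 : 0 < (n.+1%:R^-1 : R) ^+ 2 by rewrite exprn_gt0// invr_gt0.
  have [r [s0 Ss0 sr] rm] := inf_adherent n0 hA.
  exists s0; split=> //; rewrite sr.
  have -> : (n.+1%:R^-1 : R[i]) = ((n.+1%:R^-1 : R)%:C)%C.
    by rewrite fmorphV rmorph_nat.
  by rewrite -rmorphXn -rmorphD ltcR.
have inv0 n : 0 < (n.+1%:R^-1 : R[i]) by rewrite invr_gt0.
have sc a b : `|s a - s b| <= a.+1%:R^-1 + b.+1%:R^-1.
  have [->|ab] := eqVneq (s a - s b) 0.
    by rewrite normr0 addr_ge0// ltW.
  have Sab : S (s a - s b) by apply: subspaceB; [|case: (sP a)|case: (sP b)].
  have ka := key _ _ _ (inv0 a) (sP a).1 (sP a).2 Sab.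
  have kb := key _ _ _ (inv0 b) (sP b).1 (sP b).2 Sab.
  have p0 : 0 < `|s a - s b| by rewrite normr_gt0.
  rewrite -(ler_pM2l p0) -expr2 -dotxx mulrDr.
  rewrite -['[_, _]]ger0_norm ?dot_ge0//.
  have -> : '[s a - s b, s a - s b]
      = '[s a - s b, x - s b] - '[s a - s b, x - s a].
    by rewrite -dotBr opprB [x - s b + _]addrC addrA subrK.
  by rewrite (le_trans (ler_normB _ _))// addrC lerD.
have [p sp] := cauchy_inv_lim sc.
exists p.
  apply: clS; apply/closure_norm => e e0.
  by have [N Np] := sp e e0; exists (s N); [case: (sP N)|exact: Np].
move=> y Sy; apply: (@small_eq0_mul _ _ _ (`|y| * 2)).
  by rewrite mulr_ge0.
move=> e e0; have [N Np] := sp e e0; have [M Me] := inv_lt_eps e0.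
pose n := maxn N M.
have -> : x - p = (x - s n) - (p - s n) by rewrite opprB addrA subrK.
rewrite dotBr (le_trans (ler_normB _ _))// -mulrA mulrDl mul1r mulrDr lerD//.
  rewrite (le_trans (key _ _ _ (inv0 n) (sP n).1 (sP n).2 Sy))// ler_wpM2l//.
  by rewrite (le_trans _ (ltW Me))// lef_pV2 ?posrE ?ltr0n// ler_nat ltnS
    leq_maxr.
rewrite (le_trans (cauchy_schwarz _ _))// ler_wpM2l// ltW//.
by apply: Np; rewrite leq_maxl.
Qed.

End Closed.
End Subspaces.

(** * Bounded operators: algebra, construction by extension, adjoints *)

Section BopAlgebra.
Set Implicit Arguments.
Unset Strict Implicit.
Variable R : realType.
Implicit Types H K L : hilbertType R.

Lemma bopBE H K (A B : 'B(H, K)) x : (A - B) x = A x - B x.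
Proof. by []. Qed.

Lemma bop_lin H K (A : 'B(H, K)) c x y : A (c *: x + y) = c *: A x + A y.
Proof. exact: linearP. Qed.

Lemma bop0 H K (A : 'B(H, K)) : A 0 = 0.
Proof. exact: linear0. Qed.

Lemma bopD H K (A : 'B(H, K)) x y : A (x + y) = A x + A y.
Proof. exact: linearD. Qed.

Lemma bopB H K (A : 'B(H, K)) x y : A (x - y) = A x - A y.
Proof. exact: linearB. Qed.

Lemma bopZ H K (A : 'B(H, K)) c x : A (c *: x) = c *: A x.
Proof. exact: linearZ. Qed.

Lemma bop_sum H K (A : 'B(H, K)) (I : Type) (r : seq I) (P : pred I) F :
  A (\sum_(i <- r | P i) F i) = \sum_(i <- r | P i) A (F i).
Proof. exact: linear_sum. Qed.

Lemma bop_sumE H K (I : Type) (r : seq I) (P : pred I) (A : I -> 'B(H, K)) x :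
  (\sum_(i <- r | P i) A i) x = \sum_(i <- r | P i) A i x.
Proof. exact: (big_morph (fun B : 'B(H, K) => B x)). Qed.

Lemma bcompA H K L M (A : 'B(L, M)) (B : 'B(K, L)) (D : 'B(H, K)) :
  A \bo (B \bo D) = A \bo B \bo D.
Proof. exact: bopP. Qed.

Lemma bcomp1 H K (A : 'B(H, K)) : A \bo bid H = A.
Proof. exact: bopP. Qed.

Lemma bcomp1l H K (A : 'B(H, K)) : bid K \bo A = A.
Proof. exact: bopP. Qed.

Lemma bcompBr H K L (A : 'B(K, L)) (B D : 'B(H, K)) :
  A \bo (B - D) = A \bo B - A \bo D.
Proof. by apply: bopP => x; rewrite /= raddfB. Qed.

Lemma bcompDr H K L (A : 'B(K, L)) (B D : 'B(H, K)) :
  A \bo (B + D) = A \bo B + A \bo D.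
Proof. by apply: bopP => x; rewrite /= raddfD. Qed.

Lemma bcompBl H K L (A : 'B(H, K)) (B D : 'B(K, L)) :
  (B - D) \bo A = B \bo A - D \bo A.
Proof. exact: bopP. Qed.

Lemma bcompDl H K L (A : 'B(H, K)) (B D : 'B(K, L)) :
  (B + D) \bo A = B \bo A + D \bo A.
Proof. exact: bopP. Qed.

Lemma bcomp0r H K L (A : 'B(K, L)) : A \bo (0 : 'B(H, K)) = 0.
Proof. by apply: bopP => x; rewrite /= linear0. Qed.

Lemma bcomp0l H K L (A : 'B(H, K)) : (0 : 'B(K, L)) \bo A = 0.
Proof. exact: bopP. Qed.

(** Bounds are taken in [R[i]], where the norms live. *)
Lemma bop_bound H K (A : 'B(H, K)) :
  exists2 M : R[i], 0 < M & forall x, `|A x| <= M * `|x|.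
Proof.
have [M AM] := bop_bounded A.
exists ((`|M| + 1)%:C%C); first by rewrite ltcR ltr_wpDl.
move=> x; rewrite (le_trans (AM x))// ler_wpM2r// lecR.
by rewrite (le_trans (ler_norm _))// lerDl.
Qed.

Lemma bop_build H K (f : H -> K) (M : R[i]) : linear f -> 0 <= M ->
  (forall x, `|f x| <= M * `|x|) -> exists A : 'B(H, K), forall x, A x = f x.
Proof.
move=> fl M0 fM.
have fb : f \in @bounded_linear R H K.
  apply/asboolP; split=> //; exists (complex.Re M) => x.
  by rewrite RRe_real ?ger0_real.
by exists (Bop fb).
Qed.

Lemma bop_eq_dense H K (D : set H) (A B : 'B(H, K)) :
  closure (lspan D) = setT -> (forall x, D x -> A x = B x) -> A = B.
Proof.
move=> clD AB; apply: bopP => x.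
apply/eqP; rewrite -subr_eq0 -bopBE; apply/eqP.
have AB0 : lspan D `<=` [set y | (A - B) y = 0].
  apply: lspan_subset => [|y /AB ABy]; last by rewrite /mkset bopBE ABy subrr.
  split=> [|c y z]; first by rewrite /mkset bop0.
  by rewrite /mkset bop_lin => -> ->; rewrite scaler0 addr0.
have [M M0 ABM] := bop_bound (A - B).
move: (A - B) AB0 ABM => D0 AB0 ABM.
apply: (small_eq0_mul (ltW M0)) => e e0.
have : closure (lspan D) x by rewrite clD.
move=> /closure_norm /(_ e e0)[y /AB0 y0 xy].
have -> : D0 x = D0 (x - y) by rewrite bopB y0 subr0.
rewrite (le_trans (ABM _))//.
by rewrite ler_wpM2l ?ltW.
Qed.

(** The closure of the relation [G] is again linear and bounded, hence
    single-valued, and it is total because the target is complete. *)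
Lemma bop_extend H K (G : H -> K -> Prop) (M : R[i]) : 0 <= M ->
  (forall c x y x' y', G x y -> G x' y' -> G (c *: x + x') (c *: y + y')) ->
  (forall x y, G x y -> `|y| <= M * `|x|) ->
  (forall x (e : R[i]), 0 < e -> exists x' y', G x' y' /\ `|x - x'| < e) ->
  exists A : 'B(H, K), forall x y, G x y -> A x = y.
Proof.
move=> M0 Glin Gbd Gdense.
pose Gb x y := forall e : R[i], 0 < e ->
  exists x' y', [/\ G x' y', `|x - x'| < e & `|y - y'| < e].
have subG x y : G x y -> Gb x y.
  by move=> Gxy e e0; exists x, y; rewrite !subrr !normr0.
have Gblin c x y x' y' : Gb x y -> Gb x' y' -> Gb (c *: x + x') (c *: y + y').
  move=> Gxy Gxy' e e0.
  have c1 : 0 < `|c| + 1 by rewrite ltr_wpDl.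
  have e2 : 0 < e / 2 by rewrite divr_gt0.
  have [u [v [Guv xu yv]]] := Gxy _ (divr_gt0 e2 c1).
  have [u' [v' [Guv' xu' yv']]] := Gxy' _ e2.
  have est (E : hilbertType R) (z w z' w' : E) :
      `|z - w| < e / 2 / (`|c| + 1) -> `|z' - w'| < e / 2 ->
      `|c *: z + z' - (c *: w + w')| < e.
    move=> zw zw'; rewrite opprD addrACA -scalerBr.
    rewrite (le_lt_trans (ler_normD _ _))// (splitr e) ler_ltD// normrZ.
    apply: (@le_trans _ _ ((`|c| + 1) * `|z - w|)).
      by rewrite ler_wpM2r// lerDl.
    by rewrite mulrC -ler_pdivlMr// ltW.
  by exists (c *: u + u'), (c *: v + v'); split; [exact: Glin|exact: est..].
have Gbbd x y : Gb x y -> `|y| <= M * `|x|.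
  move=> Gxy; apply/ler_addgt0Pr => e e0.
  have M1 : 0 < M + 1 by rewrite ltr_wpDl.
  have [u [v [/Gbd vM xu yv]]] := Gxy _ (divr_gt0 e0 M1).
  rewrite -[y](subrK v) (le_trans (ler_normD _ _))//.
  apply: (@le_trans _ _ (e / (M + 1) + M * (`|x| + e / (M + 1)))).
    rewrite lerD ?(ltW yv)// (le_trans vM)// ler_wpM2l//.
    rewrite -[u](subrK x) addrC (le_trans (ler_normD _ _))// lerD2l.
    by rewrite distrC ltW.
  by rewrite mulrDr addrCA lerD2l -{1}[_ / _]mul1r -mulrDl addrC mulrC divfK
    ?gt_eqF.
have Gbex x : exists y, Gb x y.
  have inv0 n : 0 < (n.+1%:R^-1 : R[i]) by rewrite invr_gt0.
  have M1 : 0 < M + 1 by rewrite ltr_wpDl.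
  have /choice[u uP] n : exists p : H * K, G p.1 p.2 /\
      `|x - p.1| < n.+1%:R^-1 / (M + 1).
    have [x' [y' Gxy']] := Gdense x _ (divr_gt0 (inv0 n) M1).
    by exists (x', y').
  have uM n : M * `|x - (u n).1| <= n.+1%:R^-1.
    apply: (@le_trans _ _ ((M + 1) * `|x - (u n).1|)).
      by rewrite ler_wpM2r// lerDl.
    by rewrite mulrC -ler_pdivlMr// ltW//; case: (uP n).
  have uc m n : `|(u m).2 - (u n).2| <= m.+1%:R^-1 + n.+1%:R^-1.
    have Gmn : G ((u m).1 - (u n).1) ((u m).2 - (u n).2).
      have := Glin (-1) _ _ _ _ (uP n).1 (uP m).1.
      by rewrite !scaleN1r [X in G X]addrC [X in G _ X]addrC.
    rewrite (le_trans (Gbd _ _ Gmn))//.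
    have -> : (u m).1 - (u n).1 = (x - (u n).1) - (x - (u m).1).
      by rewrite opprB [x - _ + _]addrC addrA subrK.
    rewrite (le_trans (ler_wpM2l M0 (ler_normB _ _)))//.
    by rewrite mulrDr addrC lerD.
  have [y uy] := cauchy_inv_lim uc; exists y => e e0.
  have [N Ny] := uy e e0; have [N' Ne] := inv_lt_eps (mulr_gt0 e0 M1).
  pose n := maxn N N'; exists (u n).1, (u n).2; split; first by case: (uP n).
    have [_ /lt_le_trans->//] := uP n.
    rewrite ler_pdivrMr// (le_trans _ (ltW Ne))//.
    by rewrite lef_pV2 ?posrE ?ltr0n// ler_nat ltnS leq_maxr.
  by apply: Ny; rewrite leq_maxl.
have Gbuniq x y y' : Gb x y -> Gb x y' -> y = y'.
  move=> Gxy Gxy'; apply/eqP; rewrite -subr_eq0 -normr_le0.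
  have := Gbbd _ _ (Gblin (-1) _ _ _ _ Gxy' Gxy).
  by rewrite !scaleN1r addNr normr0 mulr0 addrC.
have [f fP] := choice Gbex.
have flin : linear f.
  by move=> c x y; apply: (Gbuniq _ _ _ (fP _)); exact: Gblin.
have [A Af] := bop_build flin M0 (fun x => Gbbd _ _ (fP x)).
by exists A => x y Gxy; rewrite Af; apply: (Gbuniq x) => //; exact: subG.
Qed.

End BopAlgebra.

Section Adjoint.
Set Implicit Arguments.
Unset Strict Implicit.
Variable R : realType.
Implicit Types H K L : hilbertType R.

(** The representing vector is orthogonal to the kernel of [f]. *)
Lemma riesz H (f : H -> R[i]) (M : R[i]) : 0 <= M ->
  (forall c x y, f (c *: x + y) = c * f x + f y) ->
  (forall x, `|f x| <= M * `|x|) -> exists y, forall x, f x = '[y, x].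
Proof.
move=> M0 fl fM.
have f0 : f 0 = 0.
  by have := fM 0; rewrite normr0 mulr0 normr_le0 => /eqP.
have fB x y : f (x - y) = f x - f y.
  by rewrite addrC -scaleN1r fl mulN1r addrC.
have fZ c x : f (c *: x) = c * f x by rewrite -[_ *: _]addr0 fl f0 addr0.
have [[x0 fx0]|nM] := pselect (exists x, f x != 0); last first.
  exists 0 => x; rewrite dot0l; apply/eqP/negPn/negP => fx.
  by apply: nM; exists x.
pose S := [set x | f x = 0].
have SS : subspace S.
  by split=> // c x y Sx Sy; rewrite /S /= fl Sx Sy mulr0 addr0.
have clS : closure S `<=` S.
  move=> x /closure_norm Sx; rewrite /S /=.
  apply: (small_eq0_mul M0) => e e0; have [y Sy xy] := Sx e e0.
  rewrite -[f x]subr0 -[X in _ - X]Sy -fB (le_trans (fM _))//.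
  by rewrite ler_wpM2l// ltW.
have [p Sp xp] := exists_proj SS clS x0.
pose z := x0 - p.
have fz : f z = f x0 by rewrite fB Sp subr0.
have z0 : z != 0 by apply: contraNneq fx0 => z0; rewrite -fz z0 f0.
have zz : '[z, z] != 0 by rewrite dotxx_eq0.
exists (((f z)^*%R / '[z, z]) *: z) => x.
have : S (x - (f x / f z) *: z).
  by rewrite /S /= fB fZ divfK ?subrr// fz.
move=> /xp/(congr1 Num.conj); rewrite rmorph0 -dotC -/z dotBr dotZr.
move=> /eqP; rewrite subr_eq0 => /eqP zx.
rewrite dotZl zx rmorphM fmorphV /= conjCK -[('[z, z])^*%R]dotC.
by rewrite mulrACA mulVf// mulr1 mulrC divfK// fz.
Qed.

Lemma adjE H K (A : 'B(H, K)) x y : '[A x, y] = '[x, adj A y].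
Proof.
suff /(xgetPex (0 : 'B(K, H))) : exists B : 'B(K, H), forall x y, '[A x, y] =
  '[x, B y].
  exact.
have [M M0 AM] := bop_bound A.
have /choice[f fP] u : exists v, forall z, '[u, A z] = '[v, z].
  apply: (@riesz _ _ (`|u| * M)) => [|c z w|z].
  - by rewrite mulr_ge0// ltW.
  - by rewrite bop_lin dotDr dotZr.
  - by rewrite (le_trans (cauchy_schwarz _ _))// -mulrA ler_wpM2l.
have fl : linear f.
  move=> c u v; apply: dot_extr => z.
  by rewrite -fP dotDl dotZl !fP -dotZl -dotDl.
have fM u : `|f u| <= M * `|u|.
  have [->|fu0] := eqVneq (f u) 0; first by rewrite normr0 mulr_ge0// ltW.
  have fup : 0 < `|f u| by rewrite normr_gt0.
  rewrite -(ler_pM2r fup) -expr2 -dotxx -fP -[X in X <= _]ger0_norm.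
    rewrite (le_trans (cauchy_schwarz _ _))//.
    by rewrite (le_trans (ler_wpM2l _ (AM _)))// mulrCA mulrA.
  by rewrite fP dot_ge0.
have [B Bf] := bop_build fl (ltW M0) fM.
by exists B => z w; rewrite Bf dotC fP -dotC.
Qed.

Lemma adjE' H K (A : 'B(H, K)) x y : '[x, A y] = '[adj A x, y].
Proof. by rewrite dotC adjE -dotC. Qed.

Lemma adj_unique H K (A : 'B(H, K)) (B : 'B(K, H)) :
  (forall x y, '[A x, y] = '[x, B y]) -> adj A = B.
Proof.
by move=> AB; apply: bopP => y; apply: dot_extl => x; rewrite -adjE AB.
Qed.

Lemma adjK H K (A : 'B(H, K)) : adj (adj A) = A.
Proof. by apply: adj_unique => x y; rewrite -adjE'. Qed.

Lemma adj_comp H K L (A : 'B(K, L)) (B : 'B(H, K)) :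
  adj (A \bo B) = adj B \bo adj A.
Proof. by apply: adj_unique => x y; rewrite /= !adjE. Qed.

Lemma adjB H K (A B : 'B(H, K)) : adj (A - B) = adj A - adj B.
Proof.
by apply: adj_unique => x y; rewrite !bopBE dotBl dotBr !adjE.
Qed.

Lemma adj_bid H : adj (bid H) = bid H.
Proof. exact: adj_unique. Qed.

Lemma adj_ketbra H K (u : K) (v : H) : adj (ketbra u v) = ketbra v u.
Proof.
by apply: adj_unique => x y /=; rewrite dotZl dotZr -dotC mulrC.
Qed.

Lemma isometric_adj H K (F : 'B(H, K)) : isometric F -> adj F \bo F = bid H.
Proof.
by move=> iF; apply: bopP => x; apply: dot_extl => y; rewrite /= -adjE iF.
Qed.

(** A sesquilinear form that vanishes on the diagonal is zero, here applied to
    the form of [A - adj A]. *)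
Lemma posop_adj H (A : 'B(H)) : posop A -> adj A = A.
Proof.
move=> Apos; apply: adj_unique.
pose B x y := '[A x, y] - '[x, A y].
have Bxx x : B x x = 0.
  by rewrite /B [X in X - _]dotC geC0_conj ?subrr.
have BD x y : B x y + B y x = 0.
  have := Bxx (x + y); rewrite /B !bopD !dotDl !dotDr.
  have := Bxx x; have := Bxx y; rewrite /B => /eqP; rewrite subr_eq0 => /eqP ->.
  move=> /eqP; rewrite subr_eq0 => /eqP -> <-.
  ring.
move=> x y; apply/eqP; rewrite -subr_eq0 -/(B x y); apply/eqP.
have := BD x ('i%R *: y).
have -> : B x ('i%R *: y) = 'i * B x y.
  by rewrite /B bopZ !dotZr mulrBr.
have -> : B ('i%R *: y) x = - ('i * B y x).
  by rewrite /B bopZ !dotZl conjCi !mulNr -opprD -mulrBr.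
rewrite -mulrBr => /eqP;
  rewrite mulf_eq0 (negPf (neq0Ci _)) /= subr_eq0 => /eqP xy.
have := BD x y; rewrite -xy => /eqP; rewrite -mulr2n mulrn_eq0 /= => /eqP //.
Qed.

Lemma adj_comp_eq0 H K (A : 'B(H, K)) : adj A \bo A = 0 -> A = 0.
Proof.
move=> A0; apply: bopP => x; apply/eqP; rewrite -dotxx_eq0 adjE.
by have -> : adj A (A x) = (adj A \bo A) x by []; rewrite A0 dot0r.
Qed.

End Adjoint.

Section OrthogonalProjection.
Set Implicit Arguments.
Unset Strict Implicit.
Variables (R : realType) (H : hilbertType R) (S : set H).
Hypotheses (SS : subspace S) (clS : closure S `<=` S).
Local Notation P := (orthproj S).

Lemma orthprojP x : S (P x) /\ forall y, S y -> '[y, x - P x] = 0.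
Proof.
suff /(xgetPex (0 : 'B(H))) : exists P : 'B(H), forall x,
    S (P x) /\ forall y, S y -> '[y, x - P x] = 0 by exact.
have /choice[f fP] u : exists v, S v /\ forall y, S y -> '[y, u - v] = 0.
  by have [v Sv vP] := exists_proj SS clS u; exists v.
have funiq u v : S v -> (forall y, S y -> '[y, u - v] = 0) -> f u = v.
  move=> Sv vP; have [Sf fo] := fP u.
  have Sfv : S (f u - v) by exact: subspaceB.
  apply/eqP; rewrite -subr_eq0 -dotxx_eq0.
  have {2}-> : f u - v = (u - v) - (u - f u).
    by rewrite opprB [u - v + _]addrC addrA subrK.
  by rewrite dotBr vP// fo// subrr.
have fl : linear f.
  move=> c u v; apply: funiq; first by apply: SS.2; [case: (fP u)|case: (fP v)].
  move=> y Sy; have [_ fu] := fP u; have [_ fv] := fP v.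
  by rewrite opprD addrACA -scalerBr dotDr dotZr fu// fv// mulr0 addr0.
have fM u : `|f u| <= 1 * `|u|.
  rewrite mul1r -ler_sqr ?nnegrE// -!dotxx -subr_ge0.
  have [Sf fo] := fP u.
  have fuu : '[f u, u] = '[f u, f u].
    by apply/eqP; rewrite -subr_eq0 -dotBr fo.
  have uff : '[u, f u] = '[f u, f u] by rewrite dotC fuu -dotC.
  have <- : '[u - f u, u - f u] = '[u, u] - '[f u, f u].
    by rewrite dotBl !dotBr fuu uff subrr subr0.
  exact: dot_ge0.
have [B Bf] := bop_build fl ler01 fM.
by exists B => u; rewrite Bf.
Qed.

Lemma orthproj_id x : S x -> P x = x.
Proof.
move=> Sx; have [SP xP] := orthprojP x; apply/eqP; rewrite eq_sym -subr_eq0.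
by rewrite -dotxx_eq0 xP//; exact: subspaceB.
Qed.

Lemma orthproj_eq0 x : (forall y, S y -> '[y, x] = 0) -> P x = 0.
Proof.
move=> xS; have [SP xP] := orthprojP x; have := xP _ SP.
by rewrite dotBr xS// sub0r => /eqP; rewrite oppr_eq0 dotxx_eq0 => /eqP.
Qed.

Lemma orthproj_adj : adj P = P.
Proof.
apply: adj_unique => x y; have [Sx xP] := orthprojP x;
  have [Sy yP] := orthprojP y.
have -> : '[P x, y] = '[P x, P y].
  by apply/eqP; rewrite -subr_eq0 -dotBr yP.
by rewrite [RHS]dotC [LHS]dotC; congr (_^*%R); apply/eqP;
  rewrite eq_sym -subr_eq0 -dotBr xP.
Qed.

End OrthogonalProjection.

(** * Finite orthonormal systems *)

Section OrthonormalSeq.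
Set Implicit Arguments.
Unset Strict Implicit.
Variable R : realType.
Implicit Types H K : hilbertType R.

Definition onseq H (t : seq H) : Prop :=
  uniq t /\ {in t &, forall x y, '[x, y] = (x == y)%:R}.

Definition oproj H (t : seq H) : 'B(H) := \sum_(x <- t) ketbra x x.

Lemma oprojE H (t : seq H) x : oproj t x = \sum_(e <- t) '[e, x] *: e.
Proof. by rewrite /oproj bop_sumE. Qed.

Lemma oproj_adj H (t : seq H) : adj (oproj t) = oproj t.
Proof.
apply: adj_unique => x y; rewrite !oprojE dot_suml dot_sumr.
by apply: eq_bigr => e _; rewrite dotZl dotZr mulrC -dotC.
Qed.

Lemma oproj_mem H (t : seq H) x : onseq t -> x \in t -> oproj t x = x.
Proof.
move=> [ut ot] xt; rewrite oprojE (bigD1_seq x)//= ot// eqxx scale1r.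
rewrite big_seq_cond big1 ?addr0// => e /andP[et ex].
by rewrite ot// (negPf ex) scale0r.
Qed.

Lemma oproj_lspan H (t : seq H) x : onseq t -> lspan [set` t] x -> oproj t x =
  x.
Proof.
move=> ot; apply: (@lspan_subset _ _ _ [set x | oproj t x = x]).
  split=> [|c y z]; first by rewrite /mkset bop0.
  by rewrite /mkset bop_lin => -> ->.
by move=> y /= yt; rewrite /mkset oproj_mem.
Qed.

Lemma oproj_in H (t : seq H) x : lspan [set` t] (oproj t x).
Proof.
rewrite oprojE big_seq; apply: subspace_sum; first exact: lspan_subspace.
move=> e et; apply: subspaceZ; first exact: lspan_subspace.
exact: lspan_in.
Qed.

Lemma oproj_idem H (t : seq H) : onseq t -> oproj t \bo oproj t = oproj t.
Proof.
by move=> ot; apply: bopP => x; apply: oproj_lspan => //; exact: oproj_in.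
Qed.

Lemma proj_contract H (Q : 'B(H)) x : adj Q = Q -> Q \bo Q = Q ->
  `|Q x| <= `|x|.
Proof.
move=> Qa QQ; rewrite -ler_sqr ?nnegrE// -!dotxx -subr_ge0.
have QQx y : Q (Q y) = Q y by rewrite -[RHS]/(Q y) -[in RHS]QQ.
have <- : '[x - Q x, x - Q x] = '[x, x] - '[Q x, Q x].
  by rewrite dotBl !dotBr !adjE Qa QQx subrr subr0.
exact: dot_ge0.
Qed.

(** The complementary projection [1 - Q] kills [y] and is a contraction. *)
Lemma proj_approx H (Q : 'B(H)) x y : adj Q = Q -> Q \bo Q = Q ->
  Q y = y -> `|x - Q x| <= `|x - y|.
Proof.
move=> Qa QQ Qy.
have -> : x - Q x = (bid H - Q) (x - y).
  by rewrite bopBE !bopB Qy opprB /= addrA subrK.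
apply: proj_contract; first by rewrite adjB adj_bid Qa.
by rewrite bcompBr !bcompBl bcomp1 bcomp1l bcomp1 QQ subrr subr0.
Qed.

Lemma onseq_cat H (s t : seq H) : onseq s -> onseq t ->
  (forall x y, x \in s -> y \in t -> '[x, y] = 0) -> onseq (s ++ t).
Proof.
move=> [us os] [ut ot] st.
have st0 x : x \in s -> x \in t -> False.
  move=> xs xt; have := st _ _ xs xt; rewrite os// eqxx => /eqP.
  by rewrite oner_eq0.
split.
  by rewrite cat_uniq us ut andbT; apply/hasPn => x xt; apply/negP => /st0;
    exact.
move=> x y; rewrite !mem_cat => /orP[xs|xt] /orP[ys|yt];
  [exact: os| | |exact: ot].
- by rewrite st//; case: eqVneq => // xy; case: (st0 x) => //; rewrite xy.
- by rewrite dotC st// rmorph0; case: eqVneq => // xy; case: (st0 y) => //;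
  rewrite -xy.
Qed.

(** Normalized residuals are appended one at a time; a vector that is already in
    the span adds nothing, so that [t] may be shorter than [w]. *)
Lemma gram_schmidt H (s w : seq H) : onseq s -> exists t,
  [/\ onseq (s ++ t), {in w, forall x, lspan [set` s ++ t] x} &
      {in t, forall x, lspan [set` s ++ w] x}].
Proof.
elim: w s => [|y w IH] s os; first by exists [::]; rewrite cats0.
pose r := y - oproj s y.
have yr : y = r + oproj s y by rewrite subrK.
have [r0|r0] := eqVneq r 0.
  have [t [ot wt tw]] := IH s os; exists t; split=> // [x|x xt].
    rewrite inE => /orP[/eqP ->|]; last exact: wt.
    rewrite yr r0 add0r; apply: lspan_mono (oproj_in _ _) => z /= zs.
    by rewrite mem_cat zs.
  apply: lspan_mono (tw _ xt) => z /=.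
  by rewrite !mem_cat inE => /orP[->//|->]; rewrite !orbT.
pose e := `|r|^-1 *: r.
have nr : `|r| != 0 by rewrite normr_eq0.
have re : r = `|r| *: e by rewrite scalerA divff// scale1r.
have ee : '[e, e] = 1.
  rewrite dotxx normrZ normfV normr_id mulVf// expr1n//.
have se x : x \in s -> '[x, e] = 0.
  move=> xs; rewrite dotZr dotBr.
  by rewrite -[oproj s]oproj_adj -adjE oproj_mem// subrr mulr0.
have os' : onseq (s ++ [:: e]).
  apply: onseq_cat => //.
    by split=> // x z; rewrite !inE => /eqP -> /eqP ->; rewrite ee eqxx.
  by move=> x z xs; rewrite inE => /eqP ->; exact: se.
have [t [ot wt tw]] := IH _ os'.
rewrite -catA in ot wt; exists ([:: e] ++ t); split=> //.
  move=> x; rewrite inE => /orP[/eqP ->|]; last exact: wt.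
  rewrite yr; apply: subspaceD; first exact: lspan_subspace.
    rewrite re; apply: subspaceZ; first exact: lspan_subspace.
    by apply: lspan_in; rewrite /= mem_cat inE eqxx !orbT.
  apply: lspan_mono (oproj_in _ _) => z /= zs.
  by rewrite mem_cat zs.
have lse : lspan [set` s ++ y :: w] e.
  apply: subspaceZ; first exact: lspan_subspace.
  apply: subspaceB; first exact: lspan_subspace.
    by apply: lspan_in; rewrite /= mem_cat mem_head orbT.
  apply: lspan_mono (oproj_in _ _) => z /= zs.
  by rewrite mem_cat zs.
move=> x; rewrite mem_cat mem_seq1 => /orP[/eqP -> //|/tw].
apply: lspan_subset; first exact: lspan_subspace.
move=> z /=; rewrite !mem_cat mem_seq1 -orbA => /or3P[zs|/eqP -> //|zw].
  by apply: lspan_in; rewrite /= mem_cat zs.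
by apply: lspan_in; rewrite /= mem_cat inE zw !orbT.
Qed.

Lemma onseq_nil H : onseq ([::] : seq H).
Proof. by []. Qed.

Lemma gram_schmidt0 H (w : seq H) : exists2 t, onseq t &
  {in w, forall x, oproj t x = x}.
Proof.
have [t [ot wt _]] := gram_schmidt w (onseq_nil H).
by exists t => // x /wt; exact: oproj_lspan.
Qed.

Lemma parseval_oproj H (t : seq H) x : onseq t ->
  '[oproj t x, oproj t x] = \sum_(e <- t) `|'[e, x]| ^+ 2.
Proof.
move=> ot; rewrite adjE oproj_adj -[X in '[_, X]]/((oproj t \bo oproj t) x).
rewrite oproj_idem// oprojE dot_sumr; apply: eq_bigr => e _.
by rewrite dotZr (dotC e x) normCK mulrC -dotC mulrC.
Qed.

Lemma bessel H (t : seq H) x : onseq t ->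
  \sum_(e <- t) `|'[e, x]| ^+ 2 <= '[x, x].
Proof.
move=> ot; rewrite -parseval_oproj// !dotxx ler_sqr ?nnegrE//.
by apply: proj_contract; [exact: oproj_adj|exact: oproj_idem].
Qed.

Lemma dot_sum_onseq H (t : seq H) (c : H -> R[i]) : onseq t ->
  '[\sum_(f <- t) c f *: f, \sum_(f <- t) c f *: f] = \sum_(f <- t) `|c f| ^+ 2.
Proof.
move=> [ut ot]; rewrite dot_suml big_seq [RHS]big_seq; apply: eq_bigr => f ft.
rewrite dotZl dot_sumr (bigD1_seq f)//= big_seq_cond big1 ?addr0.
  by rewrite dotZr ot// eqxx mulr1 normCK mulrC.
by move=> g /andP[gt gf]; rewrite dotZr ot// eq_sym (negPf gf) mulr0.
Qed.

End OrthonormalSeq.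

(** * Operators on Hilbert space tensor products *)

Section Dense.
Set Implicit Arguments.
Unset Strict Implicit.
Variable R : realType.
Implicit Types H K L : hilbertType R.

Lemma dense_subspace H (D S : set H) : closure (lspan D) = setT ->
  subspace S -> closure S `<=` S -> D `<=` S -> forall x, S x.
Proof.
move=> clD SS clS DS x; apply: clS.
have : closure (lspan D) x by rewrite clD.
by apply: closureS; exact: lspan_subset.
Qed.

Lemma dot_ext_dense H (D : set H) (u v : H) : closure (lspan D) = setT ->
  (forall x, D x -> '[x, u] = '[x, v]) -> u = v.
Proof.
move=> clD uv; apply: dot_extl => x; apply/eqP; rewrite -subr_eq0 -dotBr.
apply/eqP; move: x; apply: (@dense_subspace _ D [set x | '[x, u - v] = 0]) =>
  //.
- split=> [|c y z]; rewrite /mkset ?dot0l// dotDl dotZl => -> ->.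
  by rewrite mulr0 addr0.
- move=> x /closure_norm xS; apply: (@small_eq0_mul _ _ _ `|u - v|) => // e e0.
  have [y y0 xy] := xS e e0.
  rewrite -[X in `|X|]subr0 -y0 -dotBl (le_trans (cauchy_schwarz _ _))//.
  by rewrite mulrC ler_wpM2l// ltW.
- by move=> x Dx; rewrite /mkset dotBr uv// subrr.
Qed.

Lemma preimage_subspace H K (A : 'B(H, K)) (S : set K) :
  subspace S -> subspace [set x | S (A x)].
Proof.
move=> [S0 SD]; split; first by rewrite /mkset bop0.
by move=> c x y; rewrite /mkset bop_lin; exact: SD.
Qed.

Lemma preimage_closed H K (A : 'B(H, K)) (S : set K) :
  closure S `<=` S -> closure [set x | S (A x)] `<=` [set x | S (A x)].
Proof.
move=> clS x /closure_norm xS; apply: clS; apply/closure_norm => e e0.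
have [M M0 AM] := bop_bound A.
have [y Sy xy] := xS _ (divr_gt0 e0 M0); exists (A y) => //.
by rewrite -bopB (le_lt_trans (AM _))// mulrC -ltr_pdivlMr.
Qed.

Fact tmulr_subproof H K (T : tensor H K) (x : H) :
  (fun y => x \ox[T] y) \in @bounded_linear R K T.
Proof.
apply/asboolP; split; first exact: (tmul_linearr T x).
exists (complex.Re `|x|) => u; rewrite norm_tmul.
by rewrite RRe_real// ger0_real.
Qed.

Definition Lket H K (T : tensor H K) (x : H) : 'B(K, T) :=
  Bop (tmulr_subproof T x).

(** A closed subspace that contains all [x \ox y] with [x] in [D] and [y] in [E]
    contains them for all [x], by density in the first factor, and then for all
    [y]. *)
Lemma elem_dense H K (T : tensor H K) (D : set H) (E : set K) :
  closure (lspan D) = setT -> closure (lspan E) = setT ->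
  closure (lspan [set x \ox[T] y | x in D & y in E]) = setT.
Proof.
move=> clD clE; set S := closure _.
have SS : subspace S by apply: closure_subspace; exact: lspan_subspace.
have clS : closure S `<=` S by exact: closure_closure.
have DES x y : D x -> E y -> S (x \ox[T] y).
  by move=> Dx Ey; apply/subset_closure/lspan_in; exists x => //; exists y.
have ES x y : E y -> S (x \ox[T] y).
  move=> Ey; apply: (dense_subspace clD (preimage_subspace (Eket T y) SS)
    (preimage_closed (A := Eket T y) clS)) => z Dz; exact: DES.
have TS x y : S (x \ox[T] y).
  apply: (dense_subspace clE (preimage_subspace (Lket T x) SS)
    (preimage_closed (A := Lket T x) clS)) => z Ez; exact: ES.
apply/seteqP; split=> // z _.
apply: (dense_subspace (tmul_dense T) SS clS) => _ [x _ [y _ <-]]; exact: TS.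
Qed.

Lemma lspan_closure_setT H : closure (lspan [set: H]) = setT.
Proof. by apply/seteqP; split=> // x _; apply/subset_closure/lspan_in. Qed.

End Dense.

Section TensorOp.
Set Implicit Arguments.
Unset Strict Implicit.
Variable R : realType.
Implicit Types H K L : hilbertType R.

Section Basics.
Variables (H K : hilbertType R) (T : tensor H K).

Lemma tmul0l y : (0 : H) \ox[T] y = 0.
Proof. exact: (bop0 (Eket T y)). Qed.

Lemma tmul0r x : x \ox[T] (0 : K) = 0.
Proof. exact: (bop0 (Lket T x)). Qed.

Lemma tmulZl c x y : (c *: x) \ox[T] y = c *: (x \ox[T] y).
Proof. exact: (bopZ (Eket T y)). Qed.

Lemma tmulZr c x y : x \ox[T] (c *: y) = c *: (x \ox[T] y).
Proof. exact: (bopZ (Lket T x)). Qed.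

Lemma tmul_suml (I : Type) (r : seq I) (P : pred I) F y :
  (\sum_(i <- r | P i) F i) \ox[T] y = \sum_(i <- r | P i) (F i \ox[T] y).
Proof. exact: (bop_sum (Eket T y)). Qed.

Lemma tmul_sumr (I : Type) (r : seq I) (P : pred I) F x :
  x \ox[T] (\sum_(i <- r | P i) F i) = \sum_(i <- r | P i) (x \ox[T] F i).
Proof. exact: (bop_sum (Lket T x)). Qed.

Definition elem_sum (s : seq (H * K)) : T := \sum_(p <- s) (p.1 \ox[T] p.2).

Lemma elem_dense_sum (z : T) (e : R[i]) : 0 < e ->
  exists s, `|z - elem_sum s| < e.
Proof.
have : closure (lspan [set x \ox[T] y | x in setT & y in setT]) z.
  by rewrite tmul_dense.
move=> /closure_norm zT /zT[_ [n [c [v [vT ->]]]] zv].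
have /choice[f fP] i : exists p : H * K, p.1 \ox[T] p.2 = v i.
  by have [x _ [y _ <-]] := vT i; exists (x, y).
exists [seq (c i *: (f i).1, (f i).2) | i <- index_enum 'I_n].
suff -> : elem_sum [seq (c i *: (f i).1, (f i).2) | i <- index_enum 'I_n]
    = \sum_(i < n) c i *: v i by [].
by rewrite /elem_sum big_map; apply: eq_bigr => i _; rewrite tmulZl fP.
Qed.

Lemma dot_sum_tmul (t : seq K) (x y : K -> H) : onseq t ->
  '[\sum_(f <- t) (x f \ox[T] f), \sum_(f <- t) (y f \ox[T] f)]
    = \sum_(f <- t) '[x f, y f].
Proof.
move=> [ut ot]; rewrite dot_suml big_seq [RHS]big_seq; apply: eq_bigr => f ft.
rewrite dot_sumr (bigD1_seq f)//= big_seq_cond big1 ?addr0.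
  by rewrite dot_tmul ot// eqxx mulr1.
by move=> g /andP[gt gf]; rewrite dot_tmul ot// eq_sym (negPf gf) mulr0.
Qed.

End Basics.

(** Expanding the vectors [B f] in an orthonormal system [q] makes the left-hand
    side a sum of squares to which the bound of [A] applies. Expanding the [x f]
    in an orthonormal system then regroups the rest as squared norms of values
    of [B]. *)
Lemma tensor_bound_onseq H H' K K' (T' : tensor H' K') (A : 'B(H, H'))
    (B : 'B(K, K')) (a b : R[i]) (t : seq K) (x : K -> H) :
  0 <= a -> 0 <= b ->
  (forall x, `|A x| <= a * `|x|) -> (forall y, `|B y| <= b * `|y|) -> onseq t ->
  `|\sum_(f <- t) (A (x f) \ox[T'] B f)| ^+ 2
    <= (a * b) ^+ 2 * \sum_(f <- t) '[x f, x f].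
Proof.
move=> a0 b0 AM BM ot.
have sq E E' (Z : 'B(E, E')) m v : 0 <= m -> (forall u, `|Z u| <= m * `|u|) ->
    '[Z v, Z v] <= m ^+ 2 * '[v, v].
  by move=> m0 ZM; rewrite !dotxx -exprMn ler_sqr ?nnegrE ?mulr_ge0.
have [q oq qB] := gram_schmidt0 [seq B f | f <- t].
pose y g := \sum_(f <- t) '[g, B f] *: x f.
have -> : \sum_(f <- t) (A (x f) \ox[T'] B f) = \sum_(g <- q) (A (y g) \ox[T']
  g).
  transitivity (\sum_(f <- t) \sum_(g <- q) '[g, B f] *: (A (x f) \ox[T'] g)).
    rewrite !big_seq; apply: eq_bigr => f ft.
    rewrite -[in LHS](qB (B f)) ?map_f// oprojE tmul_sumr.
    by apply: eq_bigr => g _; rewrite tmulZr.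
  rewrite exchange_big; apply: eq_bigr => g _ /=.
  rewrite /y bop_sum tmul_suml; apply: eq_bigr => f _.
  by rewrite bopZ tmulZl.
rewrite -dotxx (dot_sum_tmul T' (A \o y) (A \o y) oq) /=.
apply: (@le_trans _ _ (a ^+ 2 * \sum_(g <- q) '[y g, y g])).
  by rewrite mulr_sumr; apply: ler_sum => g _; exact: sq.
rewrite exprMn -[X in _ <= X]mulrA ler_wpM2l ?exprn_ge0//.
have [r or rx] := gram_schmidt0 [seq x f | f <- t].
pose h e := \sum_(f <- t) '[e, x f] *: f.
have yg g : '[y g, y g] = \sum_(e <- r) `|'[g, B (h e)]| ^+ 2.
  have -> : y g = oproj r (y g).
    rewrite /y bop_sum !big_seq; apply: eq_bigr => f ft.
    by rewrite bopZ rx ?map_f.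
  rewrite parseval_oproj//; apply: eq_bigr => e _; congr (`|_| ^+ 2).
  rewrite /y /h bop_sum !dot_sumr; apply: eq_bigr => f _.
  by rewrite bopZ !dotZr mulrC.
rewrite (eq_bigr _ (fun g _ => yg g)) exchange_big /=.
apply: (@le_trans _ _ (\sum_(e <- r) b ^+ 2 * '[h e, h e])).
  apply: ler_sum => e _; apply: (le_trans (bessel _ oq)); exact: sq.
rewrite -mulr_sumr ler_wpM2l ?exprn_ge0//.
rewrite (eq_bigr _ (fun e _ => dot_sum_onseq _ ot)) exchange_big /=.
by apply: ler_sum => f _; exact: bessel.
Qed.

(** Orthonormalizing the second components reduces to [tensor_bound_onseq]. *)
Lemma elem_sum_bound H H' K K' (T : tensor H K) (T' : tensor H' K')
    (A : 'B(H, H')) (B : 'B(K, K')) (a b : R[i]) (s : seq (H * K)) :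
  0 <= a -> 0 <= b ->
  (forall x, `|A x| <= a * `|x|) -> (forall y, `|B y| <= b * `|y|) ->
  `|elem_sum T' [seq (A p.1, B p.2) | p <- s]| <= a * b * `|elem_sum T s|.
Proof.
move=> a0 b0 AM BM.
have [t ot tp] := gram_schmidt0 [seq p.2 | p <- s].
pose x f := \sum_(p <- s) '[f, p.2] *: p.1.
have sE E F (S : tensor E F) (X : 'B(H, E)) (Y : 'B(K, F)) :
    elem_sum S [seq (X p.1, Y p.2) | p <- s] = \sum_(f <- t) (X (x f) \ox[S] Y
      f).
  rewrite /elem_sum big_map.
  transitivity (\sum_(p <- s) \sum_(f <- t) '[f, p.2] *: (X p.1 \ox[S] Y f)).
    rewrite !big_seq; apply: eq_bigr => p ps.
    rewrite -[in LHS](tp p.2) ?map_f// oprojE bop_sum tmul_sumr.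
    by apply: eq_bigr => g _; rewrite bopZ tmulZr.
  rewrite exchange_big; apply: eq_bigr => g _ /=.
  rewrite /x bop_sum tmul_suml; apply: eq_bigr => f _.
  by rewrite bopZ tmulZl.
rewrite -ler_sqr ?nnegrE ?mulr_ge0// exprMn sE.
have -> : elem_sum T s = \sum_(f <- t) (x f \ox[T] f).
  by rewrite -(sE _ _ T (bid H) (bid K)) /elem_sum big_map.
by rewrite -[X in _ * X]dotxx dot_sum_tmul//; exact: tensor_bound_onseq.
Qed.

Section TensopBasics.
Variables (H H' K K' : hilbertType R) (T : tensor H K) (T' : tensor H' K').

Lemma tensopE (A : 'B(H, H')) (B : 'B(K, K')) x y :
  tensop T T' A B (x \ox[T] y) = A x \ox[T'] B y.
Proof.
suff /(xgetPex (0 : 'B(T, T'))) : exists Z : 'B(T, T'), forall x y,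
    Z (x \ox[T] y) = A x \ox[T'] B y by exact.
have [a a0 AM] := bop_bound A; have [b b0 BM] := bop_bound B.
pose G (z : T) (w : T') := exists s, z = elem_sum T s /\
  w = elem_sum T' [seq (A p.1, B p.2) | p <- s].
have [] := @bop_extend R T T' G (a * b).
- by rewrite mulr_ge0// ltW.
- move=> c _ _ _ _ [s [-> ->]] [s' [-> ->]].
  exists ([seq (c *: p.1, p.2) | p <- s] ++ s').
  rewrite /elem_sum map_cat !big_cat /= !big_map !scaler_sumr.
  split; congr (_ + _); apply: eq_bigr => p _.
    by rewrite tmulZl.
  by rewrite bopZ tmulZl.
- by move=> _ _ [s [-> ->]]; apply: elem_sum_bound => //; exact: ltW.
- move=> z e e0; have [s sz] := elem_dense_sum z e0.
  by exists (elem_sum T s), (elem_sum T' [seq (A p.1, B p.2) | p <- s]);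
    split=> //; exists s.
move=> Z ZG; exists Z => x0 y0; apply: ZG.
by exists [:: (x0, y0)]; rewrite /elem_sum /= !big_seq1.
Qed.

Lemma bop_eq_elem L (A B : 'B(T, L)) :
  (forall x y, A (x \ox[T] y) = B (x \ox[T] y)) -> A = B.
Proof.
by move=> AB; apply: (bop_eq_dense (tmul_dense T)) => _ [x _ [y _ <-]].
Qed.

Lemma dot_ext_elem (u v : T) :
  (forall x y, '[x \ox[T] y, u] = '[x \ox[T] y, v]) -> u = v.
Proof.
by move=> uv; apply: (dot_ext_dense (tmul_dense T)) => _ [x _ [y _ <-]].
Qed.

End TensopBasics.

Lemma tensop_comp H H' H'' K K' K'' (T : tensor H K) (T' : tensor H' K')
    (T'' : tensor H'' K'') (A : 'B(H', H'')) (A' : 'B(H, H'))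
    (B : 'B(K', K'')) (B' : 'B(K, K')) :
  tensop T' T'' A B \bo tensop T T' A' B' = tensop T T'' (A \bo A') (B \bo B').
Proof. by apply: bop_eq_elem => x y; rewrite /= !tensopE. Qed.

Lemma tensop1 H K (T : tensor H K) : tensop T T (bid H) (bid K) = bid T.
Proof. by apply: bop_eq_elem => x y; rewrite tensopE. Qed.

Lemma tensop_adj H H' K K' (T : tensor H K) (T' : tensor H' K')
    (A : 'B(H, H')) (B : 'B(K, K')) :
  adj (tensop T T' A B) = tensop T' T (adj A) (adj B).
Proof.
apply: bop_eq_elem => x y; apply: dot_ext_elem => u v.
by rewrite -adjE !tensopE !dot_tmul !adjE.
Qed.

Lemma tensop_linl H H' K K' (T : tensor H K) (T' : tensor H' K')
    c (A A' : 'B(H, H')) (B : 'B(K, K')) :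
  tensop T T' (c *: A + A') B = c *: tensop T T' A B + tensop T T' A' B.
Proof.
apply: bop_eq_elem => x y.
rewrite tensopE -[RHS]/(c *: tensop _ _ _ _ _ + tensop _ _ _ _ _) !tensopE.
exact: (bop_lin (Eket T' (B y))).
Qed.

Lemma tensopBl H H' K K' (T : tensor H K) (T' : tensor H' K')
    (A A' : 'B(H, H')) (B : 'B(K, K')) :
  tensop T T' (A - A') B = tensop T T' A B - tensop T T' A' B.
Proof. by rewrite addrC -scaleN1r tensop_linl scaleN1r addrC. Qed.

Lemma tensop_suml H H' K K' (T : tensor H K) (T' : tensor H' K') (I : Type)
    (r : seq I) (A : I -> 'B(H, H')) (B : 'B(K, K')) :
  tensop T T' (\sum_(i <- r) A i) B = \sum_(i <- r) tensop T T' (A i) B.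
Proof.
apply: bop_eq_elem => x y; rewrite bop_sumE !tensopE bop_sumE tmul_suml.
by apply: eq_bigr => i _; rewrite tensopE.
Qed.

Lemma tensop_sumr H H' K K' (T : tensor H K) (T' : tensor H' K') (I : Type)
    (r : seq I) (A : 'B(H, H')) (B : I -> 'B(K, K')) :
  tensop T T' A (\sum_(i <- r) B i) = \sum_(i <- r) tensop T T' A (B i).
Proof.
apply: bop_eq_elem => x y; rewrite bop_sumE !tensopE bop_sumE tmul_sumr.
by apply: eq_bigr => i _; rewrite tensopE.
Qed.

Lemma EbraE H K (T : tensor H K) (x y : K) (u : H) :
  Ebra T x (u \ox[T] y) = '[x, y] *: u.
Proof.
by apply: dot_extl => v; rewrite /Ebra -adjE /= dot_tmul dotZr mulrC.
Qed.

Lemma LbraE H K (T : tensor H K) (x : H) (u : H) (y : K) :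
  adj (Lket T x) (u \ox[T] y) = '[x, u] *: y.
Proof.
by apply: dot_extl => v; rewrite -adjE /= dot_tmul dotZr.
Qed.

Lemma tensop_ketbra1 H K (T : tensor H K) (x y : H) :
  tensop T T (ketbra x y) (bid K) = Lket T x \bo adj (Lket T y).
Proof.
by apply: bop_eq_elem => u v; rewrite tensopE /= LbraE tmulZl tmulZr.
Qed.

Lemma tensop_ketbra H K (T : tensor H K) (x y : H) (u v : K) :
  tensop T T (ketbra x y) (ketbra u v) = ketbra (x \ox[T] u) (y \ox[T] v).
Proof.
apply: bop_eq_elem => z w; rewrite tensopE /= dot_tmul tmulZl tmulZr scalerA.
by [].
Qed.

Lemma Eket_tensop H K (T : tensor H K) (A : 'B(H)) (X : 'B(K)) x y :
  Ebra T x \bo tensop T T A X \bo Eket T y = '[x, X y] *: A.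
Proof. by apply: bopP => u; rewrite /= tensopE EbraE. Qed.

Lemma conjopE H K (A : 'B(H, K)) x : conjop A (dagger x) = dagger (A x).
Proof.
suff /(xgetPex (0 : 'B(conj_space H, conj_space K))) :
    exists B : 'B(conj_space H, conj_space K), forall x, B (dagger x) = dagger
      (A x).
  exact.
have [M M0 AM] := bop_bound A.
have fl : linear (fun x : conj_space H => (A (x : H) : conj_space K)).
  by move=> c u v; exact: (bop_lin A (c^*%R) (u : H) (v : H)).
have [B BA] := bop_build fl (ltW M0) AM.
by exists B => u; rewrite BA.
Qed.

End TensorOp.

Section Assoc.
Set Implicit Arguments.
Unset Strict Implicit.
Variables (R : realType) (H K L : hilbertType R) (HK : tensor H K)
  (HK_L : tensor HK L) (KL : tensor K L) (H_KL : tensor H KL).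
Local Notation alpha := (assocop HK HK_L KL H_KL).

Let lsum (s : seq (H * K * L)) : HK_L :=
  \sum_(p <- s) ((p.1.1 \ox[HK] p.1.2) \ox[HK_L] p.2).
Let rsum (s : seq (H * K * L)) : H_KL :=
  \sum_(p <- s) (p.1.1 \ox[H_KL] (p.1.2 \ox[KL] p.2)).

Let dense_sum (E : hilbertType R) (f : H -> K -> L -> E) (z : E) (e : R[i]) :
  (forall c x y z, f (c *: x) y z = c *: f x y z) ->
  closure (lspan [set w | exists x y z, w = f x y z]) = setT -> 0 < e ->
  exists s : seq (H * K * L), `|z - \sum_(p <- s) f p.1.1 p.1.2 p.2| < e.
Proof.
move=> fZ fd e0.
have : closure (lspan [set w | exists x y z, w = f x y z]) z by rewrite fd.
move=> /closure_norm /(_ e e0)[_ [n [c [v [vT ->]]]] zv].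
have /choice[g gP] i : exists p : H * K * L, v i = f p.1.1 p.1.2 p.2.
  by have [x [y [w ->]]] := vT i; exists (x, y, w).
exists [seq (c i *: (g i).1.1, (g i).1.2, (g i).2) | i <- index_enum 'I_n].
rewrite big_map /= (eq_bigr (fun i => c i *: v i))// => i _.
by rewrite fZ gP.
Qed.

Lemma lelem_dense : closure (lspan [set w | exists x y z,
  w = (x \ox[HK] y) \ox[HK_L] z]) = setT.
Proof.
rewrite -(elem_dense HK_L (tmul_dense HK) (lspan_closure_setT L)).
congr (closure (lspan _)); apply/seteqP; split.
  move=> _ [x [y [z ->]]]; exists (x \ox[HK] y); last by exists z.
  by exists x => //; exists y.
by move=> _ [_ [x _ [y _ <-]] [z _ <-]]; exists x, y, z.
Qed.

Lemma relem_dense : closure (lspan [set w | exists x y z,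
  w = x \ox[H_KL] (y \ox[KL] z)]) = setT.
Proof.
rewrite -(elem_dense H_KL (lspan_closure_setT H) (tmul_dense KL)).
congr (closure (lspan _)); apply/seteqP; split.
  move=> _ [x [y [z ->]]]; exists x => //; exists (y \ox[KL] z) => //.
  by exists y => //; exists z.
by move=> _ [x _ [_ [y _ [z _ <-]] <-]]; exists x, y, z.
Qed.

(* The two sums have the same Gram matrix of summands. *)
Let norm_sums s : `|lsum s| = `|rsum s|.
Proof.
apply/eqP; rewrite -(@eqrXn2 _ 2)// -!dotxx !dot_suml.
apply/eqP/eq_bigr => p _; rewrite !dot_sumr; apply: eq_bigr => q _.
by rewrite !dot_tmul mulrA.
Qed.

Let sums_lin c s s' : exists s'', c *: lsum s + lsum s' = lsum s'' /\
  c *: rsum s + rsum s' = rsum s''.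
Proof.
exists ([seq (c *: p.1.1, p.1.2, p.2) | p <- s] ++ s').
rewrite /lsum /rsum !big_cat /= !big_map !scaler_sumr; split; congr (_ + _);
  by apply: eq_bigr => p _; rewrite !tmulZl.
Qed.

Let assoc_ex : exists Z : 'B(HK_L, H_KL), forall x y z,
  Z ((x \ox[HK] y) \ox[HK_L] z) = x \ox[H_KL] (y \ox[KL] z).
Proof.
have [] := @bop_extend R HK_L H_KL
  (fun z w => exists s, z = lsum s /\ w = rsum s) 1 ler01.
- move=> c _ _ _ _ [s [-> ->]] [s' [-> ->]].
  by have [s'' [-> ->]] := sums_lin c s s'; exists s''.
- by move=> _ _ [s [-> ->]]; rewrite norm_sums mul1r.
- move=> z e e0.
  have [|s zs] := @dense_sum HK_L (fun x y z => (x \ox[HK] y) \ox[HK_L] z) z e _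
    lelem_dense e0; first by move=> c x y w; rewrite !tmulZl.
  by exists (lsum s), (rsum s); split=> //; exists s.
move=> Z ZG; exists Z => x y z; apply: ZG.
by exists [:: (x, y, z)]; rewrite /lsum /rsum !big_seq1.
Qed.

Let assoc_inv_ex : exists Z : 'B(H_KL, HK_L), forall x y z,
  Z (x \ox[H_KL] (y \ox[KL] z)) = (x \ox[HK] y) \ox[HK_L] z.
Proof.
have [] := @bop_extend R H_KL HK_L
  (fun z w => exists s, z = rsum s /\ w = lsum s) 1 ler01.
- move=> c _ _ _ _ [s [-> ->]] [s' [-> ->]].
  by have [s'' [-> ->]] := sums_lin c s s'; exists s''.
- by move=> _ _ [s [-> ->]]; rewrite norm_sums mul1r.
- move=> z e e0.
  have [|s zs] := @dense_sum H_KL (fun x y z => x \ox[H_KL] (y \ox[KL] z)) z e _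
    relem_dense e0; first by move=> c x y w; rewrite !tmulZl.
  by exists (rsum s), (lsum s); split=> //; exists s.
move=> Z ZG; exists Z => x y z; apply: ZG.
by exists [:: (x, y, z)]; rewrite /lsum /rsum !big_seq1.
Qed.

Lemma assocopE x y z :
  alpha ((x \ox[HK] y) \ox[HK_L] z) = x \ox[H_KL] (y \ox[KL] z).
Proof. exact: (xgetPex (0 : 'B(HK_L, H_KL)) assoc_ex). Qed.

Lemma assocop_adjK : adj alpha \bo alpha = bid HK_L.
Proof.
apply: (bop_eq_dense lelem_dense) => _ [x [y [z ->]]].
apply: (dot_ext_dense lelem_dense) => _ [u [v [w ->]]].
by rewrite /= -adjE !assocopE !dot_tmul mulrA.
Qed.

(** The extension in the opposite direction is a right inverse of the isometry
    [alpha], hence equal to its adjoint. *)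
Lemma assocop_adjVK : alpha \bo adj alpha = bid H_KL.
Proof.
have [Z ZE] := assoc_inv_ex.
have aZ : alpha \bo Z = bid H_KL.
  apply: (bop_eq_dense relem_dense) => _ [x [y [z ->]]].
  by rewrite /= ZE assocopE.
suff -> : adj alpha = Z by [].
by rewrite -[RHS]bcomp1l -assocop_adjK -bcompA aZ bcomp1.
Qed.

Lemma assocop_adjE x y z :
  adj alpha (x \ox[H_KL] (y \ox[KL] z)) = (x \ox[HK] y) \ox[HK_L] z.
Proof.
by rewrite -assocopE -[LHS]/((adj alpha \bo alpha) _) assocop_adjK.
Qed.

(** The ampliation [T \ox 1], transported by the associativity of the tensor
    product. *)
Definition ampl (T : 'B(HK)) : 'B(H_KL) :=
  alpha \bo tensop HK_L HK_L T (bid L) \bo adj alpha.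

Lemma ampl_comp S T : ampl (S \bo T) = ampl S \bo ampl T.
Proof.
rewrite /ampl -[RHS]bcompA -[in RHS](bcompA alpha) [in RHS](bcompA (adj alpha)).
rewrite [in RHS](bcompA (adj alpha) alpha) assocop_adjK bcomp1l.
by rewrite [in RHS]bcompA -!bcompA [in RHS](bcompA (tensop _ _ _ _))
  tensop_comp bcomp1.
Qed.

Lemma ampl_adj S : adj (ampl S) = ampl (adj S).
Proof. by rewrite /ampl !adj_comp adjK tensop_adj adj_bid bcompA. Qed.

Lemma amplB S T : ampl (S - T) = ampl S - ampl T.
Proof. by rewrite /ampl tensopBl bcompBr bcompBl. Qed.

Lemma ampl1 : ampl (bid HK) = bid H_KL.
Proof. by rewrite /ampl tensop1 bcomp1 assocop_adjVK. Qed.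

Lemma ampl_tensop (A : 'B(H)) (X : 'B(K)) :
  ampl (tensop HK HK A X) = tensop H_KL H_KL A (tensop KL KL X (bid L)).
Proof.
apply: (bop_eq_dense relem_dense) => _ [x [y [z ->]]].
by rewrite /= assocop_adjE !tensopE assocopE.
Qed.

End Assoc.

(** * Orthonormal bases and traces *)

Section Bases.
Set Implicit Arguments.
Unset Strict Implicit.
Variable R : realType.
Implicit Types H K : hilbertType R.

(** A maximal orthonormal set spans a dense subspace: otherwise the projection
    theorem provides a unit vector orthogonal to it. *)
Lemma exists_orthonormal_basis H : exists E : set H, orthonormal_basis E.
Proof.
pose P (A : set H) := forall x y, A x -> A y -> '[x, y] = (x == y)%:R.
have [F FP Ftot|A [PA Amax]] := @Zorn_bigcup H P.
  move=> x y [X FX Xx] [Y FY Yy].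
  by case: (Ftot _ _ FX FY) => [XY|YX]; [apply: (FP Y)|apply: (FP X)] => //;
    [exact: XY|exact: YX].
exists A; split=> //; apply/seteqP; split=> // z _.
have SS : subspace (closure (lspan A)).
  by apply: closure_subspace; exact: lspan_subspace.
have [p Sp zp] := exists_proj SS (@closure_closure _ _ _) z.
have [r0|r0] := eqVneq (z - p) 0.
  by move/eqP : r0; rewrite subr_eq0 => /eqP ->.
pose e := `|z - p|^-1 *: (z - p).
have Ae x : A x -> '[x, e] = 0.
  by move=> Ax; rewrite dotZr zp ?mulr0//; exact/subset_closure/lspan_in.
have ee : '[e, e] = 1.
  by rewrite dotxx normrZ normfV normr_id mulVf ?normr_eq0// expr1n.
exfalso; apply: (Amax (A `|` [set e])).
  split; first by move=> x; left.
  by move=> /(_ e (or_intror erefl)) /Ae; rewrite ee => /eqP; rewrite oner_eq0.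
have AeF x : A x -> (x == e) = false.
  move=> Ax; apply/negP => /eqP xe; have := Ae _ Ax.
  by rewrite xe ee => /eqP; rewrite oner_eq0.
move=> x y [Ax|->] [Ay|->]; first exact: PA.
- by rewrite Ae// AeF.
- by rewrite dotC Ae// rmorph0 eq_sym AeF.
- by rewrite ee eqxx.
Qed.

Lemma is_sum_unique (I : choiceType) (E : set I) (f : I -> R[i]) s t :
  is_sum E f s -> is_sum E f t -> s = t.
Proof.
move=> fs ft; apply/eqP; rewrite -subr_eq0; apply/eqP.
apply: (@small_eq0_mul _ _ _ 2) => // e e0.
have [A [fA AE As]] := fs _ e0; have [B [fB BE Bt]] := ft _ e0.
have fAB : finite_set (A `|` B) by rewrite finite_setU.
have ABE : A `|` B `<=` E by rewrite subUset.
have sA := As _ fAB (@subsetUl _ A B) ABE.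
have tB := Bt _ fAB (@subsetUr _ A B) ABE.
move: sA tB; set u := \sum_(i \in _) _ => us ut.
have -> : s - t = (u - t) - (u - s) by rewrite opprB [RHS]addrC addrA subrK.
by rewrite (le_trans (ler_normB _ _))// mulrDl mul1r lerD// ltW.
Qed.

(** A finite sum of the [P e] is a projection. It fixes a vector close to [y]
    once it includes finitely many given indices, so that it almost fixes [y].
    The family [P] is abstract in order to cover both the rank one projections
    of a basis and their ampliations to a tensor product. *)
Lemma parseval_proj H K (E : set H) (P : H -> 'B(K)) (D : set K) (x y : K) :
  (forall e, adj (P e) = P e) ->
  (forall e f, E e -> E f -> P e \bo P f = if e == f then P e else 0) ->
  closure (lspan D) = setT -> (forall z, D z -> exists2 e, E e & P e z = z) ->
  is_sum E (fun e => '[x, P e y]) '[x, y].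
Proof.
move=> Pa PP clD DP e e0.
have x1 : 0 < `|x| + 1 by rewrite ltr_wpDl.
have : closure (lspan D) y by rewrite clD.
move=> /closure_norm /(_ _ (divr_gt0 e0 x1)) [_ [n [c [v [Dv ->]]]] yv].
have /choice[g gP] i : exists e, E e /\ P e (v i) = v i.
  by have [f] := DP _ (Dv i); exists f.
exists (range g); split; first exact/finite_image/finite_finset.
  by move=> _ [i _ <-]; case: (gP i).
move=> B fB gB BE; rewrite fsbig_finite//=.
set t := fset_set B.
have tB f : f \in t = (f \in B) by rewrite in_fset_set.
pose Q := \sum_(f <- t) P f.
have ut : uniq t by exact: fset_uniq.
have QP f : B f -> Q \bo P f = P f.
  move=> Bf; apply: bopP => z; rewrite /= bop_sumE (bigD1_seq f)//=; last first.
    by rewrite tB; exact/mem_set.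
  rewrite -[P f (P f z)]/((P f \bo P f) z) PP ?eqxx; [|exact: BE..].
  rewrite big_seq_cond big1 ?addr0// => f' /andP[];
    rewrite tB => /set_mem Bf' ff'.
  by rewrite -[LHS]/((P f' \bo P f) z) PP ?(negPf ff')//; exact: BE.
have QQ : Q \bo Q = Q.
  apply: bopP => z /=; rewrite [Q z]bop_sumE bop_sum !big_seq.
  apply: eq_bigr => f; rewrite tB => /set_mem Bf.
  by rewrite -[LHS]/((Q \bo P f) z) QP.
have Qa : adj Q = Q.
  apply: adj_unique => a b; rewrite !bop_sumE dot_suml dot_sumr.
  by apply: eq_bigr => f _; rewrite adjE Pa.
rewrite -dot_sumr -bop_sumE -/Q -dotBr -normrN -dotNr opprB.
set y' := \sum_(i < n) _ in yv.
have Qy' : Q y' = y'.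
  rewrite /y' bop_sum; apply: eq_bigr => i _; rewrite bopZ.
  have [_ <-] := gP i; rewrite -[X in _ *: X = _]/((Q \bo P (g i)) (v i)) QP//.
  by apply: gB; exists i.
rewrite (le_lt_trans (cauchy_schwarz _ _))//.
rewrite (le_lt_trans (ler_wpM2l _ (proj_approx y Qa QQ Qy')))//.
rewrite (@le_lt_trans _ _ ((`|x| + 1) * `|y - y'|))//.
  by rewrite ler_wpM2r// lerDl.
by rewrite mulrC -ltr_pdivlMr.
Qed.

Lemma parseval H (E : set H) (x y : H) : orthonormal_basis E ->
  is_sum E (fun e => '[x, e] * '[e, y]) '[x, y].
Proof.
move=> [oE clE].
have -> : (fun e => '[x, e] * '[e, y]) = (fun e => '[x, ketbra e e y]).
  by apply/funext => e /=; rewrite dotZr mulrC.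
apply: (parseval_proj (D := E)) => //.
- by move=> e; rewrite adj_ketbra.
- move=> e f Ee Ef; apply: bopP => z /=; rewrite dotZr (oE e f)//.
  by case: eqVneq => [->|_] /=; rewrite ?mulr1// mulr0 scale0r.
- by move=> e Ee; exists e; rewrite //= oE// eqxx scale1r.
Qed.

Lemma parseval_tensor H K (T : tensor H K) (E : set H) (x y : T) :
  orthonormal_basis E ->
  is_sum E (fun e => '[x, tensop T T (ketbra e e) (bid K) y]) '[x, y].
Proof.
move=> [oE clE].
apply: (parseval_proj (D := [set e \ox[T] v | e in E & v in setT])).
- by move=> e; rewrite tensop_adj adj_ketbra adj_bid.
- move=> e f Ee Ef; rewrite tensop_comp; case: eqVneq => [->|ef].
    rewrite bcomp1; congr tensop; apply: bopP => z /=.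
    by rewrite dotZr (oE f f)// eqxx mulr1.
  apply: bop_eq_elem => z w;
    rewrite tensopE /= dotZr (oE e f)// (negPf ef) mulr0.
  by rewrite scale0r tmul0l.
- exact: elem_dense clE (lspan_closure_setT K).
- by move=> _ [e Ee [v _ <-]]; exists e;
  rewrite // tensopE /= oE// eqxx scale1r.
Qed.

Lemma isometric_adjE H K (F : 'B(H, K)) x : isometric F -> adj F (F x) = x.
Proof. by move=> iF; rewrite -[LHS]/((adj F \bo F) x) isometric_adj. Qed.

Lemma dot_dagger H (x y : H) : '[dagger x, dagger y] = '[y, x].
Proof. by []. Qed.

Lemma has_trace_unique H (A : 'B(H)) s t : has_trace A s -> has_trace A t -> s
  = t.
Proof.
have [E oE] := exists_orthonormal_basis H.
by move=> /(_ E oE) As /(_ E oE); exact: is_sum_unique.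
Qed.

Lemma trace_ketbra H (u v : H) (B : 'B(H)) : has_trace (ketbra v u \bo B) '[u,
  B v].
Proof.
move=> E oE; rewrite adjE'.
have -> : (fun e => '[e, (ketbra v u \bo B) e])
    = (fun e => '[adj B u, e] * '[e, v]).
  by apply/funext => e /=; rewrite dotZr adjE'.
exact: parseval.
Qed.

Lemma hilbert_schmidt_ketbra H (u v : H) : hilbert_schmidt (ketbra u v).
Proof. by rewrite /hilbert_schmidt adj_ketbra; eexists;
  exact: trace_ketbra. Qed.

End Bases.

(** * The vector of a normal state *)

Section StateVector.
Set Implicit Arguments.
Unset Strict Implicit.
Variables (R : realType) (K K0 : hilbertType R) (rho : {scalar 'B(K)})
  (D S : 'B(K)) (F : 'B(K0, K)) (KK : tensor K (conj_space K))
  (khat : tensor K (conj_space K0)) (U : 'B(K) -> KK) (omega : khat).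
Hypotheses (densD : density_matrix rho D) (sqrtS : is_sqrt S D)
  (isoF : isometric F) (ranF : range F = closure (range S))
  (isoU : is_HS_isomorphism U)
  (omegaE : tensop khat KK (bid K) (conjop F) omega = U S).

Let adjS : adj S = S. Proof. by case: sqrtS => /posop_adj. Qed.
Let SS : S \bo S = D. Proof. by case: sqrtS. Qed.

(** The trace of [ketbra v u \bo S] is given by Parseval's identity. *)
Let dot_US u v : '[u \ox[KK] dagger v, U S] = '[u, S v].
Proof.
have [_ Udot _ Uket] := isoU.
have HS : hilbert_schmidt S.
  exists (rho (bid K)); rewrite adjS SS -[D]bcomp1.
  by case: densD => _; exact.
rewrite -Uket; apply: (has_trace_unique (Udot _ _ (hilbert_schmidt_ketbra u v)
  HS)).
by rewrite adj_ketbra; exact: trace_ketbra.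
Qed.

Let dot_ketbra_US u v :
  '[U S, tensop KK KK (ketbra u v) (bid (conj_space K)) (U S)] = '[v, D u].
Proof.
rewrite tensop_ketbra1 /=.
have -> : adj (Lket KK v) (U S) = dagger (S v).
  apply: dot_extl => y; rewrite -adjE /= -[y]/(dagger (y : K)) dot_US.
  by rewrite dot_dagger adjE adjS.
rewrite dotC dot_US -dotC -SS /=.
by rewrite !adjE adjS.
Qed.

(** The slices of [U S] along a basis of the first factor are the vectors [S e],
    and the terms of Parseval's identity become those of the trace of [D \bo A],
    in this order of the factors, so that no cyclicity of the trace enters. *)
Let rho_US A : rho A = '[U S, tensop KK KK A (bid (conj_space K)) (U S)].
Proof.
have [E oE] := exists_orthonormal_basis K.
have [_ rhoD] := densD.
apply: (is_sum_unique (rhoD A E oE)).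
set I := bid (conj_space K).
have -> : '[U S, tensop KK KK A I (U S)]
    = '[tensop KK KK (adj A) I (U S), U S].
  by rewrite [RHS]adjE tensop_adj adjK adj_bid.
have -> : (fun e => '[e, (D \bo A) e])
    = (fun e => '[tensop KK KK (adj A) I (U S), tensop KK KK (ketbra e e) I (U
      S)]).
  apply/funext => e; rewrite [RHS]adjE tensop_adj adjK adj_bid.
  rewrite -[X in '[U S, X]]/((tensop KK KK A I \bo tensop KK KK (ketbra e e) I)
    (U S)).
  rewrite tensop_comp bcomp1.
  have -> : A \bo ketbra e e = ketbra (A e) e.
    by apply: bopP => z /=; rewrite bopZ.
  by rewrite dot_ketbra_US.
exact: parseval_tensor.
Qed.

Let J := tensop khat KK (bid K) (conjop F).

Let adjJ : adj J \bo J = bid khat.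
Proof.
rewrite /J tensop_adj tensop_comp adj_bid bcomp1 -[RHS]tensop1; congr tensop.
apply: bopP => x; apply: dot_extl => y.
rewrite /= -adjE -[x]/(dagger (x : K0)) -[y]/(dagger (y : K0)) !conjopE.
by rewrite !dot_dagger isoF.
Qed.

Lemma dot_elem_omega u w : '[u \ox[khat] dagger w, omega] = '[u, S (F w)].
Proof.
rewrite -[omega]/(bid khat omega) -adjJ /= -adjE /J tensopE conjopE -/J omegaE.
exact: dot_US.
Qed.

Lemma state_vector A :
  rho A = '[omega, tensop khat khat A (bid (conj_space K0)) omega].
Proof.
rewrite -[X in '[omega, X]]/(bid khat _) -adjJ /= -adjE omegaE.
have JA : J \bo tensop khat khat A (bid _) = tensop KK KK A (bid _) \bo J.
  by rewrite /J !tensop_comp !bcomp1 !bcomp1l.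
by rewrite -[X in '[_, X]]/((J \bo tensop khat khat A _) omega) JA /= omegaE
  rho_US.
Qed.

Lemma range_proj : orthproj (closure (range S)) = F \bo adj F.
Proof.
have SR : subspace (closure (range S)).
  apply: closure_subspace; split; first by exists 0; rewrite // bop0.
  by move=> c _ _ [x _ <-] [y _ <-]; exists (c *: x + y); rewrite // bop_lin.
apply: bopP => x.
rewrite -{1}[x](subrK (F (adj F x))) bopD orthproj_eq0.
- rewrite add0r orthproj_id//; first exact: closure_closure.
  by rewrite -ranF; exists (adj F x).
- exact: SR.
- exact: closure_closure.
- move=> y; rewrite -ranF => -[z _ <-]; rewrite adjE bopB.
  by rewrite isometric_adjE// subrr dot0r.
Qed.

Lemma proj_omega :
  tensop khat khat (F \bo adj F) (bid (conj_space K0)) omega = omega.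
Proof.
apply: dot_ext_elem => u w; rewrite -[w]/(dagger (w : K0)) adjE' tensop_adj.
rewrite adj_bid adj_comp adjK tensopE !dot_elem_omega /=.
have : range F (S (F w)).
  by rewrite ranF; apply: subset_closure; exists (F w).
by move=> [z _ <-]; rewrite adjE isometric_adjE// adjE adjK.
Qed.

(** The hypothesis makes [A] vanish on the range of [adj F \bo S], which is
    dense. *)
Lemma omega_separating (A : 'B(K0)) :
  tensop khat khat (F \bo A \bo adj F) (bid (conj_space K0)) omega = 0 -> A = 0.
Proof.
move=> A0.
have AS w : A (adj F (S (F w))) = 0.
  apply: dot_extl => u; rewrite dot0r.
  have := congr1 (fun z => '[F u \ox[khat] dagger w, z]) A0.
  rewrite dot0r adjE' tensop_adj adj_bid tensopE dot_elem_omega.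
  by rewrite -adjE' /= adjE isometric_adjE.
have SFF x : S x = S (F (adj F x)).
  apply: dot_extl => u; rewrite !adjE' adjS.
  have : range F (S u) by rewrite ranF; apply: subset_closure; exists u.
  by move=> [z _ <-]; rewrite adjK isometric_adjE.
apply: bopP => x.
have : closure (range S) (F x) by rewrite -ranF; exists x.
have sub0 : closure [set 0 : K0] `<=` [set 0].
  by have /closure_id <- : closed [set 0 : K0] by apply:
    accessible_closed_set1; exact: hausdorff_accessible.
move=> /(closureS (B := [set y | [set 0] ((A \bo adj F) y)])) Fx.
have : (A \bo adj F) (F x) = 0.
  apply: (preimage_closed (A := A \bo adj F) sub0); apply: Fx => _ [y _ <-] /=.
  by rewrite SFF AS.
by rewrite /= isometric_adjE.
Qed.

End StateVector.

(** * Ultraweakly continuous functionals *)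

Section Ultraweak.
Set Implicit Arguments.
Unset Strict Implicit.
Variable R : realType.
Implicit Types H K L : hilbertType R.

Lemma cvg_epsC (u : nat -> R[i]) (l : R[i]) :
  (forall e : R[i], 0 < e -> exists N, forall n, (N <= n)%N -> `|l - u n| < e)
  <-> ((u : nat -> R[i]^o) @ \oo --> (l : R[i]^o)).
Proof.
split=> [ul|/cvgrPdist_lt ul e e0].
  by apply/cvgrPdist_lt => e e0; have [N Nu] := ul e e0; exists N.
by have [N _ Nu] := ul e e0; exists N.
Qed.

Lemma tensop_ketbra_r H L (T : tensor H L) (X : 'B(H)) (x y : L) :
  tensop T T X (ketbra x y) = Eket T x \bo X \bo Ebra T y.
Proof.
apply: bop_eq_elem => u v; rewrite tensopE /= EbraE bopZ tmulZl tmulZr.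
by [].
Qed.

Lemma square_summable_tail H (x : nat -> H) (e : R[i]) :
  square_summable x -> 0 < e ->
  exists N, forall m n, (N <= m)%N -> (m <= n)%N ->
    \sum_(m <= k < n) `|x k| ^+ 2 <= e.
Proof.
move=> /cvg_ex[l /cvg_epsC xl] e0.
have e2 : 0 < e / 2 by rewrite divr_gt0.
have [N Nl] := xl _ e2; exists N => m n Nm mn.
have := Nl n (leq_trans Nm mn); have := Nl m Nm.
rewrite /series /= (big_cat_nat _ mn)//=.
set a := \sum_(0 <= k < m) _; set b := \sum_(m <= k < n) _ => la lab.
have b0 : 0 <= b by apply: sumr_ge0 => k _; rewrite exprn_ge0.
rewrite -[b]ger0_norm// (_ : b = (l - a) - (l - (a + b))); last by ring.
by rewrite (le_trans (ler_normB _ _))// (splitr e) lerD// ltW.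
Qed.

Lemma mul_le_sqrD (a b : R[i]) : 0 <= a -> 0 <= b -> a * b <= a ^+ 2 + b ^+ 2.
Proof.
move=> a0 b0; have /orP[ab|ba] := real_leVge (ger0_real a0) (ger0_real b0).
  by rewrite (@le_trans _ _ (b ^+ 2))// ?lerDr ?exprn_ge0// expr2 ler_wpM2r.
by rewrite (@le_trans _ _ (a ^+ 2))// ?lerDl ?exprn_ge0// expr2 ler_wpM2l.
Qed.

(** By the Cauchy-Schwarz inequality a tail of the series that defines [f T] is
    at most [M] times the tails of the two sums of squared norms, uniformly
    in [T]. *)
Lemma uw_form_approx H (f : 'B(H) -> R[i]) (M e : R[i]) :
  uw_form f -> 0 <= M -> 0 < e -> exists s : seq (H * H), forall T : 'B(H),
    (forall v, `|T v| <= M * `|v|) -> `|f T - \sum_(p <- s) '[p.1, T p.2]| <= e.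
Proof.
move=> [x [y [sx sy fxy]]] M0 e0.
have M1 : 0 < M + 1 by rewrite ltr_wpDl.
have d0 : 0 < e / (M + 1) / 2 by rewrite !divr_gt0.
have [N1 Nx] := square_summable_tail sx d0.
have [N2 Ny] := square_summable_tail sy d0.
pose N := maxn N1 N2.
exists [seq (x k, y k) | k <- index_iota 0 N] => T TM; rewrite big_map /=.
apply/ler_addgt0Pr => r r0.
have /cvg_epsC /(_ r r0)[N3 Nf] := fxy T.
pose n := maxn N N3.
have Nn : (N <= n)%N by rewrite leq_maxl.
have := Nf n (leq_maxr _ _); rewrite /series /= (big_cat_nat _ Nn)//=.
set a := \sum_(0 <= k < N) _; set b := \sum_(N <= k < n) _ => fab.
have be : `|b| <= e.
  rewrite (le_trans (ler_norm_sum _ _ _))//.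
  apply: (@le_trans _ _ (\sum_(N <= k < n) M * (`|x k| ^+ 2 + `|y k| ^+ 2))).
    apply: ler_sum => k _; rewrite (le_trans (cauchy_schwarz _ _))//.
    rewrite (le_trans (ler_wpM2l _ (TM _)))// mulrCA ler_wpM2l//.
    exact: mul_le_sqrD.
  rewrite -mulr_sumr big_split /=.
  apply: (@le_trans _ _ (M * (e / (M + 1)))).
    rewrite ler_wpM2l// [X in _ <= X](splitr (e / (M + 1))) lerD//.
      by apply: Nx => //; rewrite leq_maxl.
    by apply: Ny => //; rewrite leq_maxr.
  by rewrite mulrCA ger_pMr// ler_pdivrMr// mul1r lerDl.
rewrite (_ : f T - a = (f T - (a + b)) + b); last by ring.
by rewrite (le_trans (ler_normD _ _))// addrC lerD// ltW.
Qed.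

Lemma elem_dense_basis H L (T : tensor H L) (E : set L) (z : T) (e : R[i]) :
  closure (lspan E) = setT -> 0 < e ->
  exists2 s, `|z - elem_sum T s| < e & {in s, forall p, E p.2}.
Proof.
move=> clE e0.
have : closure (lspan [set x \ox[T] y | x in setT & y in E]) z.
  by rewrite (elem_dense T (lspan_closure_setT H) clE).
move=> /closure_norm /(_ e e0) [_ [n [c [v [vT ->]]]] zv].
have /choice[f fP] i : exists p : H * L, p.1 \ox[T] p.2 = v i /\ E p.2.
  by have [x _ [y Ey <-]] := vT i; exists (x, y).
exists [seq (c i *: (f i).1, (f i).2) | i <- index_enum 'I_n]; last first.
  by move=> _ /mapP[i _ ->] /=; case: (fP i).
suff -> : elem_sum T [seq (c i *: (f i).1, (f i).2) | i <- index_enum 'I_n]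
    = \sum_(i < n) c i *: v i by [].
rewrite /elem_sum big_map; apply: eq_bigr => i _; rewrite tmulZl.
by have [-> _] := fP i.
Qed.

Lemma elem_sum_fix H L (T : tensor H L) (A : 'B(H)) (Q : 'B(L)) s :
  {in s, forall p, A p.1 = p.1} -> {in s, forall p, Q p.2 = p.2} ->
  tensop T T A Q (elem_sum T s) = elem_sum T s.
Proof.
move=> sA sQ; rewrite /elem_sum bop_sum !big_seq; apply: eq_bigr => p ps.
by rewrite tensopE sA// sQ.
Qed.

Lemma tensop_proj H L (T : tensor H L) (P : 'B(H)) (Q : 'B(L)) :
  adj P = P -> P \bo P = P -> adj Q = Q -> Q \bo Q = Q ->
  adj (tensop T T P Q) = tensop T T P Q /\
  tensop T T P Q \bo tensop T T P Q = tensop T T P Q.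
Proof. by move=> aP PP aQ QQ; rewrite tensop_adj tensop_comp aP PP aQ QQ. Qed.

(** Two vectors of a tensor product only see countably many elements of an
    orthonormal basis of the second factor. The sequence [b] enumerates these
    without repetition, with zeros in place of the repeated ones. *)
Lemma slice_sequence H L (T : tensor H L) (xi eta : T) :
  exists b : nat -> L, forall e : R[i], 0 < e ->
    exists N, forall n, (N <= n)%N ->
    let Q := tensop T T (bid H) (\sum_(0 <= k < n) ketbra (b k) (b k)) in
    `|xi - Q xi| < e /\ `|eta - Q eta| < e.
Proof.
have [E [oE clE]] := exists_orthonormal_basis L.
have inv0 n : 0 < (n.+1%:R^-1 : R[i]) by rewrite invr_gt0.
have /choice[sx sxP] n : exists s, `|xi - elem_sum T s| < n.+1%:R^-1 /\
    {in s, forall p, E p.2}.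
  by have [s] := elem_dense_basis xi clE (inv0 n); exists s.
have /choice[sy syP] n : exists s, `|eta - elem_sum T s| < n.+1%:R^-1 /\
    {in s, forall p, E p.2}.
  by have [s] := elem_dense_basis eta clE (inv0 n); exists s.
pose w n := [seq p.2 | p <- sx n ++ sy n].
pose c m : L := if choice.unpickle m is Some ni then nth 0 (w ni.1) ni.2 else 0.
have cE m : c m != 0 -> E (c m).
  rewrite /c; case: choice.unpickle => [[n i]|] /=; last by rewrite eqxx.
  have [iw _|] := ltnP i (size (w n)); last by move=> /(nth_default 0) ->;
    rewrite eqxx.
  have := mem_nth 0 iw => /mapP[p]; rewrite mem_cat => + ->.
  by move=> /orP[]; [case: (sxP n) => _; exact|case: (syP n) => _; exact].
have wc n x : x \in w n -> exists m, c m = x.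
  by move=> xw; exists (choice.pickle (n, index x (w n)));
    rewrite /c choice.pickleK /= nth_index.
have E0 x : E x -> x != 0.
  move=> Ex; have := oE _ _ Ex Ex; rewrite eqxx => xx; apply/eqP => x0.
  by move: xx; rewrite x0 dot0l => /eqP; rewrite eq_sym oner_eq0.
pose t := fix t n := if n is n'.+1 then
  (if (c n' == 0) || (c n' \in t n') then t n' else c n' :: t n') else [::].
pose b n := if (c n == 0) || (c n \in t n) then 0 else c n.
have tE n x : x \in t n -> E x.
  elim: n => //= n IH; case: ifPn => // /norP[cn0 _].
  by rewrite inE => /orP[/eqP ->|//]; exact: cE.
have ot n : onseq (t n).
  split; last first.
    by move=> x y /tE Ex /tE Ey; exact: oE.
  elim: n => //= n IH; case: ifPn => // /norP[_ ct].
  by rewrite /= ct.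
have bt n : \sum_(0 <= k < n) ketbra (b k) (b k) = oproj (t n).
  elim: n => [|n IH]; first by rewrite big_geq// /oproj big_nil.
  rewrite big_nat_recr//= IH /b; case: ifP => _.
    suff -> : ketbra (0 : L) (0 : L) = 0 by rewrite addr0.
    by apply: bopP => x /=; rewrite scaler0.
  by rewrite /oproj big_cons addrC.
have ct m n : (m < n)%N -> E (c m) -> c m \in t n.
  move=> + Ecm; elim: n => //= n IH; rewrite ltnS leq_eqVlt => /orP[/eqP <-|mn].
    by case: ifPn => [/orP[|//]|_];
      [rewrite (negPf (E0 _ Ecm))|rewrite inE eqxx].
  by case: ifP => _; rewrite ?inE IH// orbT.
have wt n : exists N, forall k, (N <= k)%N -> {in w n, forall x, x \in t k}.
  have : {in w n, forall x, E x}.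
    move=> _ /mapP[p + ->]; rewrite mem_cat.
    by move=> /orP[]; [case: (sxP n) => _; exact|case: (syP n) => _; exact].
  have : {in w n, forall x, exists m, c m = x} by move=> x; exact: wc.
  elim: (w n) => [|x s IH] sc sE; first by exists 0%N.
  have [x' xs|x' xs|N Ns] := IH.
  - by apply: sc; rewrite inE xs orbT.
  - by apply: sE; rewrite inE xs orbT.
  have [m cm] := sc x (mem_head _ _).
  exists (maxn N m.+1) => k; rewrite geq_max => /andP[Nk mk] x'.
  rewrite inE => /orP[/eqP ->|]; last exact: Ns.
  by rewrite -cm; apply: ct => //; rewrite cm; apply: sE; rewrite mem_head.
exists b => e e0; have [n ne] := inv_lt_eps e0; have [N Nt] := wt n.
exists N => k Nk /=; rewrite bt; set Q := tensop _ _ _ _.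
have [Qa QQ] : adj Q = Q /\ Q \bo Q = Q.
  apply: tensop_proj; rewrite ?adj_bid ?bcomp1 ?oproj_adj//.
  exact: oproj_idem.
have Qfix s : {subset s <= sx n ++ sy n} -> Q (elem_sum T s) = elem_sum T s.
  move=> sw; apply: elem_sum_fix => // p ps; apply: oproj_mem => //.
  by apply: Nt => //; apply: map_f; exact: sw.
split.
  rewrite (le_lt_trans (proj_approx xi Qa QQ (Qfix (sx n) _)))//.
    by move=> p; rewrite mem_cat => ->.
  by rewrite (lt_trans _ ne)//; case: (sxP n).
rewrite (le_lt_trans (proj_approx eta Qa QQ (Qfix (sy n) _)))//.
  by move=> p; rewrite mem_cat => ->; rewrite orbT.
by rewrite (lt_trans _ ne)//; case: (syP n).
Qed.

(** Slicing both vectors along the sequence of [slice_sequence] turns the inner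
    product into a series of vector forms. *)
Lemma uw_form_ampl H L (T : tensor H L) (xi eta : T) :
  uw_form (fun X : 'B(H) => '[xi, tensop T T X (bid L) eta]).
Proof.
have [b bP] := slice_sequence xi eta.
have sumE (X : 'B(H)) (x y : T) n :
    \sum_(0 <= k < n) '[Ebra T (b k) x, X (Ebra T (b k) y)]
    = '[x, tensop T T X (bid L)
        (tensop T T (bid H) (\sum_(0 <= k < n) ketbra (b k) (b k)) y)].
  rewrite -[X in '[x, X]]/((tensop T T X (bid L) \bo tensop T T _ _) y).
  rewrite tensop_comp bcomp1 bcomp1l tensop_sumr bop_sumE dot_sumr.
  apply: eq_bigr => k _; rewrite tensop_ketbra_r /=.
  by rewrite {1}/Ebra -adjE'.
have lim (X : 'B(H)) (x y : T) : (forall e : R[i], 0 < e -> exists N, forall n,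
  (N <= n)%N ->
      `|y - tensop T T (bid H) (\sum_(0 <= k < n) ketbra (b k) (b k)) y| < e) ->
    (series (fun k => '[Ebra T (b k) x, X (Ebra T (b k) y)] : R[i]^o)) @ \oo -->
      ('[x, tensop T T X (bid L) y] : R[i]^o).
  move=> yb; apply/cvg_epsC => e e0.
  have [M M0 XM] := bop_bound (tensop T T X (bid L)).
  have x1 : 0 < (`|x| + 1) * M by rewrite mulr_gt0// ltr_wpDl.
  have [N Ny] := yb _ (divr_gt0 e0 x1); exists N => n Nn.
  rewrite /series /= sumE -dotBr -bopB (le_lt_trans (cauchy_schwarz _ _))//.
  rewrite (le_lt_trans (ler_wpM2l _ (XM _)))// mulrA.
  rewrite (@le_lt_trans _ _ ((`|x| + 1) * M * `|y - tensop T T (bid H)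
    (\sum_(0 <= k < n) ketbra (b k) (b k)) y|))//.
    by rewrite ler_wpM2r// ler_wpM2r ?ltW// ltrDl.
  by rewrite mulrC -ltr_pdivlMr// Ny.
have sq (x : T) : (forall e : R[i], 0 < e -> exists N, forall n, (N <= n)%N ->
      `|x - tensop T T (bid H) (\sum_(0 <= k < n) ketbra (b k) (b k)) x| < e) ->
    square_summable (fun k => Ebra T (b k) x).
  move=> xb; apply/cvg_ex; exists '[x, tensop T T (bid H) (bid L) x].
  have -> : (fun k => `|Ebra T (b k) x| ^+ 2 : R[i]^o)
      = (fun k => '[Ebra T (b k) x, bid H (Ebra T (b k) x)] : R[i]^o).
    by apply/funext => k; rewrite /= dotxx.
  exact: lim.
exists (fun k => Ebra T (b k) xi), (fun k => Ebra T (b k) eta); split.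
- by apply: sq => e /bP[N Nb]; exists N => n /Nb[].
- by apply: sq => e /bP[N Nb]; exists N => n /Nb[].
- by move=> X; apply: lim => e /bP[N Nb]; exists N => n /Nb[].
Qed.

Lemma uw_form_vec H (u v : H) : uw_form (fun X : 'B(H) => '[u, X v]).
Proof.
have lim (x y : H) (X : 'B(H)) : (series (fun k =>
    '[if k == 0%N then x else 0, X (if k == 0%N then y else 0)] : R[i]^o)) @
      \oo -->
      ('[x, X y] : R[i]^o).
  apply/cvg_epsC => e e0; exists 1%N => -[//|n] _.
  rewrite /series /= big_nat_recl//= big1 ?addr0 ?subrr ?normr0//.
  by move=> i _; rewrite dot0l.
have sq (x : H) : square_summable (fun k => if k == 0%N then x else 0).
  apply/cvg_ex; exists '[x, bid H x].
  have -> : (fun k => `|if k == 0%N then x else 0| ^+ 2 : R[i]^o)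
      = (fun k => '[if k == 0%N then x else 0,
                    bid H (if k == 0%N then x else 0)] : R[i]^o).
    by apply/funext => k; rewrite /= dotxx.
  exact: lim.
by exists (fun k => if k == 0%N then u else 0), (fun k => if k == 0%N then v
  else 0).
Qed.

Lemma uw_continuous_formB H (f g : 'B(H) -> R[i]) :
  uw_continuous_form f -> uw_form g -> uw_continuous_form (fun T => f T - g T).
Proof.
move=> [n [k [kuw fk]]] guw.
exists n.+1, (fun i => oapp k g (unlift ord0 i)); split.
  move=> i; case: (unlift ord0 i) => [j|]; [exact: kuw|exact: guw].
move=> T; rewrite big_ord_recl unlift_none /= (le_trans (ler_normB _ _))//
  addrC lerD//.
by rewrite (le_trans (fk T))//; apply: ler_sum => i _; rewrite liftK.
Qed.

(** The orthonormal systems are adapted to sums of elementary tensors that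
    approximate the given vectors. *)
Lemma approx_proj H K (T : tensor H K) (s : seq T) (e : R[i]) : 0 < e ->
  exists t u, [/\ onseq t, onseq u &
    {in s, forall v, `|v - tensop T T (oproj t) (oproj u) v| <= e}].
Proof.
move=> e0; have /choice[f fP] z : exists r, `|z - elem_sum T r| < e.
  exact: elem_dense_sum.
have [t ot tP] := gram_schmidt0 [seq p.1 | p <- flatten [seq f z | z <- s]].
have [u ou uP] := gram_schmidt0 [seq p.2 | p <- flatten [seq f z | z <- s]].
exists t, u; split=> // v vs; set Q := tensop _ _ _ _.
have [Qa QQ] : adj Q = Q /\ Q \bo Q = Q.
  by apply: tensop_proj; rewrite ?oproj_adj ?oproj_idem.
have fs p : p \in f v -> p \in flatten [seq f z | z <- s].
  by move=> pf; apply/flattenP; exists (f v) => //; exact: map_f.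
apply: (le_trans (proj_approx v Qa QQ (y := elem_sum T (f v)) _));
  last exact: ltW.
by apply: elem_sum_fix => p /fs ps; [apply: tP|apply: uP]; exact: map_f.
Qed.

Lemma bcomp_suml H K L (I : Type) (r : seq I) (A : I -> 'B(K, L)) (B : 'B(H,
  K)) :
  (\sum_(i <- r) A i) \bo B = \sum_(i <- r) (A i \bo B).
Proof. by apply: bopP => x; rewrite /= !bop_sumE. Qed.

Lemma bcomp_sumr H K L (I : Type) (r : seq I) (A : 'B(K, L)) (B : I -> 'B(H,
  K)) :
  A \bo (\sum_(i <- r) B i) = \sum_(i <- r) (A \bo B i).
Proof. by apply: bopP => x; rewrite /= !bop_sumE bop_sum. Qed.

Lemma compress_elem H K (T : tensor H K) (S : set 'B(T)) (t : seq H) (u : seq K)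
    (Z : 'B(T)) : subspace S -> (forall A X, S (tensop T T A X)) ->
  S (tensop T T (oproj t) (oproj u) \bo Z \bo tensop T T (oproj t) (oproj u)).
Proof.
move=> SS ST.
have -> : tensop T T (oproj t) (oproj u)
    = \sum_(e <- t) \sum_(g <- u) ketbra (e \ox[T] g) (e \ox[T] g).
  rewrite tensop_suml; apply: eq_bigr => e _; rewrite tensop_sumr.
  by apply: eq_bigr => g _; rewrite tensop_ketbra.
rewrite bcomp_sumr; apply: subspace_sum => // e _.
rewrite bcomp_sumr; apply: subspace_sum => // g _.
rewrite !bcomp_suml; apply: subspace_sum => // e' _.
rewrite !bcomp_suml; apply: subspace_sum => // g' _.
have -> : ketbra (e' \ox[T] g') (e' \ox[T] g') \bo Z \bo ketbra (e \ox[T] g) (e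
  \ox[T] g)
    = '[e' \ox[T] g', Z (e \ox[T] g)] *: tensop T T (ketbra e' e) (ketbra g' g).
  rewrite tensop_ketbra; apply: bopP => z /=.
  by rewrite bopZ dotZr mulrC -scalerA.
exact: subspaceZ.
Qed.

(** Compressions to finite dimensional product subspaces are sums of elementary
    tensors. They approximate an operator weakly with control of the norm. *)
Lemma uw_form_elem_eq0 H K (T : tensor H K) (f : 'B(T) -> R[i]) :
  (forall c A B, f (c *: A + B) = c * f A + f B) -> uw_continuous_form f ->
  (forall A X, f (tensop T T A X) = 0) -> forall Z, f Z = 0.
Proof.
move=> fl [n [g [guw fg]]] fT Z; apply: small_eq0 => e e0.
have f0 : f 0 = 0.
  by have := fl (-1) 0 0; rewrite scaler0 addr0 mulN1r addNr.
have SS : subspace [set X | f X = 0].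
  by split=> // c A B; rewrite /mkset fl => -> ->; rewrite mulr0 addr0.
have [M M0 ZM] := bop_bound Z.
have n1 : 0 < (n.+1%:R : R[i]) by [].
have e1 : 0 < e / 2 / n.+1%:R by rewrite !divr_gt0.
have M2 : 0 <= M * 2 by rewrite mulr_ge0// ltW.
have /choice[s sP] i : exists s : seq (T * T), forall X : 'B(T),
    (forall v, `|X v| <= M * 2 * `|v|) ->
    `|g i X - \sum_(p <- s) '[p.1, X p.2]| <= e / 2 / n.+1%:R.
  by have [s] := uw_form_approx (guw i) M2 e1; exists s.
pose W := \sum_(i < n) \sum_(p <- s i) M * (`|p.1| + `|p.2|).
have W0 : 0 <= W.
  apply: sumr_ge0 => i _; apply: sumr_ge0 => p _.
  by rewrite mulr_ge0 ?addr_ge0// ltW.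
have W1 : 0 < W + 1 by rewrite ltr_wpDl.
have d0 : 0 < e / 2 / (W + 1) by rewrite !divr_gt0.
pose z := flatten [seq flatten [seq [:: p.1; p.2] | p <- s i] | i <- enum 'I_n].
have [t [u [ot ou zP]]] := approx_proj z d0.
set d := e / 2 / (W + 1) in d0 zP.
set P := tensop _ _ _ _ in zP.
have [Pa PP] : adj P = P /\ P \bo P = P.
  by apply: tensop_proj; rewrite ?oproj_adj ?oproj_idem.
pose Y := Z - P \bo Z \bo P.
have fY : f Z = f Y.
  have := compress_elem t u Z SS fT; rewrite -/P /mkset => fP.
  have -> : Z = 1 *: (P \bo Z \bo P) + Y by rewrite scale1r addrC subrK.
  by rewrite fl fP mulr0 add0r.
have PM v : `|P v| <= `|v| by exact: proj_contract.
have YM v : `|Y v| <= M * 2 * `|v|.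
  rewrite bopBE /= (le_trans (ler_normB _ _))// mulrAC mulr_natr mulr2n lerD//.
  by rewrite (le_trans (PM _))// (le_trans (ZM _))// ler_wpM2l// ltW.
have YP i p : p \in s i -> `|'[p.1, Y p.2]| <= d * (M * (`|p.1| + `|p.2|)).
  move=> ps.
  have zi x : x \in [:: p.1; p.2] -> x \in z.
    move=> xp; apply/flattenP; exists (flatten [seq [:: p.1; p.2] | p <- s i]).
      by apply: map_f; rewrite mem_enum.
    by apply/flattenP; exists [:: p.1; p.2] => //; apply/mapP; exists p.
  have p1 : `|p.1 - P p.1| <= d by apply/zP/zi; rewrite inE eqxx.
  have p2 : `|p.2 - P p.2| <= d by apply/zP/zi; rewrite !inE eqxx orbT.
  have -> : '[p.1, Y p.2] = '[p.1 - P p.1, Z p.2] + '[P p.1, Z (p.2 - P p.2)].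
    have -> : Y p.2 = Z p.2 - P (Z (P p.2)) by [].
    have Pd x w : '[x, P w] = '[P x, w] by rewrite adjE' Pa.
    by rewrite dotBr Pd dotBl bopB dotBr addrA subrK.
  rewrite (le_trans (ler_normD _ _))// mulrDr mulrDr addrC lerD//.
    rewrite (le_trans (cauchy_schwarz _ _))//.
    rewrite [X in _ <= X]mulrCA [d * _]mulrC mulrCA ler_pM//.
    by rewrite (le_trans (ZM _))// ler_wpM2l// ltW.
  by rewrite (le_trans (cauchy_schwarz _ _))// ler_pM.
rewrite fY (le_trans (fg Y))//.
apply: (@le_trans _ _ (\sum_(i < n) (e / 2 / n.+1%:R +
    \sum_(p <- s i) d * (M * (`|p.1| + `|p.2|))))).
  apply: ler_sum => i _.
  rewrite -[g i Y](subrK (\sum_(p <- s i) '[p.1, Y p.2])).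
  rewrite (le_trans (ler_normD _ _))// lerD//; first exact: sP.
  rewrite (le_trans (ler_norm_sum _ _ _))// !big_seq.
  by apply: ler_sum => p; exact: YP.
rewrite big_split /= sumr_const card_ord [X in _ <= X](splitr e) lerD//.
  rewrite -[_ *+ n]mulr_natr -mulrA ger_pMr ?divr_gt0//.
  by rewrite mulrC ler_pdivrMr// mul1r ler_nat.
rewrite (eq_bigr (fun i => d * \sum_(p <- s i) M * (`|p.1| + `|p.2|)));
  last first.
  by move=> i _; rewrite mulr_sumr.
rewrite -mulr_sumr -/W /d mulrAC -mulrA ger_pMr ?divr_gt0//.
by rewrite ler_pdivrMr// mul1r lerDl.
Qed.

End Ultraweak.

(** * Conditional expectations that preserve a faithful state *)

Section ConditionalExpectation.
Set Implicit Arguments.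
Unset Strict Implicit.
Variables (R : realType) (K K0 : hilbertType R) (rho : {scalar 'B(K)})
  (F : 'B(K0, K)) (khat : tensor K (conj_space K0)) (omega : khat)
  (D0 : set 'B(K0)) (d0 : {linear 'B(K0) -> 'B(K0)}).
Local Notation piK X := (tensop khat khat X (bid (conj_space K0))).
Local Notation cls X := (piK X omega).
Local Notation r0 A := (rho (F \bo A \bo adj F)).
Local Notation d X := (F \bo d0 (adj F \bo X \bo F) \bo adj F).
Hypotheses (isoF : isometric F) (rho1 : rho (bid K) = 1)
  (rhoE : forall A, rho A = '[omega, cls A])
  (omegaF : cls (F \bo adj F) = omega)
  (sepF : forall A, cls (F \bo A \bo adj F) = 0 -> A = 0)
  (D0P : star_subalgebra D0) (d0P : conditional_expectation D0 d0)
  (d0I : forall X : 'B(K0), r0 (d0 X) = r0 X).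

Let adjFF : adj F \bo F = bid K0. Proof. exact: isometric_adj. Qed.

Lemma cls_comp A B : piK A (cls B) = cls (A \bo B).
Proof. by rewrite -[LHS]/((piK A \bo piK B) omega) tensop_comp bcomp1. Qed.

Lemma clsB A B : cls (A - B) = cls A - cls B.
Proof. by rewrite tensopBl. Qed.

Lemma dot_cls A B : '[cls A, cls B] = rho (adj A \bo B).
Proof. by rewrite adjE tensop_adj adj_bid cls_comp rhoE. Qed.

Lemma omega_unit : '[omega, omega] = 1.
Proof. by rewrite -rho1 rhoE tensop1. Qed.

Lemma rho_adj A : rho (adj A) = (rho A)^*%R.
Proof. by rewrite !rhoE -dotC adjE tensop_adj adj_bid. Qed.

Let rho_PFr A : rho (A \bo (F \bo adj F)) = rho A.
Proof. by rewrite !rhoE -cls_comp omegaF. Qed.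

Let rho_PFl A : rho (F \bo adj F \bo A) = rho A.
Proof.
rewrite !rhoE -cls_comp adjE' tensop_adj adj_bid adj_comp adjK.
by rewrite omegaF.
Qed.

Let r0B A B : r0 (A - B) = r0 A - r0 B.
Proof. by rewrite bcompBr bcompBl raddfB. Qed.

Let r0_adj A : r0 (adj A) = (r0 A)^*%R.
Proof. by rewrite -rho_adj !adj_comp adjK bcompA. Qed.

Let r0_faithful (A : 'B(K0)) : r0 (adj A \bo A) = 0 -> A = 0.
Proof.
move=> A0; apply: sepF; apply/eqP; rewrite -dotxx_eq0 dot_cls !adj_comp adjK.
suff -> : F \bo (adj A \bo adj F) \bo (F \bo A \bo adj F)
  = F \bo (adj A \bo A) \bo adj F by rewrite A0.
by rewrite !bcompA -(bcompA _ (adj F) F) adjFF bcomp1.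
Qed.

(** The image of the identity is a projection [e] by positivity and the bimodule
    property. Invariance gives [r0 (1 - e) = 0], so [e = 1] by faithfulness. *)
Lemma condexp_unital : d0 (bid K0) = bid K0.
Proof.
have [cp d0d0 ranD bim] := d0P.
set e := d0 (bid K0).
have De : D0 e by rewrite -ranD; exists (bid K0).
have fix_ A : D0 A -> d0 A = A by rewrite -ranD => -[X _ <-]; exact: d0d0.
have eee : e \bo e \bo e = e \bo e.
  have := bim _ _ (bid K0) De De; rewrite bcomp1 => <-.
  by apply: fix_; case: D0P => _ _ + _; exact.
have ae : adj e = e.
  apply: posop_adj => x.
  have pos1 : posop_mx (const_mx (bid K0) : 'M['B(K0)]_1).
    by move=> y; rewrite !big_ord1 mxE; exact: dot_ge0.
  by have := cp _ _ pos1 (fun=> x); rewrite !big_ord1 !mxE.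
have ee : e \bo e = e.
  apply/eqP; rewrite -subr_eq0; apply/eqP; apply: adj_comp_eq0.
  rewrite adjB adj_comp ae bcompBr !bcompBl.
  by rewrite !bcompA !eee !subrr.
apply/eqP; rewrite eq_sym -subr_eq0; apply/eqP; apply: r0_faithful.
rewrite adjB ae adj_bid bcompBr !bcompBl ee !bcomp1 bcomp1l subrr subr0.
by rewrite r0B d0I subrr.
Qed.

Let d0_range A : D0 (d0 A).
Proof. by case: d0P => _ _ <- _; exists A. Qed.

Let D01 : D0 (bid K0). Proof. by rewrite -condexp_unital. Qed.

Lemma condexp_idem A : d0 (d0 A) = d0 A.
Proof. by case: d0P. Qed.

Let r0l (A B : 'B(K0)) : D0 A -> r0 (A \bo d0 B) = r0 (A \bo B).
Proof.
move=> DA; have [_ _ _ /(_ _ _ B DA D01)] := d0P; rewrite !bcomp1 => <-.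
exact: d0I.
Qed.

Let r0r (A B : 'B(K0)) : D0 B -> r0 (d0 A \bo B) = r0 (A \bo B).
Proof.
move=> DB; have [_ _ _ /(_ _ _ A D01 DB)] := d0P; rewrite !bcomp1l => <-.
exact: d0I.
Qed.

Let rho_cut_l (A : 'B(K0)) (Y : 'B(K)) : rho (F \bo A \bo adj F \bo Y) = r0 (A
  \bo (adj F \bo Y \bo F)).
Proof. by rewrite -rho_PFr !bcompA. Qed.

Let rho_cut_r (A : 'B(K0)) (Y : 'B(K)) : rho (Y \bo (F \bo A \bo adj F)) = r0
  (adj F \bo Y \bo F \bo A).
Proof. by rewrite -rho_PFl !bcompA. Qed.

Lemma rho_condexp_swap Z Y : rho (d Z \bo Y) = rho (Z \bo d Y).
Proof.
by rewrite rho_cut_l [RHS]rho_cut_r -[LHS]r0l// -[RHS]r0r.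
Qed.

(** Both sides are the inner product of [d0 x] and [d0 z], where [x] and [z] are
    the compressions of [X] and [Z]. *)
Lemma rho_condexp_adj X Z : rho (adj X \bo d Z) = rho (adj (d X) \bo Z).
Proof.
have aD A : D0 A -> D0 (adj A) by case: D0P => _ _ _; exact.
set x := adj F \bo X \bo F; set z := adj F \bo Z \bo F.
have -> : adj (F \bo d0 x \bo adj F) = F \bo adj (d0 x) \bo adj F.
  by rewrite !adj_comp adjK bcompA.
rewrite rho_cut_r rho_cut_l -/z -[RHS]r0l; last exact: aD.
have -> : adj F \bo adj X \bo F = adj x by rewrite /x !adj_comp adjK bcompA.
have star a b : r0 (adj a \bo b) = (r0 (adj b \bo a))^*%R.
  by rewrite -r0_adj adj_comp adjK.
by rewrite star -r0l ?[RHS]star//; exact: aD.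
Qed.

Lemma d_range (A : 'B(K0)) : d (F \bo d0 A \bo adj F) = F \bo d0 A \bo adj F.
Proof.
congr (F \bo _ \bo adj F).
by rewrite -!bcompA adjFF bcomp1 bcompA adjFF bcomp1l condexp_idem.
Qed.

End ConditionalExpectation.

(** * Matrix blocks with respect to the splitting off of [omega] *)

Section Blocks.
Set Implicit Arguments.
Unset Strict Implicit.
Variables (R : realType) (h k_ : hilbertType R) (T : tensor h k_) (omega : k_).
Local Notation Delta := (orthproj (closure
  (lspan [set u \ox[T] x | u in [set: h] & x in orthocompl1 omega]))).

Let SS : subspace (closure (lspan
  [set u \ox[T] x | u in [set: h] & x in orthocompl1 omega])).
Proof. by apply: closure_subspace; exact: lspan_subspace. Qed.

Lemma EketB (x y : k_) : Eket T (x - y) = Eket T x - Eket T y.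
Proof. by apply: bopP => u; rewrite bopBE; exact: (bopB (Lket T u)). Qed.

Lemma EbraB (x y : k_) : Ebra T (x - y) = Ebra T x - Ebra T y.
Proof. by rewrite /Ebra EketB adjB. Qed.

Lemma Delta_ket x : orthocompl1 omega x -> Delta \bo Eket T x = Eket T x.
Proof.
move=> ox; apply: bopP => u /=; apply: orthproj_id => //.
  exact: closure_closure.
by apply/subset_closure/lspan_in; exists u => //; exists x.
Qed.

(** The vectors killed by [Ebra T omega] form a closed subspace that contains
  the
    range of [Delta]. *)
Lemma Delta_ket_omega : Delta \bo Eket T omega = 0.
Proof.
apply: bopP => u /=; apply: orthproj_eq0 => //; first exact: closure_closure.
move=> y Ny.
pose Z : set T := [set z | (Ebra T omega) z = 0].
have ZS : subspace Z.
  by split=> [|c z w]; rewrite /Z /mkset ?bop0// bop_lin => -> ->;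
    rewrite scaler0 addr0.
have Zcl : closure Z `<=` Z.
  apply: (preimage_closed (A := Ebra T omega) (S := [set 0])).
  by have /closure_id <- : closed [set 0 : h]
    by apply: accessible_closed_set1; exact: hausdorff_accessible.
have : Z y.
  apply: Zcl; apply: closureS Ny; apply: lspan_subset => //.
  by move=> _ [v _ [x xo <-]]; rewrite /Z /mkset EbraE xo scale0r.
by move=> Zy; rewrite -[X in '[_, X]]/(Eket T omega u) adjE' -/(Ebra T omega)
  Zy dot0l.
Qed.

Lemma bra_Delta x : orthocompl1 omega x -> Ebra T x \bo Delta = Ebra T x.
Proof.
by move=> ox; rewrite -(orthproj_adj SS (@closure_closure _ _ _)) -adj_comp
  Delta_ket.
Qed.

Lemma bra_Delta_omega : Ebra T omega \bo Delta = 0.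
Proof.
rewrite -(orthproj_adj SS (@closure_closure _ _ _)) -adj_comp Delta_ket_omega.
by apply: adj_unique => x y; rewrite dot0l dot0r.
Qed.

Local Notation Deltaperp := (bid T - Delta).

Section Blocks.
Variables A B C E : 'B(T).
Let Psi := Deltaperp \bo A \bo Deltaperp + Deltaperp \bo B \bo Delta
  + Delta \bo C \bo Deltaperp + Delta \bo E \bo Delta.

Let compress (X Y : 'B(h, T)) (Z : 'B(T, h)) (W : 'B(T, h)) (P Q Q' : 'B(T)) :
  W \bo P = Z -> Q' \bo X = Y -> W \bo (P \bo Q \bo Q') \bo X = Z \bo Q \bo Y.
Proof. by move=> <- <-; rewrite !bcompA. Qed.

Let PsiE (W : 'B(T, h)) (X : 'B(h, T)) : W \bo Psi \bo X =
  W \bo (Deltaperp \bo A \bo Deltaperp) \bo X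
  + W \bo (Deltaperp \bo B \bo Delta) \bo X
  + W \bo (Delta \bo C \bo Deltaperp) \bo X
  + W \bo (Delta \bo E \bo Delta) \bo X.
Proof. by rewrite /Psi !bcompDr !bcompDl. Qed.

Let Dperp_ket x : orthocompl1 omega x -> Deltaperp \bo Eket T x = 0.
Proof. by move=> ox; rewrite bcompBl bcomp1l Delta_ket// subrr. Qed.

Let Dperp_omega : Deltaperp \bo Eket T omega = Eket T omega.
Proof. by rewrite bcompBl bcomp1l Delta_ket_omega subr0. Qed.

Let bra_Dperp x : orthocompl1 omega x -> Ebra T x \bo Deltaperp = 0.
Proof. by move=> ox; rewrite bcompBr bcomp1 bra_Delta// subrr. Qed.

Let omega_Dperp : Ebra T omega \bo Deltaperp = Ebra T omega.
Proof. by rewrite bcompBr bcomp1 bra_Delta_omega subr0. Qed.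

(** In each compression [Delta] and [Deltaperp] act on the outer vectors as
    identity or zero, which leaves one of the four summands. *)
Lemma block00 : Ebra T omega \bo Psi \bo Eket T omega
  = Ebra T omega \bo A \bo Eket T omega.
Proof.
rewrite PsiE !(compress _ omega_Dperp Dperp_omega) !(compress _ omega_Dperp
  Delta_ket_omega).
rewrite !(compress _ bra_Delta_omega Dperp_omega) !(compress _ bra_Delta_omega
  Delta_ket_omega).
by rewrite !bcomp0r !bcomp0l !addr0.
Qed.

Lemma block01 x : orthocompl1 omega x ->
  Ebra T omega \bo Psi \bo Eket T x = Ebra T omega \bo B \bo Eket T x.
Proof.
move=> ox; have D1 := Dperp_ket ox; have D2 := Delta_ket ox.
rewrite PsiE !(compress _ omega_Dperp D1) !(compress _ omega_Dperp D2).
rewrite !(compress _ bra_Delta_omega D1) !(compress _ bra_Delta_omega D2).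
by rewrite !bcomp0r !bcomp0l !addr0 add0r.
Qed.

Lemma block10 x : orthocompl1 omega x ->
  Ebra T x \bo Psi \bo Eket T omega = Ebra T x \bo C \bo Eket T omega.
Proof.
move=> ox; have D1 := bra_Dperp ox; have D2 := bra_Delta ox.
rewrite PsiE !(compress _ D1 Dperp_omega) !(compress _ D1 Delta_ket_omega).
rewrite !(compress _ D2 Dperp_omega) !(compress _ D2 Delta_ket_omega).
by rewrite !bcomp0r !bcomp0l !addr0 add0r.
Qed.

Lemma block11 x y : orthocompl1 omega x -> orthocompl1 omega y ->
  Ebra T x \bo Psi \bo Eket T y = Ebra T x \bo E \bo Eket T y.
Proof.
move=> ox oy; have B1 := bra_Dperp ox; have B2 := bra_Delta ox.
have D1 := Dperp_ket oy; have D2 := Delta_ket oy.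
rewrite PsiE !(compress _ B1 D1) !(compress _ B1 D2).
rewrite !(compress _ B2 D1) !(compress _ B2 D2).
by rewrite !bcomp0r !bcomp0l !add0r.
Qed.

End Blocks.
End Blocks.

(** * Dimension counting *)

Section Dimension.
Set Implicit Arguments.
Unset Strict Implicit.
Variables (R : realType).

Section Lmod.
Variable E : lmodType R[i].
Implicit Types S : set E.

Lemma lspan_seqP (s : seq E) x : lspan [set` s] x ->
  exists c : 'I_(size s) -> R[i], x = \sum_i c i *: s`_i.
Proof.
move: x; apply: lspan_subset.
  split; first by exists (fun=> 0); rewrite big1// => i _; rewrite scale0r.
  move=> c _ _ [a ->] [b ->]; exists (fun i => c * a i + b i).
  rewrite scaler_sumr -big_split /=; apply: eq_bigr => i _.
  by rewrite scalerA scalerDl.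
move=> x /= xs; have xi : (index x s < size s)%N by rewrite index_mem.
exists (fun i => (i == Ordinal xi)%:R).
rewrite (bigD1 (Ordinal xi))//= eqxx scale1r nth_index// big1 ?addr0//.
by move=> i /negPf ->; rewrite scale0r.
Qed.

(** The coefficients of too many vectors form a matrix with a nonzero left
    kernel, which is a linear relation. *)
Lemma lin_indep_leq m (v : 'I_m -> E) (s : seq E) :
  lin_indep v -> (forall i, lspan [set` s] (v i)) -> (m <= size s)%N.
Proof.
move=> vi vs; rewrite leqNgt; apply/negP => sm.
have /choice[M Mv] i := lspan_seqP (vs i).
pose A : 'M[R[i]]_(m, size s) := \matrix_(i, j) M i j.
have : kermx A != 0.
  rewrite kermx_eq0 /row_free neq_ltn (leq_ltn_trans (rank_leq_col _))//.
rewrite -nz_row_eq0 => /eqP; apply.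
set u := nz_row _.
have uA : u *m A = 0 by apply/sub_kermxP; exact: nz_row_sub.
apply/rowP => i; rewrite mxE; apply: (vi (fun i => u 0 i)).
transitivity (\sum_(j < size s) (u *m A) 0 j *: s`_j); last first.
  by rewrite big1// => j _; rewrite uA mxE scale0r.
rewrite (eq_bigr (fun i => \sum_(j < size s) (u 0 i * A i j) *: s`_j));
  last first.
  move=> k _; rewrite Mv scaler_sumr; apply: eq_bigr => j _.
  by rewrite scalerA mxE.
rewrite exchange_big; apply: eq_bigr => j _ /=.
by rewrite mxE scaler_suml.
Qed.

Lemma range_codom m (v : 'I_m -> E) : range v = [set` codom v].
Proof.
apply/seteqP; split=> x /=; first by move=> [i _ <-]; exact: codom_f.
by move=> /codomP[i ->]; exists i.
Qed.

(** A linearly independent family of maximal size spans. *)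
Lemma exists_dim S n : subspace S ->
  (forall m (v : 'I_m -> E), lin_indep v -> (forall i, S (v i)) ->
    (m <= n)%N) ->
  exists2 m, (m <= n)%N & has_dim S m.
Proof.
move=> SS Sn.
pose P m := `[< exists v : 'I_m -> E, lin_indep v /\ forall i, S (v i) >].
have P0 : exists m, P m.
  by exists 0%N; apply/asboolP; exists (fun=> 0); split; [move=> c _ []|case].
have Pn m : P m -> (m <= n)%N.
  by move=> /asboolP[v [vi vS]]; exact: Sn vi vS.
case: (ex_maxnP P0 Pn) => m /asboolP[v [vi vS]] mmax.
exists m; first exact: Sn vi vS.
exists v; split=> //; apply/seteqP; split.
  by apply: lspan_subset => // _ [i _ <-].
move=> x Sx; apply: contrapT => nx.
suff /mmax : P m.+1 by rewrite ltnn.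
apply/asboolP; exists (fun i => oapp v x (unlift ord0 i)); split; last first.
  by move=> i; case: (unlift ord0 i) => [j|] /=.
move=> c; rewrite big_ord_recl unlift_none /= => c0.
have csum : \sum_(i < m) c (lift ord0 i) *: oapp v x (unlift ord0 (lift ord0 i))
    = \sum_(i < m) c (lift ord0 i) *: v i.
  by apply: eq_bigr => i _; rewrite liftK.
rewrite csum in c0.
have c00 : c ord0 = 0.
  apply/eqP/negPn/negP => cn0; apply: nx.
  have -> : x = (- (c ord0)^-1) *: \sum_(i < m) c (lift ord0 i) *: v i.
    move/eqP: c0; rewrite addrC addr_eq0 => /eqP ->.
    by rewrite scalerN scaleNr opprK scalerA mulVf// scale1r.
  apply: subspaceZ; first exact: lspan_subspace.
  by exists m, (fun i => c (lift ord0 i)), v; split=> // i; exists i.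
move: c0; rewrite c00 scale0r add0r => /vi cl i.
by case: (unliftP ord0 i) => [j ->|->//]; exact: cl.
Qed.

Lemma has_dim_unique S m n : has_dim S m -> has_dim S n -> m = n.
Proof.
suff le a b : has_dim S a -> has_dim S b -> (a <= b)%N.
  by move=> Sm Sn; apply/eqP; rewrite eqn_leq !le.
move=> [v [vi vS]] [w [wi wS]].
rewrite -[b]card_ord -(size_codom w); apply: (lin_indep_leq vi) => i.
by rewrite -range_codom wS -vS; apply: lspan_in; exists i.
Qed.

Lemma dimensionE S n : has_dim S n -> dimension S = n.
Proof.
move=> Sn; apply: (has_dim_unique _ Sn).
exact: (@xgetPex _ 0%N [set m | has_dim S m] (ex_intro _ n Sn)).
Qed.

End Lmod.

Section Onseq.
Variable H : hilbertType R.
Implicit Types s t : seq H.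

Lemma onseq_nth t (i j : 'I_(size t)) : onseq t -> '[t`_i, t`_j] = (i == j)%:R.
Proof.
by move=> [ut ot]; rewrite ot ?mem_nth// nth_uniq.
Qed.

Lemma onseq_lin_indep t : onseq t -> lin_indep (fun i : 'I_(size t) => t`_i).
Proof.
move=> ot c c0 i; have := congr1 (dot t`_i) c0.
rewrite dot0r dot_sumr (bigD1 i)//= big1 => [|j ji].
  by rewrite addr0 dotZr onseq_nth// eqxx mulr1.
by rewrite dotZr onseq_nth// eq_sym (negPf ji) mulr0.
Qed.

Lemma onseq_leq s t : onseq s -> {in s, forall x, lspan [set` t] x} ->
  (size s <= size t)%N.
Proof.
move=> os st; apply: (lin_indep_leq (onseq_lin_indep os)) => i.
by apply: st; exact: mem_nth.
Qed.

Lemma range_nth t : range (fun i : 'I_(size t) => t`_i) = [set` t].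
Proof.
apply/seteqP; split=> x /=; first by move=> [i _ <-]; exact: mem_nth.
move=> xt; have xi : (index x t < size t)%N by rewrite index_mem.
by exists (Ordinal xi) => //=; rewrite nth_index.
Qed.

Lemma exists_onseq n : has_dim [set: H] n ->
  exists t, [/\ onseq t, size t = n & lspan [set` t] = setT].
Proof.
move=> Hn; have [v [vi vH]] := Hn.
have [t [ot vt _]] := gram_schmidt (codom v) (onseq_nil H).
have tT : lspan [set` t] = setT.
  apply/seteqP; split=> // x _; have : lspan (range v) x by rewrite vH.
  rewrite range_codom; apply: lspan_subset; first exact: lspan_subspace.
  by move=> y /= /vt.
exists t; split=> //; apply: has_dim_unique Hn.
by exists (fun i : 'I_(size t) => t`_i); rewrite range_nth; split=> //;
  exact: onseq_lin_indep.
Qed.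

Lemma oproj_bid t : onseq t -> lspan [set` t] = setT -> oproj t = bid H.
Proof. by move=> ot tT; apply: bopP => x; apply: oproj_lspan; rewrite ?tT. Qed.

Lemma onseq_map K (F : 'B(H, K)) t : isometric F -> onseq t ->
  onseq [seq F x | x <- t].
Proof.
move=> iF [ut ot].
have Finj : injective F by move=> x y Fxy;
  rewrite -[x](isometric_adjE _ iF) Fxy isometric_adjE.
split; first by rewrite map_inj_uniq.
move=> _ _ /mapP[x xt ->] /mapP[y yt ->].
by rewrite iF ot// (inj_eq Finj).
Qed.

Lemma onseq_conj t : onseq t -> onseq (t : seq (conj_space H)).
Proof.
move=> [ut ot]; split=> // x y xt yt.
by rewrite -[LHS]/('[(y : H), (x : H)]) ot// eq_sym.
Qed.

Lemma lspan_conj t : onseq t -> lspan [set` t] = setT ->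
  lspan [set` (t : seq (conj_space H))] = setT.
Proof.
move=> ot tT; apply/seteqP; split=> // x _.
have -> : x = oproj (t : seq (conj_space H)) x.
  rewrite -[LHS]/(bid H x) -(oproj_bid ot tT) !oprojE.
  apply: eq_bigr => e _.
  by rewrite -[RHS]/(('[(x : H), (e : H)])^*%R *: (e : H)) -dotC.
exact: oproj_in.
Qed.

End Onseq.

Lemma onseq_tensor (H K : hilbertType R) (T : tensor H K) (s : seq H) (t : seq
  K) :
  onseq s -> onseq t -> onseq [seq x \ox[T] y | x <- s, y <- t].
Proof.
move=> [us os] [ut ot].
have dotE x y x' y' : x \in s -> y \in t -> x' \in s -> y' \in t ->
    '[x \ox[T] y, x' \ox[T] y'] = ((x == x') && (y == y'))%:R.
  by move=> *; rewrite dot_tmul os// ot// -natrM mulnb.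
have inj x y x' y' : x \in s -> y \in t -> x' \in s -> y' \in t ->
    x \ox[T] y = x' \ox[T] y' -> (x, y) = (x', y').
  move=> xs yt xs' yt' xy; have := dotE x y x' y' xs yt xs' yt'.
  rewrite -xy dotE// !eqxx /= => /eqP; rewrite eq_sym pnatr_eq1 eqb1.
  by move=> /andP[/eqP -> /eqP ->].
split.
  apply: allpairs_uniq => // -[x y] [x' y'] /allpairsP[[a b] /= [as_ bt [->
    ->]]].
  by move=> /allpairsP[[a' b'] /= [as' bt' [-> ->]]] /=; exact: inj.
move=> _ _ /allpairsP[[x y] /= [xs yt ->]] /allpairsP[[x' y'] /= [xs' yt' ->]].
rewrite dotE//; congr ((nat_of_bool _)%:R);
  apply/idP/eqP => [/andP[/eqP -> /eqP ->]//|].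
by move=> /(inj _ _ _ _ xs yt xs' yt')[-> ->]; rewrite !eqxx.
Qed.

(** The projection onto the span agrees with the identity on elementary tensors,
    and both are continuous. *)
Lemma tensor_lspan (H K : hilbertType R) (T : tensor H K) (s : seq H) (t : seq
  K) :
  onseq s -> onseq t -> lspan [set` s] = setT -> lspan [set` t] = setT ->
  lspan [set` [seq x \ox[T] y | x <- s, y <- t]] = setT.
Proof.
move=> os ot sT tT; apply/seteqP; split=> // z _.
set w := [seq _ | x <- s, y <- t].
have -> : z = oproj w z.
  rewrite -[LHS]/(bid T z); congr (bop_fun _ z); apply: bop_eq_elem => x y.
  rewrite oproj_lspan//; first exact: onseq_tensor.
  have {1}-> : x = oproj s x by rewrite oproj_bid.
  have -> : y = oproj t y by rewrite oproj_bid.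
  rewrite !oprojE tmul_suml big_seq; apply: subspace_sum => [|e es].
    exact: lspan_subspace.
  rewrite tmulZl tmul_sumr big_seq; apply: subspaceZ;
    first exact: lspan_subspace.
  apply: subspace_sum => [|f ft]; first exact: lspan_subspace.
  rewrite tmulZr; apply: subspaceZ; first exact: lspan_subspace.
  by apply: lspan_in; apply/allpairsP; exists (e, f).
exact: oproj_in.
Qed.

Lemma bop_lspan (H : hilbertType R) (t : seq H) (A : 'B(H)) :
  onseq t -> lspan [set` t] = setT ->
  lspan [set` [seq ketbra x y | x <- t, y <- t]] A.
Proof.
move=> ot tT.
have -> : A = oproj t \bo A \bo oproj t by rewrite oproj_bid// bcomp1 bcomp1l.
rewrite /oproj bcomp_sumr big_seq; apply: subspace_sum => [|y yt].
  exact: lspan_subspace.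
rewrite !bcomp_suml big_seq; apply: subspace_sum => [|x xt].
  exact: lspan_subspace.
have -> : ketbra x x \bo A \bo ketbra y y = '[x, A y] *: ketbra x y.
  by apply: bopP => z /=; rewrite bopZ dotZr mulrC -scalerA.
apply: subspaceZ; first exact: lspan_subspace.
by apply: lspan_in; apply/allpairsP; exists (x, y).
Qed.

End Dimension.

(** * Counting active noises along a flag of subspaces *)

Section NoiseCount.
Set Implicit Arguments.
Unset Strict Implicit.
Variables (R : realType) (h k_ : hilbertType R) (T : tensor h k_) (V : set
  'B(h))
  (omega : k_) (psi : 'B(h) -> 'B(T)) (W1 W2 : set k_).
Hypotheses (omega1 : '[omega, omega] = 1) (W1S : subspace W1) (W2S : subspace
  W2)
  (W12 : W1 `<=` W2) (W1omega : W1 omega)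
  (psi01 : forall x a, W1 x -> '[omega, x] = 0 -> V a ->
     Ebra T omega \bo psi a \bo Eket T x = 0)
  (psi10 : forall x a, W1 x -> '[omega, x] = 0 -> V a ->
     Ebra T x \bo psi a \bo Eket T omega = 0)
  (psi11 : forall x y a, W2 x \/ W2 y -> '[omega, x] = 0 -> '[omega, y] = 0 ->
     V a -> Ebra T x \bo psi a \bo Eket T y = 0).

Let card_ge n a : #|[set i : 'I_n | (a <= i)%N]%SET| = (n - a)%N.
Proof.
rewrite -sum1_card (eq_bigl (fun i : 'I_n => true && (a <= i)%N)); last first.
  by move=> i; rewrite inE.
by rewrite -(big_geq_mkord a n xpredT (fun=> 1%N)) sum_nat_const_nat muln1.
Qed.

(** Gram-Schmidt is run on [omega], then on a basis of [W1], on [w2] and on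
  [w3].
    The basis vectors of index less than [size s1], which is at least [l], lie
      in
    [W1], and those of index less than [size s2], which is at least [size w2],
    lie in [W2]. *)
Lemma noises_along_flag l (v : 'I_l -> k_) (w2 w3 : seq k_) :
  lin_indep v -> (forall i, W1 (v i)) ->
  onseq w2 -> {in w2, forall x, W2 x} -> onseq w3 -> lspan [set` w3] = setT ->
  qsde_noises_at_most V omega psi (2 * (size w3 - l) + (size w3 - size w2) ^
    2)%N.
Proof.
move=> vi vW1 ow2 w2W2 ow3 w3T.
have ooseq : onseq [:: omega].
  by split=> // x y; rewrite !inE => /eqP -> /eqP ->; rewrite omega1 eqxx.
have [t1 [os1 vt1 t1W]] := gram_schmidt (codom v) ooseq.
have [t2 [os2 wt2 t2W]] := gram_schmidt w2 os1.
have [t3 [os3 wt3 _]] := gram_schmidt w3 os2.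
have s1W1 : {in [:: omega] ++ t1, forall x, W1 x}.
  move=> x; rewrite mem_cat => /orP[|/t1W].
    by rewrite inE => /eqP ->.
  apply: lspan_subset => // y; rewrite /= inE => /orP[/eqP -> //|].
  by move=> /codomP[i ->].
have s2W2 : {in ([:: omega] ++ t1) ++ t2, forall x, W2 x}.
  move=> x; rewrite mem_cat => /orP[/s1W1/W12 //|/t2W].
  apply: lspan_subset => // y; rewrite /mkset mem_cat => /orP[/s1W1/W12 //|].
  exact: w2W2.
set s1 := _ ++ t1 in os1 vt1 os2 wt2 s1W1 s2W2 os3 wt3.
set s2 := s1 ++ t2 in os2 wt2 s2W2 os3 wt3.
set s3 := s2 ++ t3 in os3 wt3.
have ls1 : (l <= size s1)%N.
  by apply: (lin_indep_leq vi) => i; apply: vt1; exact: codom_f.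
have w2s2 : (size w2 <= size s2)%N by apply: onseq_leq.
have s3T : lspan [set` s3] = setT.
  apply/seteqP; split=> // x _; have : lspan [set` w3] x by rewrite w3T.
  by apply: lspan_subset; [exact: lspan_subspace|move=> y /= /wt3].
have s3w3 : (size s3 <= size w3)%N by apply: onseq_leq => // x _; rewrite w3T.
pose t := t1 ++ t2 ++ t3.
have s3E : s3 = omega :: t by rewrite /s3 /s2 /s1 /t -!catA.
have tomega i : (i < size t)%N -> '[omega, t`_i] = 0.
  move=> it; have := os3.2 omega t`_i; rewrite s3E !inE eqxx mem_nth// orbT.
  move=> /(_ isT isT) ->; case: eqVneq => // ot.
  by have := os3.1; rewrite s3E /= ot mem_nth.
have ot : onseq t.
  have [us os] := os3; rewrite s3E in us os; split; first by case/andP: us.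
  by move=> x y xt yt; apply: os; rewrite inE ?xt ?yt orbT.
pose e (i : 'I_(size t)) := t`_i.
have eE (i : 'I_(size t).+1) : with_omega omega e i = s3`_i.
  by rewrite /with_omega s3E; case: unliftP => [j ->|->].
exists (size t), e; split.
- by move=> i j; exact: onseq_nth.
- rewrite range_nth; apply/seteqP; split.
    apply: lspan_subset.
      split=> [|c x y]; rewrite /orthocompl1 /mkset ?dot0r// dotDr dotZr => ->
        ->.
      by rewrite mulr0 addr0.
    by move=> x /= xt; rewrite /orthocompl1 /mkset -(nth_index 0 xt) tomega//
      index_mem.
  move=> x xo; have : lspan [set` s3] x by rewrite s3T.
  move=> /(oproj_lspan os3);
    rewrite s3E oprojE big_cons xo scale0r add0r -oprojE.
  by move=> <-; exact: oproj_in.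
pose n := (size t).+1.
have n3 : n = size s3 by rewrite s3E.
pose act (p : 'I_n * 'I_n) := exists2 a, V a &
  Ebra T (with_omega omega e p.1) \bo psi a
    \bo Eket T (with_omega omega e p.2) <> 0.
pose A := [set i : 'I_n | (size s1 <= i)%N]%SET.
pose B := [set i : 'I_n | (size s2 <= i)%N]%SET.
pose C := (finset.setX [set ord0] A :|: finset.setX A [set ord0]
  :|: finset.setX B B)%SET.
have actP (i j : 'I_n) : act (i, j) -> (i, j) != (ord0, ord0) ->
    (i, j) \in C.
  move=> [a Va]; rewrite !eE /= => act_ij; rewrite !inE /= xpair_eqE.
  have s3o (k : 'I_n) : k != ord0 -> '[omega, s3`_k] = 0.
    case: (unliftP ord0 k) => [k' ->|->]; last by rewrite eqxx.
    by move=> _; rewrite s3E; apply: tomega; exact: (ltn_ord k').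
  have s3W1 (k : 'I_n) : (k < size s1)%N -> W1 s3`_k.
    move=> ks; apply: s1W1; rewrite /s3 /s2 -catA nth_cat ks; exact: mem_nth.
  have s3W2 (k : 'I_n) : (k < size s2)%N -> W2 s3`_k.
    by move=> ks; apply: s2W2; rewrite /s3 nth_cat ks; exact: mem_nth.
  case: (eqVneq i ord0) act_ij => [->|i0]; case: (eqVneq j ord0) => [->|j0]//=.
  - move=> act_ij _; rewrite !orbF -[(_ < _)%N]/(size s1 <= j)%N leqNgt.
    apply/negP => js; apply: act_ij; apply: psi01 => //; first exact: s3W1.
    exact: s3o.
  - move=> act_ij _; rewrite andbT andbF orbF -[(size t1 < i)%N]/(size s1 <=
    i)%N leqNgt.
    apply/negP => js; apply: act_ij; apply: psi10 => //; first exact: s3W1.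
    exact: s3o.
  - move=> act_ij _; rewrite andbF /=; apply: contrapT => /negP.
    rewrite negb_and -!ltnNge => ij; apply: act_ij.
    apply: psi11; [|exact: s3o..|exact: Va].
    by case/orP: ij => ?; [left|right]; exact: s3W2.
apply: (@leq_trans #|C|).
  apply: subset_leq_card; apply/fintype.subsetP => -[i j].
  by rewrite inE => /andP[ij0 /asboolP/actP]; exact.
have nl : (n - size s1 <= size w3 - l)%N by rewrite n3 leq_sub.
have nw : (n - size s2 <= size w3 - size w2)%N by rewrite n3 leq_sub.
rewrite (leq_trans (leq_card_setU _ _))// leq_add//.
  rewrite (leq_trans (leq_card_setU _ _))// !cardsX cards1 mul1n muln1 !card_ge.
  by rewrite mul2n -addnn leq_add.
by rewrite cardsX !card_ge -mulnn leq_mul.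
Qed.

End NoiseCount.

(** * Ampliations and ultraweak tensor products of maps *)

Section AmplUltraweak.
Set Implicit Arguments.
Unset Strict Implicit.
Variables (R : realType) (h K L : hilbertType R) (hK : tensor h K)
  (hK_L : tensor hK L) (KL : tensor K L) (h_KL : tensor h KL).
Local Notation pit := (@ampl R h K L hK hK_L KL h_KL).
Local Notation piK X := (tensop KL KL X (bid L)).

Lemma ampl_uw_form (xi eta : h_KL) : uw_form (fun T : 'B(hK) => '[xi, pit T
  eta]).
Proof.
have -> : (fun T : 'B(hK) => '[xi, pit T eta]) = (fun T =>
    '[adj (assocop hK hK_L KL h_KL) xi, tensop hK_L hK_L T (bid L)
       (adj (assocop hK hK_L KL h_KL) eta)]).
  by apply/funext => T; rewrite /ampl /= adjE'.
exact: uw_form_ampl.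
Qed.

Lemma ampl_ket_elem (A : 'B(h)) (X : 'B(K)) x y :
  Ebra h_KL x \bo pit (tensop hK hK A X) \bo Eket h_KL y = '[x, piK X y] *: A.
Proof. by rewrite ampl_tensop Eket_tensop. Qed.

Let ampl_lin c S T (x y : h_KL) :
  '[x, pit (c *: S + T) y] = c * '[x, pit S y] + '[x, pit T y].
Proof.
rewrite -dotZr -dotDr; congr '[_, _]; by rewrite /ampl /= tensop_linl -bop_lin.
Qed.

(** Both sides are ultraweakly continuous in [T], so that it is enough to
  compare
    them on elementary tensors; likewise in [ampl_uwtensor]. *)
Lemma ampl_uwtensor_form (f : 'B(K) -> R[i]) (Phi : {linear 'B(hK) -> 'B(h)}) x
  y :
  is_uwtensor_form f Phi -> (forall X, '[x, piK X y] = f X) ->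
  forall T, Ebra h_KL x \bo pit T \bo Eket h_KL y = Phi T.
Proof.
move=> [uwPhi PhiE] fE T; apply: bopP => v; apply: dot_extl => u.
apply/eqP; rewrite eq_sym -subr_eq0; apply/eqP.
pose g S := '[u, Phi S v] - '[Eket h_KL x u, pit S (Eket h_KL y v)].
have braE S : '[u, (Ebra h_KL x \bo pit S \bo Eket h_KL y) v]
    = '[Eket h_KL x u, pit S (Eket h_KL y v)] by rewrite /= -adjE.
rewrite braE -/(g T); apply: (@uw_form_elem_eq0 _ _ _ hK g).
- move=> c A B; rewrite /g ampl_lin linearP.
  have -> : '[u, (c *: Phi A + Phi B) v] = c * '[u, Phi A v] + '[u, Phi B v].
    by rewrite -dotZr -dotDr.
  by ring.
- apply: uw_continuous_formB; last exact: ampl_uw_form.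
  exact: (uwPhi _ (uw_form_vec u v)).
- move=> A X; rewrite /g -braE ampl_ket_elem PhiE fE.
  by rewrite subrr.
Qed.

Lemma ampl_uwtensor (phi : 'B(K) -> 'B(K)) (Phi : {linear 'B(hK) -> 'B(hK)})
    x y x' y' : is_uwtensor phi Phi ->
  (forall X, '[x, piK (phi X) y] = '[x', piK X y']) ->
  forall T, Ebra h_KL x \bo pit (Phi T) \bo Eket h_KL y
    = Ebra h_KL x' \bo pit T \bo Eket h_KL y'.
Proof.
move=> [uwPhi PhiE] phiE T; apply: bopP => v; apply: dot_extl => u.
apply/eqP; rewrite -subr_eq0; apply/eqP.
pose g S := '[Eket h_KL x u, pit (Phi S) (Eket h_KL y v)]
  - '[Eket h_KL x' u, pit S (Eket h_KL y' v)].
have braE S z w : '[u, (Ebra h_KL z \bo pit S \bo Eket h_KL w) v]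
    = '[Eket h_KL z u, pit S (Eket h_KL w v)] by rewrite /= -adjE.
rewrite !braE -/(g T); apply: (@uw_form_elem_eq0 _ _ _ hK g).
- move=> c A B; rewrite /g linearP !ampl_lin.
  by ring.
- apply: uw_continuous_formB; last exact: ampl_uw_form.
  exact: (uwPhi _ (ampl_uw_form _ _)).
- move=> A X; rewrite /g -!braE PhiE !ampl_ket_elem phiE.
  by rewrite subrr.
Qed.

Lemma ampl_perp_ket (P : 'B(K)) x :
  pit (bid hK - tensop hK hK (bid h) P) \bo Eket h_KL x = Eket h_KL (x - piK P
    x).
Proof.
rewrite amplB ampl1 ampl_tensop EketB bcompBl bcomp1l; congr (_ - _).
by apply: bopP => u; rewrite /= tensopE.
Qed.

Lemma bra_ampl_perp (P : 'B(K)) x : adj P = P ->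
  Ebra h_KL x \bo pit (bid hK - tensop hK hK (bid h) P) = Ebra h_KL (x - piK P
    x).
Proof.
move=> Pa; rewrite /Ebra -ampl_perp_ket adj_comp ampl_adj adjB adj_bid
  tensop_adj.
by rewrite adj_bid Pa.
Qed.

End AmplUltraweak.

(** * Compressions of the coefficient and number of noises *)

Theorem proposition4p7 (R : realType) (h K K0 : hilbertType R)
  (V : set 'B(h)) (V_opspace : operator_space V)
  (rho : {scalar 'B(K)}) (rho_normal : normal_state rho)
  (varrho sqrt_varrho : 'B(K)) (varrho_density : density_matrix rho varrho)
  (sqrt_varrhoP : is_sqrt sqrt_varrho varrho)
  (F0 : 'B(K0, K)) (F0_isometry : isometric F0)
  (F0_range : range F0 = closure (range sqrt_varrho))
  (D0 : set 'B(K0)) (D0_subalgebra : star_subalgebra D0)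
  (d0 : {linear 'B(K0) -> 'B(K0)}) (d0_condexp : conditional_expectation D0 d0)
  (d0_invariant : forall X : 'B(K0),
     rho (F0 \bo d0 X \bo adj F0) = rho (F0 \bo X \bo adj F0))
  (hK : tensor h K) (KK : tensor K (conj_space K))
  (khat : tensor K (conj_space K0))
  (hkhat : tensor h khat) (hK_K0 : tensor hK (conj_space K0))
  (U_K : 'B(K) -> KK) (U_K_iso : is_HS_isomorphism U_K) (omega : khat)
  (omegaP : tensop khat KK (bid K) (conjop F0) omega = U_K sqrt_varrho)
  (delta : {linear 'B(hK) -> 'B(hK)})
  (deltaP : is_uwtensor
     (fun X => F0 \bo d0 (adj F0 \bo X \bo F0) \bo adj F0) delta)
  (rhot : {linear 'B(hK) -> 'B(h)}) (rhotP : is_uwtensor_form rho rhot)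
  (Psi : 'B(h) -> 'B(hK)) (Psi_bounded : Hbounded K V (mtensor hK V) Psi) :
  let P0 := orthproj (closure (range sqrt_varrho)) in
  let P0perp : 'B(K) := bid K - P0 in
  let P0t := tensop hK hK (bid h) P0 in
  let P0tperp : 'B(hK) := bid hK - P0t in
  let d (X : 'B(K)) : 'B(K) := F0 \bo d0 (adj F0 \bo X \bo F0) \bo adj F0 in
  let dperp (X : 'B(K)) : 'B(K) := X - d X in
  let deltaperp (T : 'B(hK)) : 'B(hK) := T - delta T in
  let piK (X : 'B(K)) := tensop khat khat X (bid (conj_space K0)) in
  let cls (X : 'B(K)) : khat := piK X omega in
  let alpha := assocop hK hK_K0 khat hkhat in
  let pit (T : 'B(hK)) :=
    alpha \bo tensop hK_K0 hK_K0 T (bid (conj_space K0)) \bo adj alpha in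
  let k_ := orthocompl1 omega in
  let Delta := orthproj
    (closure (lspan [set u \ox[hkhat] x | u in [set: h] & x in k_])) in
  let Deltaperp : 'B(hkhat) := bid hkhat - Delta in
  let psi (a : 'B(h)) : 'B(hkhat) :=
    Deltaperp \bo pit (Psi a) \bo Deltaperp
    + Deltaperp \bo pit (deltaperp (Psi a)) \bo Delta
    + Delta \bo pit (deltaperp (Psi a)) \bo Deltaperp
    + Delta \bo pit (P0tperp \bo Psi a \bo P0tperp) \bo Delta in
  let Ek := Eket hkhat in
  let Eb := Ebra hkhat in
  (forall X Y : 'B(K), rho X = 0 -> rho Y = 0 -> forall a, V a ->
     [/\ Eb omega \bo psi a \bo Ek omega
           = Eb omega \bo pit (Psi a) \bo Ek omega
         /\ Eb omega \bo pit (Psi a) \bo Ek omega = rhot (Psi a),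
         Eb omega \bo psi a \bo Ek (cls Y)
           = Eb omega \bo pit (Psi a) \bo Ek (cls (dperp Y)),
         Eb (cls X) \bo psi a \bo Ek omega
           = Eb (cls (dperp X)) \bo pit (Psi a) \bo Ek omega &
         Eb (cls X) \bo psi a \bo Ek (cls Y)
           = Eb (cls (P0perp \bo X)) \bo pit (Psi a)
             \bo Ek (cls (P0perp \bo Y))])
  /\
  (finite_dim [set: K] ->
   let N := dimension [set: K] in
   let k := dimension [set: K0] in
   let l := dimension (range d0) in
   [/\ (1 <= k <= N)%N, (1 <= l <= k ^ 2)%N &
       qsde_noises_at_most V omega psi
         (2 * (N * k - l) + (N - k) ^ 2 * k ^ 2)%N]).
Proof.
move=> P0 P0perp P0t P0tperp d dperp deltaperp piK cls alpha pit k_ Delta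
  Deltaperp psi Ek Eb.
have rho1 : rho (bid K) = 1 by case: rho_normal.
have rhoE A : rho A = '[omega, cls A].
  exact: (state_vector varrho_density sqrt_varrhoP F0_isometry U_K_iso omegaP).
have omegaF : cls (F0 \bo adj F0) = omega.
  exact: (proj_omega varrho_density sqrt_varrhoP F0_isometry F0_range U_K_iso
    omegaP).
have sepF A : cls (F0 \bo A \bo adj F0) = 0 -> A = 0.
  exact: (omega_separating varrho_density sqrt_varrhoP F0_isometry F0_range
    U_K_iso omegaP).
have P0E : P0 = F0 \bo adj F0 by exact: (range_proj F0_isometry F0_range).
have P0a : adj P0 = P0 by rewrite P0E adj_comp adjK.
have omega1 : '[omega, omega] = 1 by exact: (omega_unit rho1 rhoE).
have clsk A : rho A = 0 -> k_ (cls A) by rewrite rhoE.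
have pitB S T : pit (S - T) = pit S - pit T by exact: amplB.
have pitM S T : pit (S \bo T) = pit S \bo pit T by exact: ampl_comp.
have clsD A B : cls (A - B) = cls A - cls B by exact: clsB.
have clsM A B : piK A (cls B) = cls (A \bo B) by exact: cls_comp.
have ket_d Y T : Eb omega \bo pit (delta T) \bo Ek (cls Y)
    = Eb omega \bo pit T \bo Ek (cls (d Y)).
  apply: (@ampl_uwtensor _ _ _ _ hK hK_K0 khat hkhat d delta omega (cls Y)
    omega (cls (d Y)) deltaP) => X.
  rewrite !(cls_comp omega) -!rhoE.
  exact: (rho_condexp_swap F0_isometry rhoE omegaF sepF D0_subalgebra
    d0_condexp d0_invariant).
have bra_d X T : Eb (cls X) \bo pit (delta T) \bo Ek omega
    = Eb (cls (d X)) \bo pit T \bo Ek omega.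
  apply: (@ampl_uwtensor _ _ _ _ hK hK_K0 khat hkhat d delta (cls X) omega
    (cls (d X)) omega deltaP) => Z.
  rewrite !(dot_cls rhoE).
  exact: (rho_condexp_adj F0_isometry rhoE omegaF sepF D0_subalgebra d0_condexp
    d0_invariant).
have psi01 Y a : rho Y = 0 -> Eb omega \bo psi a \bo Ek (cls Y)
    = Eb omega \bo pit (Psi a) \bo Ek (cls (dperp Y)).
  move=> Y0.
  transitivity (Eb omega \bo pit (deltaperp (Psi a)) \bo Ek (cls Y)).
    exact: block01 (clsk _ Y0).
  by rewrite pitB bcompBr bcompBl ket_d -bcompBr -EketB -clsD.
have psi10 X a : rho X = 0 -> Eb (cls X) \bo psi a \bo Ek omega
    = Eb (cls (dperp X)) \bo pit (Psi a) \bo Ek omega.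
  move=> X0.
  transitivity (Eb (cls X) \bo pit (deltaperp (Psi a)) \bo Ek omega).
    exact: block10 (clsk _ X0).
  by rewrite pitB bcompBr bcompBl bra_d -!bcompBl -EbraB -clsD.
have psi11 x y a : k_ x -> k_ y -> Eb x \bo psi a \bo Ek y
    = Eb (x - piK P0 x) \bo pit (Psi a) \bo Ek (y - piK P0 y).
  move=> kx ky.
  transitivity (Eb x \bo pit (P0tperp \bo Psi a \bo P0tperp) \bo Ek y).
    exact: block11 kx ky.
  have assoc (p q : 'B(hkhat)) :
      Eb x \bo (p \bo q \bo p) \bo Ek y = (Eb x \bo p) \bo q \bo (p \bo Ek y).
    exact: bopP.
  rewrite !pitM assoc.
  have -> : Eb x \bo pit P0tperp = Eb (x - piK P0 x) by exact: bra_ampl_perp.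
  by have -> : pit P0tperp \bo Ek y = Ek (y - piK P0 y) by exact: ampl_perp_ket.
split.
  move=> X Y X0 Y0 a Va; split.
  - split; first exact: block00.
    by apply: (@ampl_uwtensor_form _ _ _ _ hK hK_K0 khat hkhat rho rhot omega
      omega rhotP) => Z; rewrite rhoE.
  - exact: psi01.
  - exact: psi10.
  - have Pc A : cls (P0perp \bo A) = cls A - piK P0 (cls A).
      by rewrite bcompBl bcomp1l clsD clsM.
    by rewrite !Pc; apply: psi11; exact: clsk.
move=> finK N k l.
have KN : has_dim [set: K] N.
  by case: finK => m Km; rewrite /N (dimensionE Km).
have [eK [onK sK TK]] := exists_onseq KN.
have [k' kN K0k'] : exists2 m, (m <= N)%N & has_dim [set: K0] m.
  apply: exists_dim => // m v vi _; rewrite -sK.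
  apply: (@lin_indep_leq _ _ m (F0 \o v)) => [c c0|i]; last by rewrite TK.
  apply: vi; rewrite -[LHS](isometric_adjE _ F0_isometry) bop_sum.
  rewrite (_ : \sum_(i < m) _ = 0) ?bop0// -[RHS]c0.
  by apply: eq_bigr => i _; rewrite bopZ.
have kE : k = k' by exact: dimensionE.
have [e0 [on0 s0 T0]] := exists_onseq K0k'.
have [l' lk Dl'] : exists2 m, (m <= k' * k')%N & has_dim (range d0) m.
  apply: exists_dim => [|m v vi _].
    split; first by exists 0; rewrite // linear0.
    by move=> c _ _ [A _ <-] [B _ <-]; exists (c *: A + B); rewrite // linearP.
  have := @lin_indep_leq _ _ _ v _ vi (fun i => bop_lspan (v i) on0 T0).
  by rewrite size_allpairs s0.
have lE : l = l' by exact: dimensionE.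
have cls0 : cls 0 = 0 by rewrite -(subrr (bid K)) clsD subrr.
(* If [K0] were zero, then so would be [omega], which is a unit vector. *)
have one_neq0 : bid K0 <> 0.
  move=> K00; have : '[omega, omega] = 0.
    rewrite -{2}omegaF -[F0 \bo adj F0](bcomp1 _) -[adj F0]bcomp1l K00 bcomp0l.
    rewrite bcomp0r bcomp0l.
    by rewrite cls0 dot0r.
  by rewrite omega1 => /eqP; rewrite oner_eq0.
have has0 (E : lmodType R[i]) (S : set E) x : has_dim S 0%N -> S x -> x = 0.
  move=> [v [_ <-]]; move: x;
    apply: (@lspan_subset _ _ _ [set 0]) => [|y [[]//]].
  by split=> // c y z -> ->; rewrite /= scaler0 addr0.
have d01 : d0 (bid K0) = bid K0.
  exact: (condexp_unital F0_isometry rhoE sepF D0_subalgebra d0_condexp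
    d0_invariant).
split.
- rewrite kE kN andbT lt0n; apply/eqP => k0; apply: one_neq0.
  by apply: bopP => x; rewrite k0 in K0k'; exact: (has0 _ _ _ K0k').
- rewrite lE kE -mulnn lk andbT lt0n; apply/eqP => l0; apply: one_neq0.
  by rewrite l0 in Dl'; apply: (has0 _ _ _ Dl'); exists (bid K0).
(* [W1] consists of vectors [cls Y] with [dperp Y = 0], so that [psi01] and
   [psi10] vanish at those orthogonal to [omega]. The vectors of [W2] are killed
   by [P0perp \ox 1], so that [psi11] vanishes at them. *)
pose W1 := [set x | exists A, x = cls (F0 \bo d0 A \bo adj F0)].
pose W2 := [set x | piK P0 x = x].
have FFA (A : 'B(K0)) :
    F0 \bo adj F0 \bo (F0 \bo A \bo adj F0) = F0 \bo A \bo adj F0.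
  by rewrite !bcompA -(bcompA F0) isometric_adj// bcomp1.
have [v [vi vD]] := Dl'.
have vd i : exists A, v i = d0 A.
  have : range d0 (v i) by rewrite -vD; apply: lspan_in; exists i.
  by case=> A _ <-; exists A.
have clsl c A B : cls (F0 \bo (c *: A + B) \bo adj F0)
    = c *: cls (F0 \bo A \bo adj F0) + cls (F0 \bo B \bo adj F0).
  have -> : F0 \bo (c *: A + B) \bo adj F0
      = c *: (F0 \bo A \bo adj F0) + F0 \bo B \bo adj F0.
    by apply: bopP => x; exact: (bop_lin F0).
  by rewrite /cls /piK tensop_linl.
pose e0c : seq (conj_space K0) := e0.
pose basis0 := [seq x \ox[khat] y | x <- map F0 e0, y <- e0c].
pose basis := [seq x \ox[khat] y | x <- eK, y <- e0c].
have -> : (2 * (N * k - l) + (N - k) ^ 2 * k ^ 2)%N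
    = (2 * (size basis - l') + (size basis - size basis0) ^ 2)%N.
  by rewrite !size_allpairs size_map sK s0 kE lE -expnMn mulnBl.
have oc : onseq (e0 : seq (conj_space K0)) by exact: onseq_conj.
have Tc : lspan [set` (e0 : seq (conj_space K0))] = setT by exact: lspan_conj.
have W12 : W1 `<=` W2.
  by move=> _ [A ->]; rewrite /W2 /mkset clsM P0E FFA.
have W1S : subspace W1.
  split; first by exists 0; rewrite linear0 bcomp0r bcomp0l cls0.
  move=> c _ _ [A ->] [B ->]; exists (c *: A + B); rewrite linearP clsl //.
have W2S : subspace W2.
  split=> [|c x y]; rewrite /W2 /mkset ?bop0// bop_lin => -> ->; first by [].
have W1omega : W1 omega.
  by exists (bid K0); rewrite d01 bcomp1 omegaF.
have W1E x : W1 x -> '[omega, x] = 0 ->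
    exists2 Y, rho Y = 0 & x = cls Y /\ dperp Y = 0.
  move=> [A ->]; rewrite -rhoE => YA; exists (F0 \bo d0 A \bo adj F0) => //;
    split=> //.
  rewrite /dperp /d (d_range F0_isometry d0_condexp) subrr//.
have ket0 : Ek 0 = 0 by apply: bopP => u; exact: (tmul0r hkhat).
have bra0 : Eb 0 = 0 by rewrite -(subrr (0 : khat)) /Eb EbraB subrr.
apply: (@noises_along_flag _ _ _ _ V omega psi W1 W2 omega1 W1S W2S W12 W1omega
  _ _ _ l' (fun i => cls (F0 \bo v i \bo adj F0))).
- move=> x a W1x ox Va; have [Y Y0 [-> dY]] := W1E _ W1x ox.
  by rewrite (psi01 _ _ Y0) dY cls0 ket0 bcomp0r.
- move=> x a W1x ox Va; have [Y Y0 [-> dY]] := W1E _ W1x ox.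
  by rewrite (psi10 _ _ Y0) dY cls0 bra0 !bcomp0l.
- move=> x y a xy ox oy Va; rewrite (psi11 _ _ _ ox oy); case: xy => W2z.
    by rewrite [X in x - X]W2z subrr bra0 !bcomp0l.
  by rewrite [X in y - X]W2z subrr ket0 bcomp0r.
- move=> c c0; apply: vi; apply: sepF.
  have := c0.
  have clssum (J : seq 'I_l') :
      cls (F0 \bo (\sum_(i <- J) c i *: v i) \bo adj F0)
      = \sum_(i <- J) c i *: cls (F0 \bo v i \bo adj F0).
    elim: J => [|i J IH]; first by rewrite !big_nil bcomp0r bcomp0l cls0.
    by rewrite !big_cons clsl IH.
  by rewrite -clssum.
- by move=> i; have [A ->] := vd i; exists A.
- apply: onseq_tensor => //; exact: onseq_map.
- move=> _ /allpairsP[[x y] /= [/mapP[f _ ->] _ ->]].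
  by rewrite /W2 /mkset /piK tensopE P0E /= isometric_adjE.
- exact: onseq_tensor.
- exact: tensor_lspan.
Qed.
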